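(* Let $(M,H)$ be a foliated filtered manifold, $E\to M$ a filtered vector bundle, $\nabla$ a linear connection on $E$ that preserves the filtration. Then for every $x\in M$ the sequence $(\Lambda^\bullet\mathfrak{t}^*_{H/H^0,x}M\otimes\mathrm{gr}(E_x),\partial^{\overline\omega_x})$, where $\partial^{\overline\omega}=\mathrm{gr}(d_N^\nabla)$, is the Chevalley–Eilenberg type sequence of operators associated to the map $\overline\omega_x\colon\mathfrak{t}_{H/H^0,x}M\to\mathrm{End}(\mathrm{gr}(E_x))$; that is, for $\mu\in\Lambda^k\mathfrak{t}^*_{H/H^0,x}M\otimes\mathrm{gr}(E_x)$ and $\xi_1,\dots,\xi_{k+1}\in\mathfrak{t}_{H/H^0,x}M$, $$\partial^{\overline\omega_x}\mu(\xi_1,\dots,\xi_{k+1})=\sum_{j=1}^{k+1}(-1)^{j+1}\overline\omega_x(\xi_j)\mu(\xi_1,\dots,\widehat{\xi_j},\dots,\xi_{k+1})+\sum_{i<j}(-1)^{i+j}\mu([\xi_i,\xi_j],\xi_1,\dots,\widehat{\xi_i},\dots,\widehat{\xi_j},\dots,\xi_{k+1}).$$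
   Context: **Foliated filtered manifold.** A manifold $M$ with subbundles $H^0\subset H^{-1}\subset\dots\subset H^{-r}=TM$ such that $[\Gamma(H^{-i}),\Gamma(H^{-j})]\subset\Gamma(H^{-i-j})$ for all $i,j\ge0$ ($H^{-i}=TM$ for $i\ge r$); in particular $H^0$ is a foliation. $\mathfrak{t}_{H/H^0}M=H^{-1}/H^0\oplus H^{-2}/H^{-1}\oplus\dots\oplus H^{-r}/H^{-r+1}$ is a bundle of graded nilpotent Lie algebras, with bracket induced by that of vector fields. **Filtered bundle and connection.** $E$ has a finite decreasing filtration by subbundles $E^p\supseteq E^{p+1}$, $\mathrm{gr}_p(E)=E^p/E^{p+1}$, $\mathrm{gr}(E)=\bigoplus_p\mathrm{gr}_p(E)$. $\nabla$ preserves the filtration if $\nabla_X\psi\in\Gamma(E^{p+q})$ for $X\in\Gamma(H^p)$, $p\le0$, $\psi\in\Gamma(E^q)$. **The map $\overline\omega$.** For $i\ge1$, $X\in\Gamma(H^{-i})$, $\psi\in\Gamma(E^q)$, the class of $\nabla_X\psi$ in $E^{q-i}/E^{q-i+1}$ depends tensorially on the classes of $X$ in $H^{-i}/H^{-i+1}$ (in $H^{-1}/H^0$ if $i=1$) and of $\psi$ in $E^q/E^{q+1}$. This defines the linear map $\overline\omega_x\colon\mathfrak{t}_{H/H^0,x}M\to\mathrm{End}(\mathrm{gr}(E_x))$. **Transverse sequence.** Fix $N\subset TM$ with $TM=H^0\oplus N$. $\Lambda^{i,j}T^*M=\Lambda^iN^*\otimes\Lambda^j(H^0)^*$, $\Omega^{i,j}(M,E)=\Gamma(\Lambda^{i,j}T^*M\otimes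 E)$, and $d^\nabla_N\colon\Omega^{k,0}(M,E)\to\Omega^{k+1,0}(M,E)$ is the bidegree $(1,0)$ component of the exterior covariant derivative $d^\nabla$. $\Lambda^{k,0}T^*M\cong\Lambda^k(TM/H^0)^*$ is filtered by giving $(H^{-p}/H^{-p+1})^*$ degree $p\ge1$; $\Lambda^{k,0}T^*M\otimes E$ has the tensor product filtration, with associated graded $\Lambda^k\mathfrak{t}^*_{H/H^0}M\otimes\mathrm{gr}(E)$. The operator $d_N^\nabla$ preserves these filtrations and its associated graded $\mathrm{gr}(d_N^\nabla)\colon\Lambda^k\mathfrak{t}^*_{H/H^0}M\otimes\mathrm{gr}(E)\to\Lambda^{k+1}\mathfrak{t}^*_{H/H^0}M\otimes\mathrm{gr}(E)$ is tensorial (a bundle map). The map $\overline\omega_x$ is not assumed to be a Lie algebra representation. *)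

(* Defs.v *)
From HB Require Import structures.
From mathcomp Require Import all_boot all_order all_algebra.
From mathcomp Require Import all_classical all_reals all_analysis.
Set Implicit Arguments.
Unset Strict Implicit.
Unset Printing Implicit Defensive.
Import Order.TTheory GRing.Theory Num.Theory.
Import numFieldNormedType.Exports.
Local Open Scope classical_set_scope.
Local Open Scope ring_scope.

(* Smooth functions on subsets of R^n: all iterated partial derivatives exist
   and are continuous on U (only used for open U). *)
Section EuclideanSmoothness.
Variables (R : realType) (n : nat).

Definition partial (j : 'I_n) (f : 'rV[R]_n -> R^o) : 'rV[R]_n -> R^o :=
  'D_(delta_mx 0 j) f.

Definition smooth_on (U : set 'rV[R]_n) (f : 'rV[R]_n -> R^o) : Prop :=
  forall (js : seq 'I_n) (p : 'rV[R]_n), U p ->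
    {for p, continuous (foldr partial f js)} /\
    forall j : 'I_n, derivable (foldr partial f js) p (delta_mx 0 j).

End EuclideanSmoothness.

Section Manifolds.
Variables (R : realType) (n : nat).

Record chart (T : topologicalType) := Chart {
  cdom : set T;
  cmap : T -> 'rV[R]_n;
  cinv : 'rV[R]_n -> T;
  cdom_open : open cdom;
  cimg_open : open (cmap @` cdom);
  cmapK : forall x, cdom x -> cinv (cmap x) = x;
  cmap_continuous : forall x, cdom x -> {for x, continuous cmap};
  cinv_continuous : forall x, cdom x -> {for cmap x, continuous cinv}
}.

(* The transition map c' o c^-1 is smooth, component by component. *)
Definition compatible (T : topologicalType) (c c' : chart T) : Prop :=
  forall j : 'I_n, smooth_on (cmap c @` (cdom c `&` cdom c'))
    (fun p => cmap c' (cinv c p) 0 j).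

Record manifold := Manifold {
  mspace :> topologicalType;
  atlas : set (chart mspace);
  manifold_hausdorff : hausdorff_space mspace;
  manifold_second_countable : @second_countable mspace;
  atlas_cover : forall x : mspace, exists c, atlas c /\ cdom c x;
  atlas_compatible : forall c c', atlas c -> atlas c' -> compatible c c'
}.

Variable M : manifold.

Definition smooth_fun (W : set M) (f : M -> R) : Prop :=
  forall c, atlas c ->
    smooth_on (cmap c @` (cdom c `&` W)) (fun p => f (cinv c p)).

Definition chart_at (x : M) : chart M := projT1 (cid (atlas_cover x)).

End Manifolds.

Section Bundles.
Variables (R : realType) (n : nat) (M : manifold R n).

(* Fibres together with a family of local coordinate maps; the laws making this
   a vector bundle are in [vector_bundle]. *)
Record bundle_data := BundleData {
  fib :> M -> vectType R;
  triv : Type;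
  tdom : triv -> set M;
  trank : triv -> nat;
  tmap : forall (t : triv) (x : M), fib x -> 'rV[R]_(trank t)
}.

Record vector_bundle := VectorBundle {
  vbdata :> bundle_data;
  tdom_open : forall t : triv vbdata, open (tdom t);
  tdom_cover : forall x : M, exists t : triv vbdata, tdom t x;
  tmap_linear : forall (t : triv vbdata) x, tdom t x -> linear (@tmap vbdata t x);
  tmap_bij : forall (t : triv vbdata) x, tdom t x -> bijective (@tmap vbdata t x);
  tmap_transition : forall t t' : triv vbdata,
    exists g : M -> 'M[R]_(trank t, trank t'),
      (forall i j, smooth_fun (tdom t `&` tdom t') (fun y => g y i j)) /\
      (forall y (v : vbdata y), tdom t y -> tdom t' y ->
         tmap t' v = tmap t v *m g y)
}.

Definition section (B : bundle_data) := forall x : M, B x.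

Definition smooth_section (B : bundle_data) (W : set M) (s : section B) : Prop :=
  forall (t : triv B) (j : 'I_(trank t)),
    smooth_fun (tdom t `&` W) (fun y => tmap t (s y) 0 j).

Definition subfamily (B : bundle_data) := forall x : M, {vspace B x}.

Definition subbundle (B : bundle_data) (S : subfamily B) : Prop :=
  forall x : M, exists (W : set M) (d : nat) (e : 'I_d -> section B),
    [/\ open W, W x, forall i, smooth_section W (e i) &
        forall y, W y -> basis_of (S y) [tuple e i y | i < d]].

Definition Gamma (B : bundle_data) (S : subfamily B) : set (section B) :=
  [set s | smooth_section setT s /\ forall x, s x \in S x].

(* T_xM is R^n, a vector being given by its coordinates in [chart_at x]; its
   coordinates in another chart c are obtained by applying the derivative of the
   transition map from [chart_at x] to c. (That TM satisfies the laws of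
   [vector_bundle] is the chain rule; it is not needed to define its sections.) *)
Definition tangent (x : M) : vectType R := 'rV[R]_n.

Definition tangent_coord (c : chart R n M) (x : M) (v : tangent x) : 'rV[R]_n :=
  'D_(v : 'rV[R]_n) (fun p => cmap c (cinv (chart_at x) p)) (cmap (chart_at x) x).

Definition TM : bundle_data :=
  @BundleData tangent {c : chart R n M | atlas c} (fun c => cdom (sval c))
    (fun=> n) (fun c x v => @tangent_coord (sval c) x v).

Definition vector_field := section TM.

Definition smooth_vf (X : vector_field) : Prop := smooth_section setT X.

Definition derive_fun (X : vector_field) (f : M -> R) (x : M) : R :=
  'D_(X x : 'rV[R]_n) (fun p => f (cinv (chart_at x) p) : R^o)
    (cmap (chart_at x) x).

Definition vf_in_chart (c : chart R n M) (X : vector_field) (p : 'rV[R]_n) :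
    'rV[R]_n :=
  @tangent_coord c (cinv c p) (X (cinv c p)).

(* DY(X) - DX(Y) at x in the coordinates of [chart_at x]. *)
Definition lie (X Y : vector_field) : vector_field := fun x =>
  let c := chart_at x in
  'D_(X x : 'rV[R]_n) (vf_in_chart c Y) (cmap c x) -
  'D_(Y x : 'rV[R]_n) (vf_in_chart c X) (cmap c x).

(* [fH i] is the subbundle H^{-i}. *)
Record foliated_filtration := FoliatedFiltration {
  fH :> nat -> subfamily TM;
  fH_subbundle : forall i, subbundle (fH i);
  fH_incr : forall i x, (fH i x <= fH i.+1 x)%VS;
  fH_full : exists r : nat, forall i x, (r <= i)%N -> fH i x = fullv;
  fH_bracket : forall i j X Y, Gamma (fH i) X -> Gamma (fH j) Y ->
    Gamma (fH (i + j)%N) (lie X Y)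
}.

Definition complement_of (H0 N : subfamily TM) : Prop :=
  subbundle N /\
  forall x, (H0 x + N x)%VS = fullv /\ (H0 x :&: N x)%VS = 0%VS.

Record bundle_filtration (E : vector_bundle) := BundleFiltration {
  fE :> int -> subfamily E;
  fE_subbundle : forall p, subbundle (fE p);
  fE_decr : forall p x, (fE (p + 1) x <= fE p x)%VS;
  fE_full : exists a : int, forall p x, p <= a -> fE p x = fullv;
  fE_zero : exists b : int, forall p x, b <= p -> fE p x = 0%VS
}.

Record connection (E : vector_bundle) := Connection {
  nabla :> vector_field -> section E -> section E;
  nabla_smooth : forall X s, smooth_vf X -> smooth_section setT s ->
    smooth_section setT (nabla X s);
  nablaDl : forall X Y s x, smooth_vf X -> smooth_vf Y ->
    smooth_section setT s ->
    nabla (fun y => X y + Y y) s x = nabla X s x + nabla Y s x;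
  nablaZl : forall (f : M -> R) X s x, smooth_fun setT f -> smooth_vf X ->
    smooth_section setT s ->
    nabla (fun y => f y *: X y) s x = f x *: nabla X s x;
  nablaDr : forall X s s' x, smooth_vf X ->
    smooth_section setT s -> smooth_section setT s' ->
    nabla X (fun y => s y + s' y) x = nabla X s x + nabla X s' x;
  nabla_Leibniz : forall (f : M -> R) X s x, smooth_fun setT f -> smooth_vf X ->
    smooth_section setT s ->
    nabla X (fun y => f y *: s y) x =
      derive_fun X f x *: s x + f x *: nabla X s x
}.

Definition preserves_filtration (H : foliated_filtration) (E : vector_bundle)
    (F : bundle_filtration E) (D : connection E) : Prop :=
  forall (i : nat) (q : int) X s, Gamma (H i) X -> Gamma (F q) s ->
    Gamma (F (q - i%:Z)) (D X s).

End Bundles.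

Section LinearAlgebra.
Variable R : realType.

(* For W <= U, the quotient U/W is realized on the complement U :\: W of W in U;
   [qcls U W] sends v in U to its class: it is linear, maps U onto U :\: W, and
   its restriction to U has kernel W. *)
Definition quotv (V : vectType R) (U W : {vspace V}) : vectType R :=
  subvs_of (U :\: W)%VS.

Definition qcls (V : vectType R) (U W : {vspace V}) (v : V) : quotv U W :=
  vsproj (U :\: W)%VS (addv_pi1 U W v).

(* Graded vector spaces. The families Q to which this is applied vanish outside
   a finite set of degrees, so that the product is the direct sum. *)
Definition gsum (I : eqType) (Q : I -> lmodType R) : Type := forall i, Q i.

Section GsumInstances.
Variables (I : eqType) (Q : I -> lmodType R).
HB.instance Definition _ := Choice.copy (gsum Q) (forall i, Q i).
Let add (f g : gsum Q) : gsum Q := fun i => f i + g i.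
Let opp (f : gsum Q) : gsum Q := fun i => - f i.
Let scale (a : R) (f : gsum Q) : gsum Q := fun i => a *: f i.
Let addA : associative add.
Proof. by move=> f g h; apply: functional_extensionality_dep => i; exact: addrA. Qed.
Let addC : commutative add.
Proof. by move=> f g; apply: functional_extensionality_dep => i; exact: addrC. Qed.
Let add0 : left_id ((fun i => 0) : gsum Q) add.
Proof. by move=> f; apply: functional_extensionality_dep => i; exact: add0r. Qed.
Let addN : left_inverse ((fun i => 0) : gsum Q) opp add.
Proof. by move=> f; apply: functional_extensionality_dep => i; exact: addNr. Qed.
HB.instance Definition _ := GRing.isZmodule.Build (gsum Q) addA addC add0 addN.
Let scaleA a b f : scale a (scale b f) = scale (a * b) f.
Proof. by apply: functional_extensionality_dep => i; exact: scalerA. Qed.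
Let scale1 : left_id 1 scale.
Proof. by move=> f; apply: functional_extensionality_dep => i; exact: scale1r. Qed.
Let scaleDr : right_distributive scale +%R.
Proof. by move=> a f g; apply: functional_extensionality_dep => i; exact: scalerDr. Qed.
Let scaleDl f : {morph scale^~ f : a b / a + b}.
Proof. by move=> a b; apply: functional_extensionality_dep => i; exact: scalerDl. Qed.
HB.instance Definition _ :=
  GRing.Zmodule_isLmodule.Build R (gsum Q) scaleA scale1 scaleDr scaleDl.

Definition gin (i : I) (v : Q i) : gsum Q :=
  @dfwith I (fun j => Q j) (fun=> 0) i v.
End GsumInstances.

Definition bilinear_map (U V W : lmodType R) (f : U -> V -> W) : Prop :=
  (forall v, linear (f^~ v)) /\ (forall u, linear (f u)).

(* Lambda^k V^* (x) W is the space of alternating k-linear maps V^k -> W. *)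
Definition alternating_map (k : nat) (V W : lmodType R) (m : ('I_k -> V) -> W) :
    Prop :=
  (forall (w : 'I_k -> V) (i : 'I_k) (a : R) (u v : V),
     m [eta w with i |-> a *: u + v] =
       a *: m [eta w with i |-> u] + m [eta w with i |-> v]) /\
  (forall (w : 'I_k -> V) (i j : 'I_k), i != j -> w i = w j -> m w = 0).

End LinearAlgebra.

(* For i < j, the k arguments (z, w_0, .., w_k) with w_i and w_j omitted. *)
Definition del2 (T : Type) (k : nat) (i j : 'I_k.+1) (z : T) (w : 'I_k.+1 -> T) :
    'I_k -> T :=
  fun m => if (m : nat) == 0%N then z else w (inord (bump j (bump i m.-1))).

(* The Chevalley-Eilenberg formula for a bracket [br] and a map [rho]; with
   indices starting at 0, the signs (-1)^(j+1) and (-1)^(i+j) of the formula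
   with indices starting at 1 become (-1)^j and (-1)^(i+j). *)
Definition CE_formula (R : realType) (L V : lmodType R) (br : L -> L -> L)
    (rho : L -> V -> V) (k : nat) (mu : ('I_k -> L) -> V) (xi : 'I_k.+1 -> L) : V :=
  \sum_(j < k.+1) (-1) ^+ j *: rho (xi j) (mu (fun l => xi (lift j l))) +
  \sum_(i < k.+1) \sum_(j < k.+1 | (i < j)%N)
    (-1) ^+ (i + j) *: mu (del2 i j (br (xi i) (xi j)) xi).

Section Forms.
Variables (R : realType) (n : nat) (M : manifold R n) (E : vector_bundle M).

Definition form (k : nat) := forall x : M, ('I_k -> TM M x) -> E x.

Definition smooth_form (k : nat) (alpha : form k) : Prop :=
  (forall x, alternating_map (alpha x)) /\
  (forall X : 'I_k -> vector_field M, (forall i, smooth_vf (X i)) ->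
     smooth_section setT (fun x => alpha x (fun i => X i x) : E x)).

Variable D : connection E.

Definition Koszul (k : nat) (alpha : form k) (X : 'I_k.+1 -> vector_field M)
    (x : M) : E x :=
  \sum_(j < k.+1)
    (-1) ^+ j *: D (X j) (fun y => alpha y (fun l => X (lift j l) y)) x +
  \sum_(i < k.+1) \sum_(j < k.+1 | (i < j)%N)
    (-1) ^+ (i + j) *: alpha x (del2 i j (lie (X i) (X j) x) (fun l => X l x)).

(* The exterior covariant derivative: the form whose value on smooth vector
   fields is given by the Koszul formula (unique, since every tangent vector
   extends to a smooth vector field). *)
Definition ext_cov_derivative (k : nat) (alpha : form k) : form k.+1 :=
  xget ((fun _ _ => 0) : {classic form k.+1})
    [set beta : form k.+1 | forall X, (forall i, smooth_vf (X i)) ->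
       forall x, beta x (fun i => X i x) = Koszul alpha X x].

End Forms.

Section Transverse.
Variables (R : realType) (n : nat) (M : manifold R n).
Variables (H : foliated_filtration M) (E : vector_bundle M).
Variables (F : bundle_filtration E) (D : connection E) (N : subfamily (TM M)).

(* Forms of bidegree (k,0), i.e. sections of Lambda^k N^* (x) E, where N^* is
   the annihilator of H^0. *)
Definition form_k0 (k : nat) (alpha : form E k) : Prop :=
  smooth_form alpha /\
  forall x v (i : 'I_k), v i \in H 0%N x -> alpha x v = 0.

(* Evaluation on the projections to N along H^0 extracts the component of
   bidegree (k,0) of a k-form. *)
Definition component_k0 (k : nat) (alpha : form E k) : form E k :=
  fun x v => alpha x (fun i => daddv_pi (N x) (H 0%N x) (v i)).

Definition dN (k : nat) (alpha : form E k) : form E k.+1 :=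
  component_k0 (ext_cov_derivative D alpha).

Variable x : M.

(* The component of index i has degree -(i+1). *)
Definition tspace : lmodType R :=
  gsum (fun i : nat => quotv (H i.+1 x) (H i x) : lmodType R).

Definition tcls (i : nat) (v : TM M x) : tspace :=
  gin (Q := fun i : nat => quotv (H i.+1 x) (H i x) : lmodType R)
    (i := i) (qcls (H i.+1 x) (H i x) v).

Definition grE : lmodType R :=
  gsum (fun p : int => quotv (F p x) (F (p + 1) x) : lmodType R).

Definition grEcls (p : int) (e : E x) : grE :=
  gin (Q := fun p : int => quotv (F p x) (F (p + 1) x) : lmodType R)
    (i := p) (qcls (F p x) (F (p + 1) x) e).

(* The maps induced by the bracket of vector fields and by the connection; each
   is the only map with the stated property, since every vector of H^{-i} or E^q
   at x extends to a section.
   The bracket of degrees -(i+1) and -(j+1) has degree -(i+j+2). *)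
Definition tbracket : tspace -> tspace -> tspace :=
  xget ((fun _ _ => 0) : {classic tspace -> tspace -> tspace})
    [set br : tspace -> tspace -> tspace | bilinear_map br /\
       forall (i j : nat) X Y, Gamma (H i.+1) X -> Gamma (H j.+1) Y ->
         br (tcls i (X x)) (tcls j (Y x)) = tcls (i + j).+1 (lie X Y x)].

Definition omegabar : tspace -> grE -> grE :=
  xget ((fun _ _ => 0) : {classic tspace -> grE -> grE})
    [set w : tspace -> grE -> grE | bilinear_map w /\
       forall (i : nat) (q : int) X s, Gamma (H i.+1) X -> Gamma (F q) s ->
         w (tcls i (X x)) (grEcls q (s x)) =
           grEcls (q - i.+1%:Z) (D X s x)].

(* The filtration degree s part of Lambda^{k,0}T_x^*M (x) E_x. A covector has
   degree at least p+1 iff it vanishes on H^{-p}, and the tensor product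
   filtration is spanned by the (theta_1 /\ .. /\ theta_k) (x) e of degree at
   least s. *)
Definition in_filtration (k : nat) (s : int) (b : ('I_k -> TM M x) -> E x) : Prop :=
  exists (m : nat) (theta : 'I_m -> 'I_k -> 'Hom(TM M x, R^o))
    (p : 'I_m -> 'I_k -> nat) (e : 'I_m -> E x) (q : 'I_m -> int),
    [/\ forall a i v, v \in H (p a i) x -> theta a i v = 0,
        forall a, e a \in F (q a) x,
        forall a, s <= (\sum_(i < k) (p a i).+1)%N%:Z + q a &
        forall v, b v =
          \sum_(a < m) \det (\matrix_(i, j) (theta a i (v j) : R)) *: e a].

(* mu is the class of b in degree s of Lambda^k t^* (x) gr(E_x), the associated
   graded of Lambda^{k,0}T_x^*M (x) E_x. *)
Definition gr_class (k : nat) (s : int) (b : ('I_k -> TM M x) -> E x)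
    (mu : ('I_k -> tspace) -> grE) : Prop :=
  [/\ in_filtration s b, alternating_map mu &
      forall (p : 'I_k -> nat) (v : 'I_k -> TM M x),
        (forall i, v i \in H (p i).+1 x) ->
        mu (fun i => tcls (p i) (v i)) =
          grEcls (s - (\sum_(i < k) (p i).+1)%N%:Z) (b v)].

End Transverse.

Arguments dN {R n M} H {E} D N {k} alpha x v.
Arguments tcls {R n M} H x i v.
Arguments grEcls {R n M E} F x p e.
Arguments tbracket {R n M} H x xi eta : rename.
Arguments omegabar {R n M} H {E} F D x xi psi : rename.
Arguments in_filtration {R n M} H {E} F {x k} s b.
Arguments gr_class {R n M} H {E} F {x k} s b mu.

Section GradedOperator.
Variables (R : realType) (n : nat) (M : manifold R n).
Variables (H : foliated_filtration M) (E : vector_bundle M).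
Variables (F : bundle_filtration E) (D : connection E) (N : subfamily (TM M)).
Variables (x : M) (k : nat).

Notation cochain j := (('I_j -> tspace H x) -> grE F x).

(* [del] is the map induced by d_N on associated graded spaces at x: it is linear
   and, on the class at x of a section alpha of the degree s part of the
   filtration, it is the class of d_N alpha. These conditions determine [del] on
   alternating maps. *)
Definition is_gr_dN (del : cochain k -> cochain k.+1) : Prop :=
  [/\ forall mu, alternating_map mu -> alternating_map (del mu),
      forall (a : R) mu nu, alternating_map mu -> alternating_map nu ->
        del (fun xi => a *: mu xi + nu xi) =
          (fun xi => a *: del mu xi + del nu xi) &
      forall (s : int) (alpha : form E k) mu,
        form_k0 H alpha ->
        (forall y, in_filtration H F s (alpha y)) ->
        gr_class H F s (alpha x) mu ->
        gr_class H F s (dN H D N alpha x) (del mu)].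

Definition gr_dN : cochain k -> cochain k.+1 :=
  xget ((fun _ _ => 0) : {classic cochain k -> cochain k.+1})
    [set del : cochain k -> cochain k.+1 | is_gr_dN del].

End GradedOperator.

Arguments gr_dN {R n M} H {E} F D N x k mu xi : rename.

(* Main.v *)
From HB Require Import structures.
Require Import Defs.
From mathcomp Require Import all_boot all_order all_algebra.
From mathcomp Require Import all_classical all_reals all_analysis.
From mathcomp Require Import zify ring.
From mathcomp Require Import perm.
Set Implicit Arguments.
Unset Strict Implicit.
Unset Printing Implicit Defensive.
Import Order.TTheory GRing.Theory Num.Theory.
Import numFieldNormedType.Exports.
Local Open Scope classical_set_scope.
Local Open Scope ring_scope.

(** Both sides are determined by what they do to vector fields and sections, so the
    proof computes [d_N] on extensions of vectors and reads off symbols.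

    Let [alpha] be a form of bidegree [(k, 0)] in filtration degree [s], with class
    [mu] at [x], and let [v_0, .., v_k] be tangent vectors with [v_i] of degree
    [-p_i]. Up to [H^0], extend them to fields [X_i] that are sections of [H^{-p_i}].
    The Koszul formula writes [d_N alpha] at [x] as a sum of terms
    [nabla_{X_j} (alpha (.., no X_j, ..))] and [alpha ([X_i, X_j], ..)]. The value
    [alpha (.., no X_j, ..)] is a section of a step of the filtration of [E], so the
    class of the first term is [omegabar] applied to the class of [X_j] and to a value
    of [mu], by the definition of [omegabar]; the class of the second is a value of
    [mu] at the bracket of the classes. This is the Chevalley-Eilenberg formula
    ([CE_gr_class]).

    Four facts stand behind this computation. They are where the work lies.

    Tensoriality. If a section of a subbundle vanishes at [x], it is a combination of
    sections of the same subbundle with coefficients vanishing at [x]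
    ([Gamma_vanishing]). Leibniz rules then show that its derivatives at [x] along
    other fields stay in the subbundle, and so that the bracket on the graded space
    and [omegabar] are well defined ([tbracket_spec], [omegabar_spec]).

    Existence of the exterior covariant derivative. The Koszul formula is linear over
    functions in its first argument, because the derivatives of the function that
    come from the connection cancel those that come from the brackets, and it is
    alternating; so it only depends on the values of the fields
    ([ext_cov_derivativeE]). The Koszul and the Chevalley-Eilenberg formulas are
    instances of the same double sum [CEsum], whose alternation is proved once.

    The degree of a form can be recognized on its values ([filtration_value],
    [in_filtrationI]), so that [d_N] preserves the filtration.

    Uniqueness. Every alternating map on the graded space is a finite combination of
    classes of global forms: expand it over a basis, and extend the dual covectors
    with their order of vanishing ([covector_extension], [monomial_gr_class],
    [monomial_decomposition]). Hence the conditions that define the operator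
    induced by [d_N] have only one solution on alternating maps. *)

(** * Maps linear in each argument, and alternating sums *)

Definition upd (T : Type) (k : nat) (w : 'I_k -> T) (i : 'I_k) (u : T) :
    'I_k -> T := fun l => if l == i then u else w l.

Lemma updE (T : Type) k (w : 'I_k -> T) i u : upd w i u i = u.
Proof. by rewrite /upd eqxx. Qed.

Lemma updN (T : Type) k (w : 'I_k -> T) i u l : l != i -> upd w i u l = w l.
Proof. by rewrite /upd => /negbTE ->. Qed.

Lemma upd_id (T : Type) k (w : 'I_k -> T) i : upd w i (w i) = w.
Proof. by apply/funext => l; rewrite /upd; case: eqP => [->|]. Qed.

Lemma upd_upd (T : Type) k (w : 'I_k -> T) i u v : upd (upd w i u) i v = upd w i v.
Proof. by apply/funext => l; rewrite /upd; case: eqP. Qed.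

Lemma updC (T : Type) k (w : 'I_k -> T) i j u v : i != j ->
  upd (upd w i u) j v = upd (upd w j v) i u.
Proof.
move=> ij; apply/funext => l; rewrite /upd; case: (eqVneq l j) => // ->.
by rewrite eq_sym (negbTE ij).
Qed.

Lemma upd_all (T : Type) (P : T -> Prop) k (w : 'I_k -> T) i u :
  (forall l, P (w l)) -> P u -> forall l, P (upd w i u l).
Proof. by move=> Pw Pu l; rewrite /upd; case: eqP. Qed.

Section SlotLinear.
Variables (R : realType) (L W : lmodType R) (P : L -> Prop).

(** Linearity and vanishing are only asked of arguments satisfying [P]: the Koszul
    formula makes sense for smooth vector fields, among all vector fields. *)
Definition slot_linear (k : nat) (m : ('I_k -> L) -> W) : Prop :=
  forall w i a u v, (forall l, P (w l)) -> P u -> P v ->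
    m (upd w i (a *: u + v)) = a *: m (upd w i u) + m (upd w i v).

Definition adjacent_vanishing (k : nat) (m : ('I_k -> L) -> W) : Prop :=
  forall (w : 'I_k -> L) (i j : 'I_k), (forall l, P (w l)) ->
    (j : nat) = i.+1 -> w i = w j -> m w = 0.

Hypothesis P_lin : forall a u v, P u -> P v -> P (a *: u + v).
Hypothesis P0 : P 0.

Let PD u v : P u -> P v -> P (u + v).
Proof. by move=> Pu Pv; rewrite -[u]scale1r; exact: P_lin. Qed.

Let PZ a u : P u -> P (a *: u).
Proof. by move=> Pu; rewrite -[_ *: _]addr0; exact: P_lin. Qed.

Lemma slot_linearD k (m : ('I_k -> L) -> W) w i u v : slot_linear m ->
  (forall l, P (w l)) -> P u -> P v ->
  m (upd w i (u + v)) = m (upd w i u) + m (upd w i v).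
Proof. by move=> ml Pw Pu Pv; have := ml w i 1 u v Pw Pu Pv; rewrite !scale1r. Qed.

Lemma slot_linear0 k (m : ('I_k -> L) -> W) w i : slot_linear m ->
  (forall l, P (w l)) -> m (upd w i 0) = 0.
Proof.
move=> ml Pw; have := slot_linearD i ml Pw P0 P0.
by rewrite addr0 -{1}[m _]addr0 => /addrI <-.
Qed.

Lemma slot_linearZ k (m : ('I_k -> L) -> W) w i a u : slot_linear m ->
  (forall l, P (w l)) -> P u -> m (upd w i (a *: u)) = a *: m (upd w i u).
Proof.
by move=> ml Pw Pu; have := ml w i a u 0 Pw Pu P0; rewrite slot_linear0// !addr0.
Qed.

Lemma slot_linear_sum k (m : ('I_k -> L) -> W) (I : Type) (r : seq I) w i
    (c : I -> R) (e : I -> L) : slot_linear m ->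
  (forall l, P (w l)) -> (forall a, P (e a)) ->
  m (upd w i (\sum_(a <- r) c a *: e a)) = \sum_(a <- r) c a *: m (upd w i (e a)).
Proof.
move=> ml Pw Pe; elim: r => [|a r IH]; first by rewrite !big_nil slot_linear0.
rewrite !big_cons ml ?IH//.
apply: (big_ind P) => [|u v|b _]; [exact: P0|exact: PD|exact: PZ].
Qed.

(** Expanding the value at [u + v], [u + v] leaves only the two mixed terms. *)
Lemma swap_of_vanishing k (m : ('I_k -> L) -> W) (i j : 'I_k) : slot_linear m ->
  i != j ->
  (forall w, (forall l, P (w l)) -> w i = w j -> m w = 0) ->
  forall w, (forall l, P (w l)) -> m (w \o tperm i j) = - m w.
Proof.
move=> ml ij m0 w Pw; set u := w i; set v := w j.
have Pu : P u := Pw i; have Pv : P v := Pw j.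
have eij x y : upd (upd w i x) j y i = x by rewrite updN// updE.
have ejj x y : upd (upd w i x) j y j = y by rewrite updE.
have Pij x y : P x -> P y -> forall l, P (upd (upd w i x) j y l).
  by move=> Px Py; apply: upd_all => //; exact: upd_all.
have := m0 (upd (upd w i (u + v)) j (u + v)) (Pij _ _ (PD Pu Pv) (PD Pu Pv)).
rewrite eij ejj => /(_ erefl).
rewrite slot_linearD//; last by apply: upd_all => //; exact: PD.
rewrite !(updC _ _ _ ij) !slot_linearD//; [|by apply: upd_all..].
rewrite -!(updC _ _ _ ij) (m0 (upd (upd w i u) j u)) ?eij ?ejj//; last exact: Pij.
rewrite (m0 (upd (upd w i v) j v)) ?eij ?ejj//; last exact: Pij.
rewrite add0r addr0.
have -> : upd (upd w i u) j v = w.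
  by rewrite upd_id /u upd_id.
have -> : upd (upd w i v) j u = w \o tperm i j.
  apply/funext => l /=; rewrite /upd; case: tpermP => [->|->|/eqP li /eqP lj].
  - by rewrite (negbTE ij) eqxx.
  - by rewrite eqxx.
  - by rewrite (negbTE li) (negbTE lj).
by move/eqP; rewrite addr_eq0 => /eqP.
Qed.

(** Induction on the distance of the two equal arguments, which an exchange of
    neighbours shortens. *)
Lemma vanishing_of_adjacent k (m : ('I_k -> L) -> W) : slot_linear m ->
  adjacent_vanishing m ->
  forall (w : 'I_k -> L) (i j : 'I_k), (forall l, P (w l)) ->
    i != j -> w i = w j -> m w = 0.
Proof.
move=> ml ma; suff main d : forall (w : 'I_k -> L) (i j : 'I_k),
    (forall l, P (w l)) -> (j : nat) = (i + d.+1)%N -> w i = w j -> m w = 0.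
  move=> w i j Pw ij wij; case: (ltngtP i j) => ij'.
  - by apply: (main (j - i.+1)%N w i j) => //; lia.
  - by apply: (main (i - j.+1)%N w j i) => //; lia.
  - by move: ij; rewrite (val_inj ij') eqxx.
elim: d => [|d IH] w i j Pw jE wij; first by apply: (ma w i j) => //; lia.
have j1 : (j.-1 < k)%N by have := ltn_ord j; lia.
pose j' := Ordinal j1.
have j'j : j' != j by apply/eqP => /(congr1 val)/=; lia.
have ij' : i != j' by apply/eqP => /(congr1 val)/=; lia.
have ij : i != j by apply/eqP => /(congr1 val)/=; lia.
have := swap_of_vanishing ml j'j _ Pw.
rewrite (IH (w \o tperm j' j) i j') /=.
- move=> /(_ _)/esym/eqP; rewrite oppr_eq0 => H; apply/eqP/H => w' Pw' wj'.
  by apply: (ma w' j' j) => //=; lia.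
- by move=> l; exact: Pw.
- by rewrite /=; lia.
- by rewrite tpermL tpermD// eq_sym.
Qed.

(** Replacing the arguments one after the other: a slot-linear map that vanishes
    as soon as one argument lies in a subgroup [Z] only depends on the classes
    modulo [Z]. *)
Lemma eq_mod_of_vanishing k (m : ('I_k -> L) -> W) (Z : L -> Prop) :
  slot_linear m ->
  (forall (w : 'I_k -> L) i, (forall l, P (w l)) -> Z (w i) -> m w = 0) ->
  forall w w', (forall l, P (w l)) -> (forall l, P (w' l)) ->
    (forall l, Z (w l - w' l)) -> m w = m w'.
Proof.
move=> ml m0 w w' Pw Pw' Zw.
pose h t : 'I_k -> L := fun l => if (l < t)%N then w' l else w l.
have Ph t l : P (h t l) by rewrite /h; case: ifP.
suff main t : (t <= k)%N -> m (h t) = m w.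
  rewrite -(main k (leqnn k)); congr m; apply/funext => l.
  by rewrite /h ltn_ord.
elim: t => [_|t IH tk]; first by congr m; apply/funext => l; rewrite /h ltn0.
rewrite -(IH (ltnW tk)); pose i := Ordinal tk.
have -> : h t.+1 = upd (h t) i (w' i).
  apply/funext => l; rewrite /h /upd ltnS leq_eqVlt -val_eqE /=.
  by case: (eqVneq (l : nat) t) => [lt|] //=; congr w'; exact: val_inj.
have -> : h t = upd (h t) i ((w i - w' i) + w' i).
  by rewrite subrK -{1}(upd_id (h t) i) {2}/h ltnn.
rewrite slot_linearD//; last first.
  by rewrite -scaleN1r addrC; exact: P_lin.
rewrite (m0 (upd (h t) i (w i - w' i)) i) ?updE ?add0r ?upd_upd//.
by apply: upd_all => //; rewrite -scaleN1r addrC; exact: P_lin.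
Qed.

End SlotLinear.

Lemma sum_antisym (R : realType) (W : lmodType R) (I : finType) (P : pred I)
    (h : I -> I) (T : I -> W) : involutive h -> (forall p, P p -> P (h p)) ->
  (forall p, P p -> T (h p) = - T p) -> \sum_(p | P p) T p = 0.
Proof.
move=> hK Ph Th; set S := LHS.
have SN : S = - S.
  rewrite {1}/S (reindex_inj (can_inj hK)) -sumrN.
  apply: eq_big => [p|p /Ph]; last by rewrite hK; exact: Th.
  by apply/idP/idP => [/Ph|/Ph]; rewrite ?hK.
have : 2%:R *: S = 0 by rewrite scaler_nat mulr2n {1}SN addNr.
by move/eqP; rewrite scaler_eq0 pnatr_eq0 => /eqP.
Qed.

Lemma sign_parity (R : realType) (p q : nat) :
  odd p = ~~ odd q -> (-1) ^+ p = - (-1) ^+ q :> R.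
Proof. by move=> pq; rewrite -signr_odd pq signrN signr_odd. Qed.

(** The exchange of [a] and [a.+1] on natural numbers, the transposition used below
    in a form that arithmetic can decide. *)
Definition swapn (a n : nat) : nat := if n == a then a.+1 else if n == a.+1 then a else n.
Lemma swapn_id (a n : nat) : n != a -> n != a.+1 -> swapn a n = n.
Proof. by rewrite /swapn => /negbTE -> /negbTE ->. Qed.
Lemma swapnl a : swapn a a = a.+1.
Proof. by rewrite /swapn eqxx. Qed.
Lemma swapnr a : swapn a a.+1 = a.
Proof. by rewrite /swapn eqxx; case: eqP => //; lia. Qed.
Lemma bump_succ (a l : nat) : bump a.+1 l != bump a l ->
  bump a.+1 l = a /\ bump a l = a.+1.
Proof. by rewrite /bump => ?; split; lia. Qed.

(** [bump j] after [bump i] enumerates the complement of [i] and [j]. Moving one of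
    them to the neighbouring place moves one element of the complement back. *)
Lemma swapn_bump2 (a i j l : nat) : (i < j)%N -> (i, j) != (a, a.+1) ->
  [|| i == a, i == a.+1, j == a | j == a.+1] ->
  bump (swapn a j) (bump (swapn a i) l) != bump j (bump i l) ->
  bump (swapn a j) (bump (swapn a i) l) = swapn a (bump j (bump i l)).
Proof.
move=> ij nij iorj; set x := bump _ _; set y := bump _ _ => xy.
suff [[-> ->]|[-> ->]] : (x = a.+1 /\ y = a) \/ (x = a /\ y = a.+1).
- by rewrite swapnl.
- by rewrite swapnr.
rewrite xpair_eqE in nij; move: xy; rewrite {}/x {}/y.
case/or4P: iorj => /eqP E; rewrite {}E ?swapnl ?swapnr in ij nij *.
- rewrite swapn_id; [|lia..]. rewrite /bump; lia.
- rewrite swapn_id; [|lia..]. rewrite /bump; lia.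
- rewrite swapn_id; [|lia..]. rewrite /bump; lia.
- rewrite swapn_id; [|lia..]. rewrite /bump; lia.
Qed.

Lemma swapn_parity (a i j : nat) : (i < j)%N -> (i, j) != (a, a.+1) ->
  [|| i == a, i == a.+1, j == a | j == a.+1] ->
  odd (swapn a i + swapn a j) = ~~ odd (i + j).
Proof.
move=> ij nij iorj; rewrite xpair_eqE in nij; rewrite !oddD.
case/or4P: iorj => /eqP E; rewrite {}E ?swapnl ?swapnr in ij nij *.
all: rewrite swapn_id; [|lia..]; rewrite /=.
all: by do 2 case: (odd _).
Qed.

Section CEsum.
Variables (R : realType) (L W : lmodType R) (P : L -> Prop) (k : nat).
Variables (A : L -> ('I_k -> L) -> W) (m : ('I_k -> L) -> W) (br : L -> L -> L).

(** The Koszul formula (arguments: vector fields) and the Chevalley-Eilenberg formula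
    (arguments: elements of a Lie algebra) are both of this form, [A z w] being the
    action of [z] on the value at [w]. *)
Definition CEsum (X : 'I_k.+1 -> L) : W :=
  \sum_(j < k.+1) (-1) ^+ j *: A (X j) (fun l => X (lift j l)) +
  \sum_(i < k.+1) \sum_(j < k.+1 | (i < j)%N)
    (-1) ^+ (i + j) *: m (del2 i j (br (X i) (X j)) X).

Hypothesis P_br : forall u v, P u -> P v -> P (br u v).

Lemma del2_all (i j : 'I_k.+1) z (X : 'I_k.+1 -> L) :
  P z -> (forall l, P (X l)) -> forall l, P (del2 i j z X l).
Proof. by move=> Pz PX l; rewrite /del2; case: ifP. Qed.

Lemma del2_hit (i j c : 'I_k.+1) : (i < j)%N -> c != i -> c != j ->
  exists l : 'I_k, (0 < l)%N /\ bump j (bump i l.-1) = c.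
Proof.
rewrite -!val_eqE /= => ij ci cj.
have lk : ((unbump i (unbump j c)).+1 < k)%N.
  have := ltn_ord c; have := ltn_ord j; rewrite /unbump.
  by case: (ltnP j c); case: ltnP => /=; lia.
exists (Ordinal lk); split=> //=.
by rewrite /bump /unbump; repeat (case: leqP => /=; try lia).
Qed.

Lemma del2E (T : Type) (i j : 'I_k.+1) (l : 'I_k) (c : 'I_k.+1) z
    (X : 'I_k.+1 -> T) :
  (0 < l)%N -> bump j (bump i l.-1) = c -> del2 i j z X l = X c.
Proof.
move=> l0 E; rewrite /del2 eqn0Ngt l0 /=; congr X; apply: val_inj.
by rewrite /= inordK E.
Qed.

Lemma bump2_lt (i j : 'I_k.+1) (l : 'I_k) : (bump j (bump i l.-1) < k.+1)%N \/ l = 0%N :> nat.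
Proof.
have := ltn_ord l; rewrite /bump; case: (posnP l) => [|l0 lk]; first by right.
by left; case: leqP; case: leqP => /=; lia.
Qed.

(** When two adjacent arguments agree, exchanging the corresponding indices is an
    involution on the terms of either sum that reverses their sign; the terms it
    fixes vanish by themselves. *)
Lemma CEsum_adjacent :
  (forall z w i j, P z -> (forall l, P (w l)) -> i != j -> w i = w j -> A z w = 0) ->
  (forall w i j, (forall l, P (w l)) -> i != j -> w i = w j -> m w = 0) ->
  (forall w i u, (forall l, P (w l)) -> P u -> w i = br u u -> m w = 0) ->
  adjacent_vanishing P CEsum.
Proof.
move=> A0 m0 br0 X a b PX ba Xab.
have ab : a != b by rewrite -val_eqE /= ba; lia.
pose tau := tperm a b.
have tauE i : (tau i : nat) = swapn a i.
  rewrite /tau; case: tpermP => [->|->|/eqP ia /eqP ib].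
  - by rewrite swapnl ba.
  - by rewrite ba swapnr.
  - by rewrite swapn_id// -ba.
have tauK : involutive tau by exact: tpermK.
have Xtau i : X (tau i) = X i by rewrite /tau; case: tpermP => [->|->|].
have eqa i : (i == a) = ((i : nat) == a) by rewrite -val_eqE.
have eqb i : (i == b) = ((i : nat) == a.+1) by rewrite -val_eqE /= ba.
rewrite /CEsum; suff [-> ->] : \sum_(j < k.+1) (-1) ^+ j *: A (X j) (fun l => X (lift j l)) = 0
  /\ \sum_(i < k.+1) \sum_(j < k.+1 | (i < j)%N)
    (-1) ^+ (i + j) *: m (del2 i j (br (X i) (X j)) X) = 0 by rewrite addr0.
split.
  apply: (sum_antisym tauK) => // j _.
  have [jab|] := boolP ((j == a) || (j == b)).
    rewrite Xtau; have -> : (fun l => X (lift (tau j) l)) = (fun l => X (lift j l)).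
      apply/funext => l; rewrite -[RHS]Xtau.
      have [/eqP|lab] := boolP (lift (tau j) l == lift j l); first by rewrite Xtau => ->.
      congr X; apply: val_inj; rewrite /= !tauE /=.
      move: lab jab; rewrite -val_eqE /= tauE eqa eqb => lab.
      move=> /orP[]/eqP E; move: lab; rewrite E ?swapnl ?swapnr => lab.
        by have [-> ->] := bump_succ lab; rewrite swapnr.
      by rewrite eq_sym in lab; have [-> ->] := bump_succ lab; rewrite swapnl.
    rewrite -scaleNr; congr (_ *: _); apply: sign_parity.
    by rewrite tauE; move: jab; rewrite eqa eqb => /orP[]/eqP ->;
      rewrite ?swapnl ?swapnr /= ?negbK.
  rewrite negb_or => /andP[ja jb].
  have [la laE _] := unlift_some ja; have [lb lbE _] := unlift_some jb.
  have lab : la != lb by apply/eqP => E; move: ab; rewrite laE lbE E eqxx.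
  have Aj0 : A (X j) (fun l => X (lift j l)) = 0.
    by apply: (A0 _ _ la lb (PX _)) => //=; rewrite -laE -lbE.
  have -> : tau j = j by rewrite /tau tpermD// eq_sym.
  by rewrite Aj0 scaler0 oppr0.
rewrite pair_big_dep /= (bigID (pred1 (a, b))) /= big1 ?add0r; last first.
  move=> [i j] /andP[_ /eqP[-> ->]] /=.
  case: (posnP k) => [k0|kp]; first by exfalso; move: (ltn_ord b); lia.
  rewrite (br0 _ (Ordinal kp) (X a)) ?scaler0//; last by rewrite /del2 /= Xab.
  by apply: del2_all => //; exact: P_br.
pose h (p : 'I_k.+1 * 'I_k.+1) := (tau p.1, tau p.2).
apply: (@sum_antisym _ _ _ _ h); first by move=> [i j]; rewrite /h /= !tauK.
  move=> [i j] /andP[/= ij]; rewrite /h /= !xpair_eqE !eqa !eqb !tauE /swapn.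
  by repeat (case: eqP => //= ?); lia.
move=> [i j] /andP[/= ij]; rewrite /h /= xpair_eqE => nab.
have [/andP[/norP[ia ib] /norP[ja jb]]|iorj] :=
    boolP (~~ ((i == a) || (i == b)) && ~~ ((j == a) || (j == b))).
  have -> : tau i = i by rewrite /tau tpermD// eq_sym.
  have -> : tau j = j by rewrite /tau tpermD// eq_sym.
  have [||la [la0 laE]] := @del2_hit i j a ij; [by rewrite eq_sym..|].
  have [||lb [lb0 lbE]] := @del2_hit i j b ij; [by rewrite eq_sym..|].
  rewrite (m0 _ la lb) ?scaler0 ?oppr0//.
  - by apply: del2_all => //; exact: P_br.
  - by apply/eqP => E; move: ab; rewrite -val_eqE /= -laE -lbE E eqxx.
  - by rewrite (del2E _ _ la0 laE) (del2E _ _ lb0 lbE).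
rewrite !Xtau; have -> : del2 (tau i) (tau j) (br (X i) (X j)) X =
    del2 i j (br (X i) (X j)) X.
  apply/funext => l; rewrite /del2; case: ifP => // /negbT l0.
  rewrite -[RHS]Xtau.
  have [/eqP E|lab] := boolP (bump (tau j) (bump (tau i) l.-1) == bump j (bump i l.-1)).
    by rewrite Xtau E.
  have lt1 : (bump (tau j) (bump (tau i) l.-1) < k.+1)%N.
    by case: (bump2_lt (tau i) (tau j) l) => // l0'; rewrite l0' in l0.
  have lt2 : (bump j (bump i l.-1) < k.+1)%N.
    by case: (bump2_lt i j l) => // l0'; rewrite l0' in l0.
  congr X; apply: val_inj; rewrite /= [RHS]tauE (inordK lt1) (inordK lt2) !tauE.
  apply: swapn_bump2 => //.
  - by rewrite xpair_eqE -eqa -eqb.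
  - by move: iorj; rewrite negb_and !negbK !eqa !eqb -orbA.
  - by rewrite -!tauE.
rewrite -scaleNr; congr (_ *: _); apply: sign_parity.
rewrite !tauE; apply: swapn_parity => //; first by rewrite xpair_eqE -eqa -eqb.
by move: iorj; rewrite negb_and !negbK !eqa !eqb -orbA.
Qed.

End CEsum.

Section CEsumLinear.
Variables (R : realType) (L W : lmodType R) (P : L -> Prop) (k : nat).
Variables (A : L -> ('I_k -> L) -> W) (m : ('I_k -> L) -> W) (br : L -> L -> L).

Lemma upd_lift_same (T : Type) (X : 'I_k.+1 -> T) c u :
  (fun l => upd X c u (lift c l)) = (fun l => X (lift c l)).
Proof. by apply/funext => l; rewrite updN// eq_sym neq_lift. Qed.

Lemma upd_lift (T : Type) (X : 'I_k.+1 -> T) j c u :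
  (fun l => upd X (lift j c) u (lift j l)) = upd (fun l => X (lift j l)) c u.
Proof. by apply/funext => l; rewrite /upd (inj_eq (@lift_inj _ j)). Qed.

Lemma bump2_neq (i j l : nat) : (i < j)%N ->
  bump j (bump i l) != i /\ bump j (bump i l) != j.
Proof. by rewrite /bump => ij; do 2 (case: leqP => /= ?); split; lia. Qed.

Lemma del2_upd_same (T : Type) (X : 'I_k.+1 -> T) (i j c : 'I_k.+1) z u :
  (i < j)%N -> (c == i) || (c == j) -> del2 i j z (upd X c u) = del2 i j z X.
Proof.
move=> ij cij; apply/funext => l; rewrite /del2; case: ifP => // /negbT l0.
have [//|l0'] := bump2_lt i j l; last by rewrite l0' in l0.
move=> lt1; rewrite updN// -val_eqE /= inordK//.
have [? ?] := bump2_neq l.-1 ij.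
by case/orP: cij => /eqP ->.
Qed.

Lemma del2_upd (T : Type) (X : 'I_k.+1 -> T) (i j c : 'I_k.+1) (l : 'I_k) z u :
  (0 < l)%N -> bump j (bump i l.-1) = c ->
  del2 i j z (upd X c u) = upd (del2 i j z X) l u.
Proof.
move=> l0 lc; apply/funext => l'; rewrite /upd.
have [->|ll'] := eqVneq l' l; first by rewrite (del2E _ _ l0 lc) eqxx.
rewrite /del2; case: ifP => // /negbT l'0; rewrite ifN//.
have [lt1|l0'] := bump2_lt i j l'; last by rewrite l0' in l'0.
apply: contra ll'; rewrite -!val_eqE /= inordK// -lc => /eqP.
by move/(can_inj (@bumpK j))/(can_inj (@bumpK i)) => E; apply/eqP; lia.
Qed.

Lemma del2_head (T : Type) (X : 'I_k.+1 -> T) (i j : 'I_k.+1) z z' (o : 'I_k) :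
  (o : nat) = 0%N -> del2 i j z X = upd (del2 i j z' X) o z.
Proof.
move=> o0; apply/funext => l; rewrite /del2 /upd -val_eqE /= o0.
by case: ifP.
Qed.

Hypothesis P_lin : forall a u v, P u -> P v -> P (a *: u + v).
Hypothesis P_br : forall u v, P u -> P v -> P (br u v).
Hypothesis A_lin1 : forall w a u v, (forall l, P (w l)) -> P u -> P v ->
  A (a *: u + v) w = a *: A u w + A v w.
Hypothesis A_lin2 : forall z, P z -> slot_linear P (A z).
Hypothesis m_lin : slot_linear P m.
Hypothesis br_lin1 : forall a u v z, P u -> P v -> P z ->
  br (a *: u + v) z = a *: br u z + br v z.
Hypothesis br_lin2 : forall a u v z, P u -> P v -> P z ->
  br z (a *: u + v) = a *: br z u + br z v.

Let m_head X (i j : 'I_k.+1) a u v : (forall l, P (X l)) -> (i < j)%N ->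
  P u -> P v ->
  m (del2 i j (a *: u + v) X) = a *: m (del2 i j u X) + m (del2 i j v X).
Proof.
move=> PX ij Pu Pv; have k0 : (0 < k)%N by have := ltn_ord j; lia.
have [d [Pd dE]] : exists d, (forall l, P (d l)) /\
    forall z, del2 i j z X = upd d (Ordinal k0) z.
  exists (del2 i j u X); split=> [|z]; first exact: del2_all.
  exact: del2_head.
by rewrite !dE m_lin.
Qed.

Lemma CEsum_slot_linear : slot_linear P (CEsum A m br).
Proof.
move=> X c a u v PX Pu Pv; rewrite /CEsum scalerDr [RHS]addrACA.
have Puv := P_lin a Pu Pv; congr (_ + _).
  rewrite scaler_sumr -big_split; apply: eq_bigr => j _ /=.
  rewrite scalerA mulrC -scalerA -scalerDr; congr (_ *: _).
  have [<-|cj] := eqVneq c j.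
    by rewrite !updE !upd_lift_same A_lin1.
  rewrite !(@updN _ _ X _ _ j) 1?eq_sym//.
  rewrite eq_sym in cj; have [d -> _] := unlift_some cj.
  by rewrite !upd_lift A_lin2.
rewrite scaler_sumr -big_split; apply: eq_bigr => i _ /=.
rewrite scaler_sumr -big_split; apply: eq_bigr => j ij /=.
rewrite scalerA mulrC -scalerA -scalerDr; congr (_ *: _).
have [cij|] := boolP ((c == i) || (c == j)).
  rewrite !del2_upd_same//.
  have [ci|ci] := eqVneq c i.
    subst c; have ji : j != i by rewrite -val_eqE /=; lia.
    by rewrite !updE !(@updN _ _ X _ _ j)// br_lin1// m_head//; exact: P_br.
  have cj : c = j by move: cij; rewrite (negbTE ci) => /eqP.
  subst c; rewrite !updE !(@updN _ _ X _ _ i) 1?eq_sym// br_lin2// m_head//; exact: P_br.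
rewrite negb_or => /andP[ci cj].
have [l [l0 lc]] := del2_hit ij ci cj.
rewrite !(del2_upd _ _ _ l0 lc) !(@updN _ _ X _ _ i) 1?eq_sym// !(@updN _ _ X _ _ j) 1?eq_sym//.
by rewrite m_lin//; apply: del2_all => //; exact: P_br.
Qed.

End CEsumLinear.

Lemma alternating_slot_linear (R : realType) (k : nat) (V W : lmodType R)
    (m : ('I_k -> V) -> W) : alternating_map m -> slot_linear (fun=> True) m.
Proof. by move=> [ml _] w i a u v _ _ _; exact: ml. Qed.

Lemma alternating_of_adjacent (R : realType) (k : nat) (V W : lmodType R)
    (m : ('I_k -> V) -> W) : slot_linear (fun=> True) m ->
  adjacent_vanishing (fun=> True) m -> alternating_map m.
Proof.
move=> ml ma; split; first by move=> w i a u v; exact: ml.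
by move=> w i j ij wij; exact: (vanishing_of_adjacent _ ml ma _ ij wij).
Qed.

Lemma alternating_perm (R : realType) (k : nat) (V W : lmodType R)
    (m : ('I_k -> V) -> W) (s : 'S_k) (w : 'I_k -> V) : alternating_map m ->
  m (w \o s) = (-1) ^+ s *: m w.
Proof.
move=> ma; have ml := alternating_slot_linear ma.
have [ts -> dts] := prod_tpermP s.
elim: ts dts w => [|t ts IH] /=.
  by move=> _ w; rewrite big_nil odd_perm1 scale1r; congr m; apply/funext => l /=; rewrite perm1.
move=> /andP[dt dts] w; rewrite big_cons odd_permM odd_tperm dt.
set s' := (\prod_(t <- ts) _)%g in IH *.
have -> : w \o (tperm t.1 t.2 * s')%g = (w \o s') \o tperm t.1 t.2.
  by apply/funext => l /=; rewrite permM.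
rewrite (swap_of_vanishing _ ml dt)//; last by move=> w' _; case: ma => _; apply.
by rewrite IH// signr_addb expr1 mulN1r scaleNr.
Qed.

Section Expansion.
Variables (R : realType) (V W : lmodType R) (A : finType).
Variables (e : A -> V) (tau : A -> V -> R).

Lemma ffun_cons (k : nat) (T : finType) (F : T -> {ffun 'I_k -> T} -> W) :
  \sum_(a : T) \sum_(I : {ffun 'I_k -> T}) F a I =
  \sum_(I : {ffun 'I_k.+1 -> T}) F (I ord0) [ffun i => I (lift ord0 i)].
Proof.
rewrite pair_big /=.
pose h (I : {ffun 'I_k.+1 -> T}) := (I ord0, [ffun i => I (lift ord0 i)]).
pose g (p : T * {ffun 'I_k -> T}) : {ffun 'I_k.+1 -> T} :=
  [ffun i => if unlift ord0 i is Some j then p.2 j else p.1].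
rewrite (reindex h) //; exists g => [I _|[a I] _].
  apply/ffunP => i; rewrite ffunE /=; case: unliftP => [j ->|->] //.
  by rewrite ffunE.
congr pair; first by rewrite ffunE unlift_none.
by apply/ffunP => i; rewrite !ffunE liftK.
Qed.

(** Expansion of all arguments over the vectors [e a]. The hypothesis asks that [m]
    does not see the difference between a vector and its expansion, which lets [m]
    have a kernel, such as the directions of a foliation. *)
Lemma slot_expansion k (m : ('I_k -> V) -> W) :
  (forall w i, m w = \sum_a tau a (w i) *: m (upd w i (e a))) ->
  forall w, m w =
    \sum_(I : {ffun 'I_k -> A}) (\prod_i tau (I i) (w i)) *: m (e \o I).
Proof.
elim: k m => [|k IH] m mexp w.
  rewrite (eq_bigr (fun=> m w)) => [|I _]; last first.
    by rewrite big_ord0 scale1r; congr m; apply/funext => -[].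
  by rewrite sumr_const card_ffun card_ord expn0 mulr1n.
pose c a (w' : 'I_k -> V) : 'I_k.+1 -> V :=
  fun i => if unlift ord0 i is Some j then w' j else e a.
have cupd a w' j v : c a (upd w' j v) = upd (c a w') (lift ord0 j) v.
  apply/funext => i; rewrite /c /upd; case: unliftP => [l ->|->].
    by rewrite (inj_eq (@lift_inj _ ord0)).
  by rewrite (negbTE (neq_lift _ _)).
rewrite (mexp w ord0).
transitivity (\sum_a \sum_(I : {ffun 'I_k -> A})
    (tau a (w ord0) * \prod_i tau (I i) (w (lift ord0 i))) *: m (c a (e \o I))).
  apply: eq_bigr => a _.
  have -> : upd w ord0 (e a) = c a (fun l => w (lift ord0 l)).
    by apply/funext => i; rewrite /c /upd; case: unliftP => [l ->|->].
  rewrite (IH (fun w' => m (c a w'))) => [|w' i]; last first.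
    rewrite (mexp _ (lift ord0 i)); apply: eq_bigr => b _.
    by rewrite cupd {1}/c liftK.
  by rewrite scaler_sumr; apply: eq_bigr => I _; rewrite scalerA.
rewrite ffun_cons; apply: eq_bigr => I _; rewrite big_ord_recl.
congr (_ * _ *: m _); first by apply: eq_bigr => i _; rewrite ffunE.
by apply/funext => i; rewrite /c /=; case: unliftP => [l ->|->] //; rewrite /= ffunE.
Qed.

(** Summing the previous expansion over all permutations of the arguments gives
    each term its full determinant, at the cost of the factor [k!]. *)
Lemma alternating_expansion k (m : ('I_k -> V) -> W) : alternating_map m ->
  (forall w i, m w = \sum_a tau a (w i) *: m (upd w i (e a))) ->
  forall w, m w = (k`!%:R)^-1 *: \sum_(I : {ffun 'I_k -> A})
    \det (\matrix_(i, j) tau (I i) (w j)) *: m (e \o I).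
Proof.
move=> malt mexp w.
suff -> : \sum_(I : {ffun 'I_k -> A})
    \det (\matrix_(i, j) tau (I i) (w j)) *: m (e \o I) = k`!%:R *: m w.
  by rewrite scalerA mulVf ?scale1r// pnatr_eq0 -lt0n fact_gt0.
under eq_bigr => I _ do rewrite /determinant scaler_suml.
rewrite exchange_big /= (eq_bigr (fun=> m w)) => [|s _].
  by rewrite sumr_const card_Sn scaler_nat.
transitivity ((-1) ^+ s *: m (w \o s)); last first.
  by rewrite alternating_perm// scalerA -expr2 sqrr_sign scale1r.
rewrite (slot_expansion mexp) scaler_sumr; apply: eq_bigr => I _.
by rewrite scalerA; congr (_ * _ *: _); apply: eq_bigr => i _; rewrite mxE.
Qed.

End Expansion.

(** * Filtered vector spaces and their graded spaces *)

Section Complements.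
Variables (R : realType) (V : vectType R).

Lemma memv_diff_pi1 (U W : {vspace V}) v : (W <= U)%VS -> v \in U ->
  v - addv_pi1 U W v \in W.
Proof.
move=> WU vU; rewrite -{1}(@addv_pi1_pi2 _ _ U W v); last first.
  by rewrite (addv_idPl WU).
by rewrite addrC addKr memv_pi2.
Qed.

Lemma addv_pi1_eq0 (U W : {vspace V}) w : w \in W -> addv_pi1 U W w = 0.
Proof.
move=> wW; have /addv_pi1_pi2 : w \in (U + W)%VS by apply: (subvP (addvSr _ _)).
by rewrite (addv_pi2_id _ wW) => /(canRL (addrK _)); rewrite subrr.
Qed.

Lemma subv_chain (G : nat -> {vspace V}) : (forall i, (G i <= G i.+1)%VS) ->
  forall i j, (i <= j)%N -> (G i <= G j)%VS.
Proof.
move=> Gincr i j /subnKC <-; elim: (j - i)%N => [|d IH]; first by rewrite addn0.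
by rewrite addnS (subv_trans IH).
Qed.

(** Bases of complements of each [G i] in [G i.+1]; the covectors are the dual
    ones, precomposed with the successive projections so that they keep vanishing
    on the smaller steps. *)
Lemma adapted_family (G : nat -> {vspace V}) (r : nat) :
  (forall i, (G i <= G i.+1)%VS) ->
  exists (A : finType) (dg : A -> nat) (e : A -> V) (tau : A -> 'Hom(V, R^o)),
    [/\ forall a, e a \in G (dg a).+1,
        forall a v, v \in G (dg a) -> tau a v = 0,
        forall a, (dg a < r)%N &
        forall v, v \in G r -> v - \sum_a (tau a v : R) *: e a \in G 0%N].
Proof.
move=> Gincr; elim: r => [|r [A [dg [e [tau [eG tau0 dgr vG]]]]]].
  exists void, (fun=> 0%N), (fun=> 0), (fun=> 0); split=> [[]|[]|[]|v vG].
  by rewrite big_pred0 ?subr0// => -[].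
have Gle := subv_chain Gincr.
pose pi := addv_pi1 (G r.+1) (G r).
pose C := (G r.+1 :\: G r)%VS; pose B := vbasis C.
pose d := \dim C.
pose dg' (a : A + 'I_d) := match a with inl a => dg a | inr _ => r end.
pose e' (a : A + 'I_d) := match a with inl a => e a | inr b => B`_b end.
pose tau' (a : A + 'I_d) : 'Hom(V, R^o) := match a with
  | inl a => (tau a \o (\1 - pi))%VF
  | inr b => (linfun (coord B b : V -> R^o) \o pi)%VF end.
exists (A + 'I_d)%type, dg', e', tau'; split.
- move=> [a|b] /=; first exact: eG.
  by apply: (subvP (diffvSl _ (G r))); apply: vbasis_mem; rewrite mem_nth// size_tuple.
- move=> [a|b] v vG' /=; rewrite comp_lfunE /=; last first.
    by rewrite /pi addv_pi1_eq0// linear0.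
  have vr : v \in G r by apply: (subvP (Gle _ _ (ltnW (dgr a)))).
  by rewrite !lfunE /= opp_lfunE id_lfunE /pi addv_pi1_eq0// subr0 tau0.
- by move=> [a|b] /=; rewrite ltnS ?leqnn// ltnW.
move=> v vG'; rewrite big_sumType /=.
have pv : v - pi v \in G r := memv_diff_pi1 (Gincr r) vG'.
have -> : \sum_(i < d) (tau' (inr i) v : R) *: B`_i = pi v.
  rewrite [RHS](coord_vbasis (memv_pi _ _ v)); apply: eq_bigr => i _.
  by rewrite /= comp_lfunE lfunE.
rewrite (eq_bigr (fun a => (tau a (v - pi v) : R) *: e a)); last first.
  by move=> a _; rewrite /= comp_lfunE !lfunE /= opp_lfunE id_lfunE.
by have := vG _ pv; rewrite -addrA -opprD [pi v + _]addrC.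
Qed.

End Complements.

Lemma gsum_sumE (R : realType) (I : eqType) (Q : I -> lmodType R) (J : Type)
    (r : seq J) (F : J -> gsum Q) i :
  (\sum_(j <- r) F j) i = \sum_(j <- r) F j i.
Proof. by elim/big_rec2: _ => // j x y _ <-. Qed.

Section AssociatedGraded.
Variables (R : realType) (V : vectType R) (I : eqType) (U W : I -> {vspace V}).
Hypothesis WU : forall i, (W i <= U i)%VS.

Let Q (i : I) : lmodType R := quotv (U i) (W i).
Definition gcls (i : I) (v : V) : gsum Q := gin (Q := Q) (i := i) (qcls (U i) (W i) v).

Lemma gclsE i v j : gcls i v j = if i == j then qcls (U j) (W j) v else (0 : Q j).
Proof.
rewrite /gcls /gin; case: eqVneq => [<-|ij]; first by rewrite dfwithin.
by rewrite dfwithout.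
Qed.

Lemma qcls_linear (i : I) : linear (qcls (U i) (W i)).
Proof. by move=> a u v; rewrite /qcls !linearP. Qed.

Lemma gcls_linear i : linear (gcls i).
Proof.
move=> a u v; apply: functional_extensionality_dep => j.
rewrite [RHS]/(a *: gcls i u j + gcls i v j) !gclsE; case: eqP => _.
  exact: qcls_linear.
by rewrite scaler0; exact/esym/addr0.
Qed.

HB.instance Definition _ i := GRing.isLinear.Build R V (gsum Q) _ (gcls i) (@gcls_linear i).

Lemma gcls_eq0 i v : v \in W i -> gcls i v = 0.
Proof.
move=> vW; apply: functional_extensionality_dep => j; rewrite gclsE.
by case: eqP => // <-; rewrite /qcls addv_pi1_eq0// linear0.
Qed.

Lemma eq_gcls i u v : u - v \in W i -> gcls i u = gcls i v.
Proof.
by move=> uv; rewrite -(subrK v u) -[u - v]scale1r gcls_linear gcls_eq0 ?scaler0 ?add0r.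
Qed.

Lemma mem_vsval_quotv i (w : quotv (U i) (W i)) : vsval w \in U i.
Proof. exact: (subvP (diffvSl _ (W i)) _ (subvsP w)). Qed.

Lemma qcls_vsval i (w : quotv (U i) (W i)) : qcls (U i) (W i) (vsval w) = w.
Proof.
apply: val_inj; rewrite /qcls /= vsprojK ?memv_pi//.
by rewrite daddv_pi_id ?subvsP// capv_diff.
Qed.

Lemma vsval_gcls i v : v \in U i -> v - vsval (gcls i v i) \in W i.
Proof.
move=> vU; rewrite gclsE eqxx /qcls /= vsprojK ?memv_pi//.
exact: (memv_diff_pi1 (WU i) vU).
Qed.

(** Componentwise, this is the expansion of a representative modulo [W i]. *)
Lemma gsum_expansion (A : finType) (dg : A -> I) (e : A -> V) (tau : A -> V -> R) :
  (forall i u, u \in U i -> u - \sum_(a | dg a == i) tau a u *: e a \in W i) ->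
  forall w : gsum Q, w = \sum_a tau a (vsval (w (dg a))) *: gcls (dg a) (e a).
Proof.
move=> exp w; apply: functional_extensionality_dep => i; rewrite gsum_sumE.
have -> : w i = qcls (U i) (W i) (\sum_(a | dg a == i) tau a (vsval (w i)) *: e a).
  have /eq_gcls := exp i _ (mem_vsval_quotv (w i)).
  move/(congr1 (fun f : gsum Q => f i)); rewrite !gclsE eqxx => <-.
  by rewrite qcls_vsval.
have qD : {morph qcls (U i) (W i) : x y / x + y}.
  by move=> x y; have := qcls_linear i 1 x y; rewrite !scale1r.
have q0 : qcls (U i) (W i) 0 = 0 by rewrite /qcls !linear0.
rewrite (big_morph _ qD q0) big_mkcond; apply: eq_bigr => a _.
rewrite [RHS]/(tau a (vsval (w (dg a))) *: gcls (dg a) (e a) i) gclsE.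
case: eqP => [<-|_]; last exact/esym/scaler0.
by rewrite /qcls !linearZ.
Qed.

End AssociatedGraded.

(** * Flat functions *)

Section Flat.
Variable R : realType.

(** [exp (- 1 / t)] divided by a power of [t]. The powers are there to make the family
    stable under differentiation. *)
Definition flat (k : nat) (t : R) : R :=
  if 0 < t then t ^- k * expR (- t^-1) else 0.

Lemma flat_le0 k t : t <= 0 -> flat k t = 0.
Proof. by rewrite /flat leNgt => /negbTE ->. Qed.

Lemma flat_gt0 t : 0 < t -> 0 < flat 0 t.
Proof. by rewrite /flat => t0; rewrite t0 invr1 mul1r expR_gt0. Qed.

(** The exponential beats every power. *)
Lemma flat_bound k t : `|flat k t| <= (k.+1)`!%:R * `|t|.
Proof.
rewrite /flat; case: ifPn => [t0|_]; last by rewrite normr0 mulr_ge0.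
have e0 := expR_gt0 t^-1; have tk : 0 < t ^+ k by rewrite exprn_gt0.
rewrite !gtr0_norm ?mulr_gt0 ?invr_gt0// ?expR_gt0// expRN.
have f0 : 0 < k.+1`!%:R :> R by rewrite ltr0n fact_gt0.
have le : t^-1 ^+ k.+1 / k.+1`!%:R <= expR t^-1.
  apply: (le_trans _ (@expR_ge1Dxn R t^-1 k _)); first by rewrite lerDr.
  by rewrite invr_ge0 ltW.
rewrite ler_pdivrMr//; have -> : t ^- k = k.+1`!%:R * t * (t^-1 ^+ k.+1 / k.+1`!%:R).
  by rewrite exprVn exprS; field; rewrite !gt_eqF.
by rewrite ler_pM2l// mulr_gt0.
Qed.

Lemma flat_continuous0 k : {for 0, continuous (flat k)}.
Proof.
suff : flat k t @[t --> (0 : R)] --> (0 : R).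
  by rewrite -[X in _ --> X](@flat_le0 k 0).
apply/cvgrPdist_le => eps eps0.
have C0 : 0 < (k.+1)`!%:R :> R by rewrite ltr0n fact_gt0.
near=> t; rewrite sub0r normrN; apply: le_trans (flat_bound k t) _.
rewrite mulrC -ler_pdivlMr//; near: t.
have H := @nbhs0_le R R^o (eps / (k.+1)`!%:R); exact: (H (divr_gt0 eps0 C0)).
Unshelve. all: by end_near. Qed.

(** Differentiation stays inside the family; in particular each member is
    infinitely differentiable. *)
Lemma is_derive_flat k (t : R) :
  is_derive t 1 (flat k : R -> R) (flat k.+2 t - k%:R * flat k.+1 t).
Proof.
have [t0|t0|->] := ltgtP t 0.
- rewrite !flat_le0 ?ltW// mulr0 subr0.
  apply: (near_eq_is_derive _ (is_derive_cst (0 : R) t 1)).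
  near=> y; rewrite flat_le0//; near: y.
  by apply: filterS (lt_nbhsl t0) => z /ltW.
- have tn0 : t != 0 by rewrite gt_eqF.
  have dV : is_derive t 1 (fun y : R => y^-1) (- t ^- 2).
    by apply: (is_derive_eq (is_deriveV tn0 (is_derive_id t 1))); rewrite [LHS]mulr1.
  have dN : is_derive t 1 (fun y : R => - y^-1) (t ^- 2).
    by have := is_deriveN dV; rewrite opprK.
  have dE := @is_derive1_comp R expR (fun y : R => - y^-1) _ _ _ (is_derive_expR (- t^-1)) dN.
  have H := is_deriveM (is_deriveX k dV) dE.
  apply: (@is_derive_eq _ _ _ _ _ _ _ _ (near_eq_is_derive _ H)).
    near=> y; rewrite /flat ifT; last by near: y; exact: lt_nbhsr.
    by rewrite fctE exprfctE /= exprVn.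
  rewrite /flat t0 exprfctE /=.
  rewrite /GRing.scale /=; set E := expR _; case: k {H} => [|k] /=.
    by rewrite !expr0 !exprS; field.
  by rewrite !exprS exprVn; field; rewrite tn0 expf_neq0.
- have -> : flat k.+2 0 - k%:R * flat k.+1 0 = flat k.+1 0.
    by rewrite !flat_le0// mulr0 subr0.
  apply/is_derive1_caratheodory; exists (flat k.+1); split=> //.
    move=> z; rewrite subr0 [flat k 0]flat_le0// subr0 /flat.
    case: ifP => [z0|]; last by rewrite mul0r.
    by rewrite exprS; field; rewrite ?expf_neq0 gt_eqF.
  exact: flat_continuous0.
Unshelve. all: by end_near.
Qed.

End Flat.

(** * Smooth functions on open subsets of Euclidean space *)

Section Lines.
Variables (R : realType) (V : normedModType R).
Implicit Types (f : V -> R) (p v : V).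

Lemma derive_line f p v : 'D_v f p = 'D_1 (fun h : R => f (h *: v + p)) 0.
Proof.
rewrite /derive; set g1 := fun h => h^-1 *: _; set g2 := fun h => h^-1 *: _.
suff -> : g1 = g2 by [].
by apply/funext => h; rewrite /g1 /g2 /= addr0 scale0r add0r [_%:A]mulr1.
Qed.

Lemma is_derive_line f p v (df : R) :
  is_derive p v f df <-> is_derive (0 : R) (1 : R) (fun h : R => f (h *: v + p)) df.
Proof.
split=> -[d <-]; split.
- exact: (derivable1P f p v).1 d.
- by rewrite derive_line.
- exact: (derivable1P f p v).2 d.
- by rewrite derive_line.
Qed.

Lemma is_derive_line_at f p v (s df : R) : is_derive (s *: v + p) v f df ->
  is_derive (s : R) (1 : R) (fun h : R => f (h *: v + p)) df.
Proof.
move/is_derive_line => H.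
have -> : (fun h : R => f (h *: v + p)) =
    (fun h : R => f (h *: v + (s *: v + p))) \o (fun h => h - s).
  by apply/funext => h /=; rewrite addrA -scalerDl subrK.
rewrite -[df]mulr1; apply: is_derive1_comp; first by rewrite subrr.
rewrite -[X in is_derive _ _ _ X]subr0.
exact: is_deriveB.
Qed.

Lemma is_derive_comp1 (g : R -> R) f p v (dg df : R) :
  is_derive (f p) (1 : R) g dg -> is_derive p v f df -> is_derive p v (g \o f) (dg * df).
Proof.
move=> Hg /is_derive_line Hf; apply/is_derive_line.
apply: (@is_derive1_comp _ g (fun h : R => f (h *: v + p))) Hf.
by rewrite scale0r add0r.
Qed.

End Lines.

Section C1.
Variables (R : realType) (n : nat).
Notation E := 'rV[R]_n.

(** Mean value theorem along the last displacement: the continuity of one more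
    partial derivative allows one more coordinate in the direction. *)
Lemma is_derive_addcoord (f : E -> R) (p v : E) (j : 'I_n) (a L : R) :
  (\forall q \near p, derivable f q (delta_mx 0 j)) ->
  {for p, continuous ('D_(delta_mx 0 j) f)} ->
  is_derive p v f L ->
  is_derive p (v + a *: delta_mx 0 j) f (L + a * 'D_(delta_mx 0 j) f p).
Proof.
set e := delta_mx 0 j => dfe De [dv <-].
suff H : h^-1 *: ((f \o shift p) (h *: (v + a *: e)) - f p) @[h --> 0^'] -->
    'D_v f p + a * 'D_e f p.
  by split; [apply/cvg_ex; eexists; exact: H|exact: cvg_lim H].
have -> : (fun h : R => h^-1 *: ((f \o shift p) (h *: (v + a *: e)) - f p)) =
   (fun h => h^-1 *: ((f \o shift p) (h *: v) - f p)) \+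
   (fun h => h^-1 *: (f ((h * a) *: e + (h *: v + p)) - f (h *: v + p))).
  apply/funext => h /=.
  have -> : h *: (v + a *: e) + p = (h * a) *: e + (h *: v + p).
    by rewrite scalerDr scalerA addrA [_ + h *: v]addrC.
  by rewrite -scalerDr [X in _ = _ *: X]addrC subrKA.
apply: cvgD; first exact: dv.
apply/cvgrPdist_le => eps eps0.
have a1 : 0 < `|a| + 1 by rewrite ltr_wpDl.
have e1 : 0 < eps / (`|a| + 1) by rewrite divr_gt0.
have /nbhs_ballP[d /= d0 dP] : \forall q \near p,
    derivable f q e /\ `|'D_e f p - 'D_e f q| <= eps / (`|a| + 1).
  by apply: filterI => //; move/cvgrPdist_le: De; apply.
(* A bound for the speed at which the points below move away from [p]; the 1 keeps it
   positive when [v] and [a] are zero. *)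
pose b := `|v| + `|a| * `|e| + 1.
have b0 : 0 < b by rewrite ltr_wpDl// addr_ge0// mulr_ge0.
near=> h.
have hn0 : h != 0 by near: h; exact: nbhs_dnbhs_neq.
have hd : `|h| * b < d.
  by rewrite -ltr_pdivlMr//; near: h; apply: dnbhs0_lt; rewrite divr_gt0.
have inball (s : R) : s \in `[0, 1] -> ball p d ((s * (h * a)) *: e + (h *: v + p)).
  rewrite in_itv /= => /andP[s0 s1].
  rewrite -ball_normE /= addrA opprD addrCA subrr addr0 normrN.
  apply: le_lt_trans hd; apply: le_trans (ler_normD _ _) _.
  rewrite !normrZ ?normrM /b !mulrDr mulr1 addrC -!addrA lerD2l.
  by rewrite -[leLHS]addr0 lerD// -!mulrA ler_piMl ?mulr_ge0// ger0_norm.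
pose g (s : R) := f ((s * (h * a)) *: e + (h *: v + p)).
have dg (s : R) : s \in `[0, 1] ->
    is_derive s 1 g ('D_e f ((s * (h * a)) *: e + (h *: v + p)) * (h * a)).
  move=> s01; have [dfs _] := dP _ (inball s s01).
  apply: (@is_derive1_comp _ (fun t : R => f (t *: e + (h *: v + p)))
    (fun s : R => s * (h * a))).
    by apply: is_derive_line_at; exact: derivableP.
  have H := is_deriveM (is_derive_id s 1) (is_derive_cst (h * a : R) s 1).
  by apply: (is_derive_eq H); rewrite scaler0 add0r /cst [LHS]mulr1.
have gc : {within `[0, 1], continuous g}.
  by apply: derivable_within_continuous => s /dg[].
pose dg' (s : R) := 'D_e f ((s * (h * a)) *: e + (h *: v + p)) * (h * a).
have dgo (s : R) : s \in `]0, 1[%R -> is_derive s 1 g (dg' s).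
  by move=> s01; apply: dg; exact: subset_itv_oo_cc s01.
have [s s01] := @MVT_segment R g dg' 0 1 ler01 dgo gc.
rewrite /dg' /g.
rewrite subr0 mulr1 mul1r mul0r scale0r add0r => -> /=.
have [_ Ds] := dP _ (inball s s01).
have -> : h^-1 *: ('D_e f ((s * (h * a)) *: e + (h *: v + p)) * (h * a)) =
    a * 'D_e f ((s * (h * a)) *: e + (h *: v + p)).
  by rewrite /GRing.scale /=; field.
rewrite -mulrBr normrM; apply: le_trans (ler_wpM2l _ Ds) _ => //.
by rewrite mulrCA ler_piMr ?(ltW eps0)// ler_pdivrMr// mul1r lerDl.
Unshelve. all: by end_near. Qed.

(** Continuous partial derivatives make the derivative linear in the direction. *)
Lemma smooth_on_is_derive (U : set E) (f : E -> R) : open U -> smooth_on U f ->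
  forall p v, U p -> is_derive p v f (\sum_j v 0 j * partial j f p).
Proof.
move=> Uo fs p v Up; rewrite {1}(row_sum_delta v).
elim: (index_enum _) => [|j r IH].
  by rewrite !big_nil; exact: is_derive0.
rewrite !big_cons addrC [X in is_derive _ _ _ X]addrC.
apply: is_derive_addcoord => //.
- have Up' : \forall q \near p, U q by exact: open_nbhs_nbhs.
  by apply: filterS Up' => q Uq; exact: (fs [::] q Uq).2.
- exact: (fs [:: j] p Up).1.
Qed.

Lemma smooth_on_derivable (U : set E) (f : E -> R) : open U -> smooth_on U f ->
  forall p v, U p -> derivable f p v.
Proof. by move=> Uo fs p v Up; have [] := smooth_on_is_derive Uo fs v Up. Qed.

Lemma smooth_on_deriveE (U : set E) (f : E -> R) : open U -> smooth_on U f ->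
  forall p v, U p -> 'D_v f p = \sum_j v 0 j * partial j f p.
Proof. by move=> Uo fs p v Up; have [_] := smooth_on_is_derive Uo fs v Up. Qed.

End C1.

Section SmoothFunctions.
Variables (R : realType) (n : nat).
Notation E := 'rV[R]_n.
Implicit Types (U : set E) (f g : E -> R).

Lemma smooth_on_subset U U' f : U `<=` U' -> smooth_on U' f -> smooth_on U f.
Proof. by move=> UU' fs js p Up; exact: fs (UU' _ Up). Qed.

Lemma smooth_on_setU U U' f : smooth_on U f -> smooth_on U' f ->
  smooth_on (U `|` U') f.
Proof. by move=> fs fs' js p [Up|Up]; [exact: fs|exact: fs']. Qed.

Lemma smooth_on_partial U f j : smooth_on U f -> smooth_on U (partial j f).
Proof. by move=> fs js p Up; have := fs (rcons js j) p Up; rewrite foldr_rcons. Qed.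

(** Iterated derivatives of a product or of a composite have no fixed shape to argue
    about by induction; a class stable under differentiation absorbs them all. *)
Lemma smooth_on_coind U (C : (E -> R) -> Prop) : open U ->
  (forall f p, C f -> U p ->
     {for p, continuous f} /\ forall j, derivable f p (delta_mx 0 j)) ->
  (forall f j, C f -> exists2 g, C g & forall p, U p -> partial j f p = g p) ->
  forall f, C f -> smooth_on U f.
Proof.
move=> Uo C1 CD f Cf js.
have [g Cg fg] : exists2 g, C g & forall p, U p -> foldr (@partial R n) f js p = g p.
  elim: js => [|j js [g Cg fg]] /=; first by exists f.
  have [h Ch gh] := CD g j Cg; exists h => // p Up; rewrite -gh//.
  apply: near_eq_derive; have Up' : \forall q \near p, U q by exact: open_nbhs_nbhs.
  by apply: filterS Up' => q; exact: fg.
move=> p Up; have [gc gd] := C1 g p Cg Up.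
have Up' : \forall q \near p, g q = foldr (@partial R n) f js q.
  have : \forall q \near p, U q by exact: open_nbhs_nbhs.
  by apply: filterS => q /fg ->.
split; last by move=> j; exact: near_eq_derivable Up' (gd j).
rewrite /prop_for /continuous_at fg//.
exact: cvg_trans (near_eq_cvg Up') gc.
Qed.

(** The algebra generated by smooth functions and stable under composition with flat
    functions; it is stable under differentiation, so coinduction proves all the
    closure properties of smooth functions at once. *)
Inductive smooth_alg U : (E -> R) -> Prop :=
| SmoothGen f of smooth_on U f : smooth_alg U f
| SmoothCst c : smooth_alg U (fun=> c)
| SmoothAdd f g of smooth_alg U f & smooth_alg U g : smooth_alg U (fun p => f p + g p)
| SmoothMul f g of smooth_alg U f & smooth_alg U g : smooth_alg U (fun p => f p * g p)
| SmoothFlat k f of smooth_alg U f : smooth_alg U (fun p => flat k (f p)).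

Lemma smooth_algP U f : open U -> smooth_alg U f -> smooth_on U f.
Proof.
move=> Uo; apply: smooth_on_coind => // {f}.
  move=> f p fA Up; elim: fA => {f}.
  - by move=> f fs; exact: fs [::] p Up.
  - by move=> a; split=> [|j]; [exact: (@cst_continuous _ _ a p)|exact: derivable_cst].
  - move=> f g _ [fc fd] _ [gc gd]; split=> [|j].
      exact: (@continuousD _ _ _ f g).
    exact: (@derivableD _ _ _ f g).
  - move=> f g _ [fc fd] _ [gc gd]; split=> [|j].
      exact: (@continuousM _ _ f g).
    exact: (@derivableM _ _ f g).
  - move=> k f _ [fc fd]; split=> [|j].
      apply: (@continuous_comp _ _ _ f (flat k)) => //.
      have [] := is_derive_flat k (f p).
      by move=> /derivable1_diffP/differentiable_continuous.
    have := is_derive_comp1 (is_derive_flat k (f p)) (derivableP (fd j)).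
    by case.
move=> f j fA; suff [g gA fg] : exists2 g, smooth_alg U g &
    forall p, U p -> is_derive p (delta_mx 0 j) f (g p).
  by exists g => // p Up; have [] := fg p Up.
elim: fA => {f}.
- move=> f fs; exists (partial j f); first exact/SmoothGen/smooth_on_partial.
  by move=> p Up; apply: derivableP; exact: (fs [::] p Up).2.
- by move=> c; exists (fun=> 0) => [|p Up]; [exact: SmoothCst|exact: is_derive_cst].
- move=> f g _ [df dfA fd] _ [dg dgA gd].
  exists (fun p => df p + dg p); first exact: SmoothAdd.
  by move=> p Up; exact: is_deriveD (fd p Up) (gd p Up).
- move=> f g fA [df dfA fd] gA [dg dgA gd].
  exists (fun p => f p * dg p + g p * df p).
    by apply: SmoothAdd; exact: SmoothMul.
  by move=> p Up; exact: is_deriveM (fd p Up) (gd p Up).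
- move=> k f fA [df dfA fd].
  exists (fun p => (flat k.+2 (f p) + (- k%:R) * flat k.+1 (f p)) * df p).
    apply: SmoothMul => //; apply: SmoothAdd; first exact: SmoothFlat.
    by apply: SmoothMul; [exact: SmoothCst|exact: SmoothFlat].
  move=> p Up; rewrite mulNr.
  exact: is_derive_comp1 (is_derive_flat k (f p)) (fd p Up).
Qed.

Lemma eq_smooth_on U f g : open U -> (forall p, U p -> f p = g p) ->
  smooth_on U f -> smooth_on U g.
Proof.
move=> Uo fg fs.
apply: (@smooth_on_coind U (fun g => exists2 f, smooth_on U f &
  forall p, U p -> f p = g p)) => //; last by exists f.
  move=> {fs}g' p [f' fs fg'] Up; have [fc fd] := fs [::] p Up.
  have Up' : \forall q \near p, f' q = g' q.
    have : \forall q \near p, U q by exact: open_nbhs_nbhs.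
    by apply: filterS => q /fg' ->.
  split; last by move=> j; exact: near_eq_derivable Up' (fd j).
  rewrite /prop_for /continuous_at -fg'//.
  exact: cvg_trans (near_eq_cvg Up') fc.
move=> {fs}g' j [f' fs fg']; exists (partial j g') => //; exists (partial j f').
  exact: smooth_on_partial.
move=> p Up; apply: near_eq_derive.
have : \forall q \near p, U q by exact: open_nbhs_nbhs.
by apply: filterS => q /fg' ->.
Qed.

End SmoothFunctions.

(** * Smooth functions on a manifold, and bump functions *)

Section SmoothFun.
Variables (R : realType) (n : nat) (M : manifold R n).
Implicit Types (c : chart R n M) (W V : set M) (f g : M -> R).

Lemma open_chart_image c W : open W -> open (cmap c @` (cdom c `&` W)).
Proof.
move=> Wo; rewrite openE => _ [x [cx Wx] <-]; rewrite /interior.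
have H1 : \forall p \near cmap c x, (cmap c @` cdom c) p.
  apply: open_nbhs_nbhs; split; first exact: cimg_open.
  by exists x.
have H2 : \forall p \near cmap c x, W (cinv c p).
  apply: (cinv_continuous cx); rewrite cmapK//.
  exact: open_nbhs_nbhs.
near=> p.
have [y cy yp] : (cmap c @` cdom c) p by near: p.
have Wp : W (cinv c p) by near: p.
by exists y => //; split=> //; rewrite -(cmapK cy) yp.
Unshelve. all: by end_near. Qed.

Lemma smooth_funS W V f : W `<=` V -> smooth_fun V f -> smooth_fun W f.
Proof.
move=> WV fs c ac; apply: smooth_on_subset (fs c ac).
by move=> _ [x [cx Wx] <-]; exists x => //; split=> //; exact: WV.
Qed.

Lemma smooth_funU W V f : smooth_fun W f -> smooth_fun V f -> smooth_fun (W `|` V) f.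
Proof.
move=> fW fV c ac; apply: smooth_on_subset (smooth_on_setU (fW c ac) (fV c ac)).
by move=> _ [x [cx [Wx|Vx]] <-]; [left|right]; exists x.
Qed.

Lemma eq_smooth_fun W f g : open W -> (forall x, W x -> f x = g x) ->
  smooth_fun W f -> smooth_fun W g.
Proof.
move=> Wo fg fs c ac; apply: (eq_smooth_on _ _ (fs c ac)).
  exact: open_chart_image.
by move=> _ [x [cx Wx] <-]; rewrite cmapK// fg.
Qed.

Let salg W f : open W -> (forall c, atlas c ->
    smooth_alg (cmap c @` (cdom c `&` W)) (fun p => f (cinv c p))) -> smooth_fun W f.
Proof.
by move=> Wo H c ac; apply: smooth_algP (H c ac); exact: open_chart_image.
Qed.

Lemma smooth_fun_cst W (a : R) : open W -> smooth_fun W (fun=> a).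
Proof. by move=> Wo; apply: salg => // c ac; exact: SmoothCst. Qed.

Lemma smooth_funD W f g : open W -> smooth_fun W f -> smooth_fun W g ->
  smooth_fun W (fun x => f x + g x).
Proof.
move=> Wo fs gs; apply: salg => // c ac.
by apply: (SmoothAdd (f := fun p => f (cinv c p)));
  apply: SmoothGen; [exact: fs|exact: gs].
Qed.

Lemma smooth_funM W f g : open W -> smooth_fun W f -> smooth_fun W g ->
  smooth_fun W (fun x => f x * g x).
Proof.
move=> Wo fs gs; apply: salg => // c ac.
by apply: (SmoothMul (f := fun p => f (cinv c p)));
  apply: SmoothGen; [exact: fs|exact: gs].
Qed.

Lemma smooth_fun_flat W k f : open W -> smooth_fun W f ->
  smooth_fun W (fun x => flat k (f x)).
Proof.
move=> Wo fs; apply: salg => // c ac.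
by apply: (SmoothFlat _ (f := fun p => f (cinv c p))); apply: SmoothGen; exact: fs.
Qed.

Lemma smooth_funZ W (a : R) f : open W -> smooth_fun W f ->
  smooth_fun W (fun x => a * f x).
Proof. by move=> Wo fs; apply: smooth_funM => //; exact: smooth_fun_cst. Qed.

Lemma smooth_funN W f : open W -> smooth_fun W f -> smooth_fun W (fun x => - f x).
Proof.
move=> Wo fs; apply: (eq_smooth_fun Wo _ (smooth_funZ (-1) Wo fs)) => x _.
by rewrite mulN1r.
Qed.

Lemma smooth_fun_sum W (I : Type) (r : seq I) (P : pred I) (F : I -> M -> R) :
  open W -> (forall i, P i -> smooth_fun W (F i)) ->
  smooth_fun W (fun x => \sum_(i <- r | P i) F i x).
Proof.
move=> Wo Fs; elim: r => [|i r IH].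
  apply: (eq_smooth_fun Wo _ (smooth_fun_cst 0 Wo)) => x _.
  by rewrite big_nil.
have [Pi|Pi] := boolP (P i); last first.
  by apply: (eq_smooth_fun Wo _ IH) => x _; rewrite big_cons (negbTE Pi).
apply: (eq_smooth_fun Wo _ (smooth_funD Wo (Fs i Pi) IH)) => x _.
by rewrite big_cons Pi.
Qed.

Lemma smooth_fun_prod W (I : Type) (r : seq I) (F : I -> M -> R) :
  open W -> (forall i, smooth_fun W (F i)) ->
  smooth_fun W (fun x => \prod_(i <- r) F i x).
Proof.
move=> Wo Fs; elim: r => [|i r IH].
  apply: (eq_smooth_fun Wo _ (smooth_fun_cst 1 Wo)) => x _.
  by rewrite big_nil.
apply: (eq_smooth_fun Wo _ (smooth_funM Wo (Fs i) IH)) => x _.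
by rewrite big_cons.
Qed.

Lemma smooth_fun_det W d (A : M -> 'M[R]_d) : open W ->
  (forall i j, smooth_fun W (fun x => A x i j)) ->
  smooth_fun W (fun x => \det (A x)).
Proof.
move=> Wo As; apply: smooth_fun_sum => // s _; apply: smooth_funZ => //.
by apply: smooth_fun_prod => // i.
Qed.

Lemma smooth_fun_adj W d (A : M -> 'M[R]_d) i j : open W ->
  (forall i j, smooth_fun W (fun x => A x i j)) ->
  smooth_fun W (fun x => (\adj (A x)) i j).
Proof.
move=> Wo As; apply: (@eq_smooth_fun _ (fun x => cofactor (A x) j i)) => //.
  by move=> x _; rewrite mxE.
apply: smooth_funZ => //; apply: smooth_fun_det => // i' j'.
by apply: (eq_smooth_fun Wo _ (As (lift j i') (lift i j'))) => x _; rewrite !mxE.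
Qed.

Lemma smooth_fun_mulmx W a b d (A : M -> 'M[R]_(a, b)) (B : M -> 'M[R]_(b, d)) i j :
  open W -> (forall i j, smooth_fun W (fun x => A x i j)) ->
  (forall i j, smooth_fun W (fun x => B x i j)) ->
  smooth_fun W (fun x => (A x *m B x) i j).
Proof.
move=> Wo As Bs; apply: (@eq_smooth_fun _ (fun x => \sum_l A x i l * B x l j)) => //.
  by move=> x _; rewrite mxE.
by apply: smooth_fun_sum => // l _; exact: smooth_funM.
Qed.

Lemma smooth_coord c j : atlas c -> smooth_fun (cdom c) (fun x => cmap c x 0 j).
Proof. by move=> ac c' ac'; exact: (@atlas_compatible _ _ M c' c). Qed.

Lemma chart_at_atlas (x : M) : atlas (chart_at x).
Proof. by rewrite /chart_at; case: cid => c []. Qed.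

Lemma chart_at_dom (x : M) : cdom (chart_at x) x.
Proof. by rewrite /chart_at; case: cid => c []. Qed.

(** The support of the bump is the image of a closed ball under the inverse of a
    chart. It is compact, hence closed as the manifold is Hausdorff, so that
    extending by zero preserves smoothness. *)
Lemma exists_bump (x : M) W : open W -> W x ->
  exists chi : M -> R, [/\ smooth_fun setT chi, chi x = 1,
    forall y, ~ W y -> chi y = 0 &
    forall V f, open V -> smooth_fun (V `&` W) f ->
      smooth_fun V (fun y => chi y * f y)].
Proof.
move=> Wo Wx; pose c := chart_at x; pose p := cmap c x.
have ac : atlas c := chart_at_atlas x; have cx : cdom c x := chart_at_dom x.
have Oo : open (cdom c `&` W) by apply: openI => //; exact: cdom_open.
have [e /= e0 eP] : exists2 e : R, 0 < e & ball p e `<=` cmap c @` (cdom c `&` W).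
  apply/nbhs_ballP; apply: open_nbhs_nbhs; split; first exact: open_chart_image.
  by exists x.
(* Half the radius, for a closed ball to fit into the open one. *)
pose r := e / 2; have r0 : 0 < r by rewrite divr_gt0.
pose B : set 'rV[R]_n := closed_ball p r.
have BO : B `<=` cmap c @` (cdom c `&` W).
  move=> q; rewrite /B closed_ballE// => pq; apply: eP.
  rewrite -ball_normE /=; apply: le_lt_trans pq _.
  by rewrite /r ltr_pdivrMr// mulr_natr mulr2n ltrDl.
pose K := cinv c @` B.
have Kcl : closed K.
  apply: compact_closed; first exact: manifold_hausdorff.
  apply: continuous_compact.
    apply: continuous_in_subspaceT => q; rewrite inE => /BO[y [cy _] <-].
    exact: cinv_continuous.
  apply: bounded_closed_compact; last exact: closed_ball_closed.
  exists (`|p| + r); split; first by rewrite realE addr_ge0// ltW.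
  move=> t pt q; rewrite /B closed_ballE// => pq; apply: le_trans (ltW pt).
  rewrite -[q](subKr p); apply: le_trans (ler_normD _ _) _.
  by rewrite normrN lerD2l.
have KO : K `<=` cdom c `&` W.
  by move=> _ [q /BO[y [cy Wy] <-] <-]; rewrite cmapK.
(* Positive inside a Euclidean ball, which the ball of the maximum norm contains. *)
pose u y := r ^+ 2 - \sum_j (cmap c y 0 j - p 0 j) ^+ 2.
have ux : 0 < u x by rewrite /u big1 ?subr0 ?exprn_gt0// => j _; rewrite subrr expr0n.
pose chi y : R := if `[< cdom c y >] then (flat 0 (u x))^-1 * flat 0 (u y) else 0.
have chi0 y : ~ K y -> chi y = 0.
  move=> Ky; rewrite /chi; case: asboolP => // cy.
  rewrite (@flat_le0 _ _ (u y)) ?mulr0// leNgt; apply/negP => uy; apply: Ky.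
  exists (cmap c y); last by rewrite cmapK.
  rewrite /B closed_ballE// /closed_ball_ /=.
  rewrite /Num.Def.normr/= mx_normrE (bigmax_le _ (ltW r0))// => -[i j] _ /=.
  rewrite !mxE ord1 -(ler_pXn2r (n := 2))// ?nnegrE ?(ltW r0)//.
  rewrite real_normK ?num_real// -sqrrN opprB.
  move: uy; rewrite subr_gt0 (bigD1 j)//= => uy.
  by apply: le_trans (ltW uy); rewrite lerDl sumr_ge0// => l _; rewrite sqr_ge0.
have us : smooth_fun (cdom c) u.
  have co : open (cdom c) by exact: cdom_open.
  apply: smooth_funD => //; first exact: smooth_fun_cst.
  apply: smooth_funN => //; apply: smooth_fun_sum => // j _.
  have H : smooth_fun (cdom c) (fun y => cmap c y 0 j - p 0 j).
    by apply: smooth_funD => //; [exact: smooth_coord|exact: smooth_fun_cst].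
  exact: smooth_funM.
have chiP V f : open V -> smooth_fun (V `&` W) f ->
    smooth_fun V (fun y => chi y * f y).
  move=> Vo fs.
  have -> : V = (V `&` (cdom c `&` W)) `|` (V `&` ~` K).
    rewrite -setIUr; apply/seteqP; split=> [y Vy|y []//]; split=> //.
    by have [Ky|Ky] := pselect (K y); [left; exact: KO|right].
  apply: smooth_funU.
    have VO : open (V `&` (cdom c `&` W)) by exact: openI.
    apply: (@eq_smooth_fun _ (fun y => (flat 0 (u x))^-1 * flat 0 (u y) * f y)) => //.
      by move=> y [_ [cy _]]; rewrite /chi asboolT.
    apply: smooth_funM => //.
      apply: smooth_funZ => //; apply: smooth_fun_flat => //.
      by apply: smooth_funS us => y [_ []].
    by apply: smooth_funS fs => y [? []].
  have VK : open (V `&` ~` K) by apply: openI => //; exact: closed_openC.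
  apply: (eq_smooth_fun VK _ (smooth_fun_cst 0 VK)) => y [_ Ky].
  by rewrite chi0// mul0r.
exists chi; split=> //.
- have := chiP setT (fun=> 1) openT (smooth_fun_cst 1 (openI openT Wo)).
  by apply: eq_smooth_fun => [|y _]; [exact: openT|rewrite mulr1].
- by rewrite /chi asboolT// mulVf// gt_eqF// flat_gt0.
- by move=> y Wy; apply: chi0 => /KO[].
Qed.

End SmoothFun.

(** * Sections of bundles and of subbundles *)

Lemma hom_of_linear (R : realType) (V : vectType R) (f : V -> R^o) :
  linear f -> exists F : 'Hom(V, R^o), F =1 f.
Proof.
move=> fl; pose lf := GRing.isLinear.Build R V R^o _ f fl.
pose f' : {linear V -> R^o} := HB.pack f lf.
by exists (linfun f') => v; rewrite lfunE.
Qed.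

Section Bundles.
Variables (R : realType) (n : nat) (M : manifold R n).

(** What a vector bundle and the tangent bundle, given by its sections, have in
    common. One trivialization that is bijective at the point under study is enough to
    recover coefficients. *)
Definition linear_bundle (B : bundle_data M) : Prop :=
  [/\ forall t : triv B, open (tdom t),
      forall (t : triv B) x, tdom t x -> linear (@tmap R n M B t x) &
      forall x : M, exists t : triv B, tdom t x /\ bijective (@tmap R n M B t x)].

Lemma vector_bundle_linear (E : vector_bundle M) : linear_bundle E.
Proof.
split=> [t|t x|x]; first exact: tdom_open.
- exact: tmap_linear.
- by have [t tx] := tdom_cover E x; exists t; split=> //; exact: tmap_bij.
Qed.

Variable B : bundle_data M.
Hypothesis BL : linear_bundle B.
Implicit Types (s : section B) (S : subfamily B) (f : M -> R) (W V : set M).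

Lemma open_tdom (t : triv B) : open (tdom t). Proof. by case: BL. Qed.
Lemma tmap_lin (t : triv B) x : tdom t x -> linear (@tmap R n M B t x).
Proof. by case: BL => _ + _; apply. Qed.
Lemma tmap0 (t : triv B) x : tdom t x -> tmap t (0 : B x) = 0.
Proof.
move=> tx; have := tmap_lin tx 1 0 0; rewrite !scale1r addr0.
by rewrite -{1}[tmap _ _]addr0 => /addrI <-.
Qed.
Lemma tmapZ (t : triv B) x a (v : B x) : tdom t x -> tmap t (a *: v) = a *: tmap t v.
Proof. by move=> tx; have := tmap_lin tx a v 0; rewrite tmap0// !addr0. Qed.
Lemma tmapD (t : triv B) x (u v : B x) : tdom t x -> tmap t (u + v) = tmap t u + tmap t v.
Proof. by move=> tx; have := tmap_lin tx 1 u v; rewrite !scale1r. Qed.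
Lemma tmap_sum (t : triv B) x (I : Type) (r : seq I) (F : I -> B x) : tdom t x ->
  tmap t (\sum_(i <- r) F i) = \sum_(i <- r) tmap t (F i).
Proof.
move=> tx; elim: r => [|i r IH]; first by rewrite !big_nil tmap0.
by rewrite !big_cons tmapD// IH.
Qed.

Lemma smooth_sectionS W V s : W `<=` V -> smooth_section V s -> smooth_section W s.
Proof.
by move=> WV ss t j; apply: smooth_funS (ss t j) => y [ty Wy]; split=> //; exact: WV.
Qed.

Lemma eq_smooth_section W s s' : (forall x, s x = s' x) -> smooth_section W s ->
  smooth_section W s'.
Proof.
by move=> ss'; suff -> : s' = s by []; apply: functional_extensionality_dep => x.
Qed.

Lemma smooth_sectionD W s s' : open W -> smooth_section W s -> smooth_section W s' ->
  smooth_section W (fun y => s y + s' y).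
Proof.
move=> Wo ss ss' t j; have oo : open (tdom t `&` W) by apply: openI => //; exact: open_tdom.
apply: (eq_smooth_fun oo _ (smooth_funD oo (ss t j) (ss' t j))) => y [ty _].
by rewrite tmapD// mxE.
Qed.

Lemma smooth_sectionM W f s : open W -> smooth_fun W f -> smooth_section W s ->
  smooth_section W (fun y => f y *: s y).
Proof.
move=> Wo fs ss t j; have oo : open (tdom t `&` W) by apply: openI => //; exact: open_tdom.
have fs' : smooth_fun (tdom t `&` W) f by apply: smooth_funS fs => y [].
apply: (eq_smooth_fun oo _ (smooth_funM oo fs' (ss t j))) => y [ty _].
by rewrite tmapZ// mxE.
Qed.

Lemma smooth_section0 W : open W -> smooth_section W (fun y => 0 : B y).
Proof.
move=> Wo t j; have oo : open (tdom t `&` W) by apply: openI => //; exact: open_tdom.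
apply: (eq_smooth_fun oo _ (smooth_fun_cst 0 oo)) => y [ty _].
by rewrite tmap0// mxE.
Qed.

Lemma smooth_section_sum W (I : Type) (r : seq I) (P : pred I) (F : I -> section B) :
  open W -> (forall i, P i -> smooth_section W (F i)) ->
  smooth_section W (fun y => \sum_(i <- r | P i) F i y).
Proof.
move=> Wo Fs; elim: r => [|i r IH].
  by apply: eq_smooth_section (smooth_section0 Wo) => y; rewrite big_nil.
have [Pi|Pi] := boolP (P i); last first.
  by apply: eq_smooth_section IH => y; rewrite big_cons (negbTE Pi).
apply: eq_smooth_section (smooth_sectionD Wo (Fs i Pi) IH) => y.
by rewrite big_cons Pi.
Qed.

Lemma GammaD S s s' : Gamma S s -> Gamma S s' -> Gamma S (fun y => s y + s' y).
Proof.
move=> [ss sS] [ss' sS']; split; first by apply: smooth_sectionD => //; exact: openT.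
by move=> y; rewrite memvD.
Qed.

Lemma GammaM S f s : smooth_fun setT f -> Gamma S s -> Gamma S (fun y => f y *: s y).
Proof.
move=> fs [ss sS]; split; first by apply: smooth_sectionM => //; exact: openT.
by move=> y; rewrite memvZ.
Qed.

Lemma GammaZ S a s : Gamma S s -> Gamma S (fun y => a *: s y).
Proof. by apply: GammaM; apply: smooth_fun_cst; exact: openT. Qed.

Lemma Gamma_sum S (I : Type) (r : seq I) (P : pred I) (F : I -> section B) :
  (forall i, P i -> Gamma S (F i)) -> Gamma S (fun y => \sum_(i <- r | P i) F i y).
Proof.
move=> Fs; split; last by move=> y; apply: memv_suml => i Pi; case: (Fs i Pi).
by apply: smooth_section_sum => [|i Pi]; [exact: openT|case: (Fs i Pi)].
Qed.

Lemma GammaB S s s' : Gamma S s -> Gamma S s' -> Gamma S (fun y => s y - s' y).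
Proof.
move=> ss ss'; have := GammaD ss (GammaZ (-1) ss').
congr Gamma; apply: functional_extensionality_dep => y.
by rewrite scaleN1r.
Qed.

Lemma GammaS S S' s : (forall x, (S x <= S' x)%VS) -> Gamma S s -> Gamma S' s.
Proof. by move=> SS' [ss sS]; split=> // x; exact: (subvP (SS' x)). Qed.

Lemma Gamma_bump S W chi s : open W -> (forall y, ~ W y -> chi y = 0) ->
  (forall V f, open V -> smooth_fun (V `&` W) f -> smooth_fun V (fun y => chi y * f y)) ->
  smooth_section W s -> (forall y, W y -> s y \in S y) ->
  Gamma S (fun y => chi y *: s y).
Proof.
move=> Wo chi0 chiP ss sS; split=> [t j|y]; last first.
  have [Wy|/chi0 ->] := pselect (W y); last by rewrite scale0r mem0v.
  by rewrite memvZ// sS.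
rewrite setIT; apply: (eq_smooth_fun (open_tdom t) _ (chiP _ _ (open_tdom t) (ss t j))).
by move=> y ty; rewrite tmapZ// mxE.
Qed.

(** A constant combination of a local frame, cut off by a bump function. *)
Lemma Gamma_extension S x v : subbundle S -> v \in S x ->
  exists s, Gamma S s /\ s x = v.
Proof.
move=> /(_ x)[W [d [e [Wo Wx es eb]]]] vS.
have [chi [_ chi1 chi0 chiP]] := exists_bump Wo Wx.
pose c (i : 'I_d) := coord [tuple e i x | i < d] i v.
exists (fun y => chi y *: \sum_i c i *: e i y); split.
  apply: (Gamma_bump Wo chi0 chiP).
    apply: (smooth_section_sum _ Wo) => i _.
    exact: (smooth_sectionM Wo (smooth_fun_cst _ Wo) (es i)).
  move=> y Wy; apply: memv_suml => i _; apply: memvZ.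
  by apply: (basis_mem (eb y Wy)); apply/tnthP; exists i; rewrite tnth_mktuple.
rewrite chi1 scale1r [RHS](coord_basis (eb x Wx) vS).
by apply: eq_bigr => i _; rewrite nth_mktuple.
Qed.

(** As [L] is constant, [A y *m L] is a square matrix that depends smoothly on [y] and
    is the identity at [x]: its adjugate inverts the frame near [x] up to a
    determinant, without any division. *)
Lemma frame_matrix S x : subbundle S ->
  exists (t : triv B) (U : set M) (d : nat) (e : 'I_d -> section B)
      (A : M -> 'M[R]_(d, trank t)) (L : 'M[R]_(trank t, d)),
    [/\ [/\ open U, U x, U `<=` tdom t & bijective (@tmap R n M B t x)],
        forall i, smooth_section U (e i),
        forall y, U y -> basis_of (S y) [tuple e i y | i < d],
        (forall i j, smooth_fun U (fun y => A y i j)) /\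
          (forall y i, row i (A y) = tmap t (e i y)) & A x *m L = 1%:M].
Proof.
move=> /(_ x)[W [d [e [Wo Wx es eb]]]].
have [t [tx tb]] : exists t : triv B, tdom t x /\ bijective (@tmap R n M B t x).
  by case: BL.
pose A y : 'M[R]_(d, trank t) := \matrix_(i, j) tmap t (e i y) 0 j.
have rA y i : row i (A y) = tmap t (e i y) by apply/rowP => j; rewrite !mxE.
have /row_freeP[L AL] : row_free (A x).
  rewrite -kermx_eq0; apply/rowV0P => u /sub_kermxP uA.
  have : tmap t (\sum_i u 0 i *: e i x) = tmap t (0 : B x).
    rewrite tmap0// -[RHS]uA mulmx_sum_row tmap_sum//; apply: eq_bigr => i _.
    by rewrite tmapZ// rA.
  move/(bij_inj tb) => ue; have /andP[_ fr] := eb x Wx.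
  apply/rowP => i; rewrite mxE; move/freeP: fr => /(_ (fun i => u 0 i)).
  by apply; rewrite -[RHS]ue; apply: eq_bigr => j _; rewrite nth_mktuple.
exists t, (tdom t `&` W), d, e, A, L; split=> //.
- by split=> //; apply: openI => //; exact: open_tdom.
- by move=> i; apply: smooth_sectionS (es i) => y [].
- by move=> y [_ Wy]; exact: eb.
- split=> // i j; apply: (eq_smooth_fun _ _ (es i t j)).
    by apply: openI => //; exact: open_tdom.
  by move=> y _; rewrite mxE.
Qed.

(** Over a neighbourhood of [x], Cramer's rule turns the coefficients of a section
    in a local frame, multiplied by a determinant that is 1 at [x], into polynomials
    in smooth functions. *)
Lemma Gamma_vanishing S x s : subbundle S -> Gamma S s -> s x = 0 ->
  exists (d : nat) (f : 'I_d -> M -> R) (e : 'I_d -> section B) (g : M -> R),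
    [/\ forall i, smooth_fun setT (f i) /\ f i x = 0,
        forall i, Gamma S (e i),
        smooth_fun setT g /\ g x = 0 &
        forall y, s y = \sum_i f i y *: e i y + g y *: s y].
Proof.
move=> Ssub [ss sS] sx0.
have [t [U [d [e [A [L [[Uo Ux Ut tb] es eb [As Ae] AL]]]]]]] := frame_matrix x Ssub.
have [chi [chis chi1 chi0 chiP]] := exists_bump Uo Ux.
pose D y := \det (A y *m L).
pose h y : 'rV[R]_d := tmap t (s y) *m L *m \adj (A y *m L).
have ALs i j : smooth_fun U (fun y => (A y *m L) i j).
  by apply: (smooth_fun_mulmx _ _ Uo As) => i' j'; exact: smooth_fun_cst Uo.
have Ds : smooth_fun U D := smooth_fun_det Uo ALs.
have hs i : smooth_fun U (fun y => h y 0 i).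
  apply: (smooth_fun_mulmx _ _ Uo) => [j k|j k]; last exact: (smooth_fun_adj _ _ Uo ALs).
  apply: (smooth_fun_mulmx _ _ Uo) => [j' k'|j' k']; last exact: smooth_fun_cst Uo.
  by rewrite ord1; apply: smooth_funS (ss t k') => y Uy; split=> //; exact: Ut.
have chiT f : smooth_fun U f -> smooth_fun setT (fun y => chi y * f y).
  by move=> fs; apply: chiP; [exact: openT|rewrite setTI].
have he y : U y -> \sum_i h y 0 i *: e i y = D y *: s y.
  move=> Uy; pose phi : 'rV[R]_d := \row_i coord [tuple e i y | i < d] i (s y).
  have sE : s y = \sum_i phi 0 i *: e i y.
    rewrite {1}(coord_basis (eb y Uy) (sS y)); apply: eq_bigr => i _.
    by rewrite nth_mktuple mxE.
  have tsE : tmap t (s y) = phi *m A y.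
    rewrite {1}sE mulmx_sum_row tmap_sum; last exact: Ut.
    by apply: eq_bigr => i _; rewrite tmapZ ?Ae//; exact: Ut.
  have -> : h y = D y *: phi.
    by rewrite /h tsE -!mulmxA (mulmxA (A y)) mul_mx_adj mul_mx_scalar.
  rewrite [in RHS]sE scaler_sumr; apply: eq_bigr => i _.
  by rewrite mxE scalerA.
exists d, (fun i y => chi y * h y 0 i), (fun i y => chi y *: e i y),
  (fun y => 1 - chi y * (chi y * D y)); split.
- move=> i; split; first exact: chiT (hs i).
  by rewrite /h sx0 tmap0; [rewrite !mul0mx mxE mulr0|exact: Ut].
- move=> i; apply: (Gamma_bump Uo chi0 chiP) => // y Uy.
  by apply: (basis_mem (eb y Uy)); apply/tnthP; exists i; rewrite tnth_mktuple.
- split; last by rewrite chi1 /D AL det1 !mul1r subrr.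
  apply: smooth_funD; [exact: openT|by apply: smooth_fun_cst; exact: openT|].
  apply: smooth_funN; first exact: openT.
  exact: (smooth_funM openT chis (chiT _ Ds)).
move=> y; have [Uy|/chi0 c0] := pselect (U y); last first.
  rewrite c0 !mul0r subr0 scale1r big1 ?add0r// => i _.
  by rewrite mul0r scale0r.
rewrite (eq_bigr (fun i => (chi y * chi y) *: (h y 0 i *: e i y))); last first.
  by move=> i _; rewrite !scalerA -mulrA -mulrA [h y 0 i * _]mulrC.
by rewrite -scaler_sumr he// scalerA -mulrA scalerBl scale1r addrC subrK.
Qed.

(** At a point [y] near [x], subtracting from the constant extension its value on
    the component along the frame gives a covector killing the frame. *)
Lemma covector_extension S x (th : 'Hom(B x, R^o)) : subbundle S ->
  (forall v, v \in S x -> th v = 0) ->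
  exists Th : forall y, 'Hom(B y, R^o),
    [/\ forall y v, v \in S y -> Th y v = 0, Th x = th &
        forall s, smooth_section setT s -> smooth_fun setT (fun y => Th y (s y) : R)].
Proof.
move=> Ssub th0.
have [t [U [d [e [A [L [[Uo Ux Ut tb] es eb [As Ae] AL]]]]]]] := frame_matrix x Ssub.
have [chi [chis chi1 chi0 chiP]] := exists_bump Uo Ux.
have [l lE] : exists l : 'cV[R]_(trank t), forall v : B x, th v = (tmap t v *m l) 0 0.
  have [g gK Kg] := tb; have tx := Ut _ Ux.
  have vE (v : B x) : v = \sum_i (tmap t v) 0 i *: g (delta_mx 0 i).
    apply: (bij_inj tb); rewrite tmap_sum// [LHS](row_sum_delta (tmap t v)).
    by apply: eq_bigr => i _; rewrite tmapZ// Kg.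
  exists (\col_i (th (g (delta_mx 0 i)) : R)) => v; rewrite mxE {1}[v]vE linear_sum.
  by apply: eq_bigr => i _ /=; rewrite linearZ mxE.
pose D y := \det (A y *m L).
pose P y : 'M[R]_(trank t) := D y *: 1%:M - L *m \adj (A y *m L) *m A y.
pose H y (v : B y) : R^o := chi y * (tmap t v *m (P y *m l)) 0 0.
have Hlin y : linear (@H y).
  move=> a u v; rewrite /H; have [Uy|/chi0 ->] := pselect (U y); last first.
    by rewrite !mul0r scaler0 addr0.
  have ty := Ut _ Uy; rewrite tmapD// tmapZ// mulmxDl -scalemxAl !mxE mulrDr.
  by rewrite mulrCA.
have /(_ _)/cid-/all_sig[Th ThE] y : exists F : 'Hom(B y, R^o), F =1 @H y.
  exact: hom_of_linear.
have ALs i j : smooth_fun U (fun y => (A y *m L) i j).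
  by apply: (smooth_fun_mulmx _ _ Uo As) => i' j'; exact: smooth_fun_cst Uo.
have Ds : smooth_fun U D := smooth_fun_det Uo ALs.
exists Th; split.
- move=> y v vS; rewrite ThE /H; have [Uy|/chi0 ->] := pselect (U y); last by rewrite mul0r.
  suff -> : tmap t v *m (P y *m l) = 0 by rewrite mxE mulr0.
  pose phi : 'rV[R]_d := \row_i coord [tuple e i y | i < d] i v.
  have tsE : tmap t v = phi *m A y.
    rewrite {1}(coord_basis (eb y Uy) vS) mulmx_sum_row tmap_sum; last exact: Ut.
    by apply: eq_bigr => i _; rewrite tmapZ ?Ae ?nth_mktuple ?mxE//; exact: Ut.
  rewrite tsE -mulmxA (mulmxA (A y)); suff -> : A y *m P y = 0 by rewrite mul0mx mulmx0.
  rewrite /P mulmxBr -scalemxAr mulmx1 !mulmxA mul_mx_adj.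
  by rewrite mul_scalar_mx subrr.
- apply/lfunP => v; rewrite ThE /H chi1 mul1r /P /D AL det1 scale1r adj1.
  rewrite mulmx1 mulmxA mulmxBr mulmx1 mulmxBl [LHS]mxE -lE [X in _ + X]mxE.
  set u := tmap t v *m L; rewrite mulmxA -/u.
  have -> : u *m A x = tmap t (\sum_i u 0 i *: e i x).
    rewrite mulmx_sum_row tmap_sum; last exact: Ut.
    by apply: eq_bigr => i _; rewrite tmapZ ?Ae//; exact: Ut.
  rewrite -lE [X in _ - X]th0 ?subr0//; apply: memv_suml => i _; apply: memvZ.
  by apply: (basis_mem (eb x Ux)); apply/tnthP; exists i; rewrite tnth_mktuple.
- move=> s ss; have : smooth_fun setT (fun y => chi y * (tmap t (s y) *m (P y *m l)) 0 0).
    apply: chiP; first exact: openT.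
    rewrite setTI; apply: (smooth_fun_mulmx _ _ Uo) => [i j|i j].
      by rewrite ord1; apply: smooth_funS (ss t j) => y Uy; split=> //; exact: Ut.
    apply: (smooth_fun_mulmx _ _ Uo) => [i' j'|i' j']; last exact: smooth_fun_cst Uo.
    pose Q y := L *m \adj (A y *m L) *m A y.
    have Qs : smooth_fun U (fun y => Q y i' j').
      apply: (smooth_fun_mulmx _ _ Uo _ As) => a b.
      apply: (smooth_fun_mulmx _ _ Uo) => [a' b'|a' b']; first exact: smooth_fun_cst Uo.
      exact: (smooth_fun_adj _ _ Uo ALs).
    have Ds' := smooth_funM Uo Ds (smooth_fun_cst ((1%:M : 'M[R]_(trank t)) i' j') Uo).
    apply: (eq_smooth_fun Uo _ (smooth_funD Uo Ds' (smooth_funN Uo Qs))).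
    by move=> y _; rewrite !mxE.
  by apply: eq_smooth_fun => [|y _]; [exact: openT|rewrite ThE].
Qed.

End Bundles.

(** * The tangent bundle and the Lie bracket *)

Section Tangent.
Variables (R : realType) (n : nat) (M : manifold R n).
Implicit Types (x : M) (X Y Z : vector_field M) (f : M -> R) (c : chart R n M).

Lemma derivable_rowP (V : normedModType R) d (F : V -> 'rV[R]_d) p v :
  derivable F p v <-> forall j, derivable (fun q => F q 0 j) p v.
Proof.
by split=> [/derivable_mxP H j|H]; [exact: H|apply/derivable_mxP => i j; rewrite ord1].
Qed.

Lemma derive_row (V : normedModType R) d (F : V -> 'rV[R]_d) p v j :
  (forall j, derivable (fun q => F q 0 j) p v) ->
  ('D_v F p) 0 j = 'D_v (fun q => F q 0 j) p.
Proof. by move/derivable_rowP => H; rewrite derive_mx// mxE. Qed.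

Lemma rowB d (u v : 'rV[R]_d) j : (u - v) 0 j = u 0 j - v 0 j.
Proof. by rewrite !mxE. Qed.

Lemma rowDZ d (a : R) (u v : 'rV[R]_d) j : (a *: u + v) 0 j = a * u 0 j + v 0 j.
Proof. by rewrite !mxE. Qed.

Lemma rowZB d (a b : R) (u v : 'rV[R]_d) j :
  (a *: u - b *: v) 0 j = a * u 0 j - b * v 0 j.
Proof. by rewrite !mxE. Qed.

(** The differential of a transition map is linear because its components have
    continuous partial derivatives. *)
Lemma tangent_coordE c x : atlas c -> cdom c x ->
  exists J : 'M[R]_n, forall v : TM M x, @tangent_coord R n M c x v = (v : 'rV[R]_n) *m J.
Proof.
move=> ac cx; pose ch := chart_at x; pose p := cmap ch x.
pose U := cmap ch @` (cdom ch `&` cdom c).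
have Uo : open U by apply: open_chart_image; exact: cdom_open.
have Up : U p by exists x => //; split=> //; exact: chart_at_dom.
pose F q := cmap c (cinv ch q).
have Fs j : smooth_on U (fun q => F q 0 j).
  exact: (atlas_compatible (chart_at_atlas x) ac).
exists (\matrix_(l, j) partial l (fun q => F q 0 j) p) => v.
apply/rowP => j; rewrite /tangent_coord derive_row; last first.
  by move=> j'; exact: smooth_on_derivable Uo (Fs j') _ _ Up.
rewrite (smooth_on_deriveE Uo (Fs j) v Up) mxE; apply: eq_bigr => l _.
by rewrite mxE.
Qed.

Lemma tangent_coord_at x (v : TM M x) : @tangent_coord R n M (chart_at x) x v = v.
Proof.
rewrite /tangent_coord; set c := chart_at x.
have cx : cdom c x := chart_at_dom x.
transitivity ('D_(v : 'rV[R]_n) (id : 'rV[R]_n -> 'rV[R]_n) (cmap c x)).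
  apply: near_eq_derive.
  have : \forall q \near cmap c x, (cmap c @` cdom c) q.
    by apply: open_nbhs_nbhs; split; [exact: cimg_open|exists x].
  by apply: filterS => _ [y cy <-]; rewrite cmapK.
exact: derive_id.
Qed.

Lemma TM_linear : linear_bundle (TM M).
Proof.
split=> [[c ac]|[c ac] x cx a u v|x] /=; first exact: cdom_open.
- have [J JE] := tangent_coordE ac cx.
  by rewrite !JE mulmxDl scalemxAl.
- exists (exist _ (chart_at x) (chart_at_atlas x)); split; first exact: chart_at_dom.
  by exists id => v /=; rewrite tangent_coord_at.
Qed.

(** The chart at [x] is the one in which the bracket at [x] is computed. *)
Definition vf_coord x X (j : 'I_n) : 'rV[R]_n -> R := fun p => vf_in_chart (chart_at x) X p 0 j.
Definition chart_range x : set 'rV[R]_n := cmap (chart_at x) @` cdom (chart_at x).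

Lemma open_chart_range x : open (chart_range x). Proof. exact: cimg_open. Qed.

Lemma chart_range_at x : chart_range x (cmap (chart_at x) x).
Proof. by exists x => //; exact: chart_at_dom. Qed.

Lemma vf_coord_smooth x X j : smooth_vf X -> smooth_on (chart_range x) (vf_coord x X j).
Proof.
move=> Xs; have := Xs (exist _ (chart_at x) (chart_at_atlas x)) j _ (chart_at_atlas x).
by apply: smooth_on_subset => _ [y cy <-]; exists y.
Qed.

Lemma vf_coord_at x X j : vf_coord x X j (cmap (chart_at x) x) = (X x : 'rV[R]_n) 0 j.
Proof.
rewrite /vf_coord /vf_in_chart cmapK; last exact: chart_at_dom.
by rewrite tangent_coord_at.
Qed.

Lemma vf_coord_lin x a X Y j p : chart_range x p ->
  vf_coord x (fun y => a *: X y + Y y) j p = a * vf_coord x X j p + vf_coord x Y j p.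
Proof.
move=> [y cy <-]; rewrite /vf_coord /vf_in_chart cmapK//.
have [J JE] := tangent_coordE (chart_at_atlas x) cy.
by rewrite !JE mulmxDl -scalemxAl !mxE.
Qed.

Lemma vf_coord_mul x f X j p : chart_range x p ->
  vf_coord x (fun y => f y *: X y) j p = f (cinv (chart_at x) p) * vf_coord x X j p.
Proof.
move=> [y cy <-]; rewrite /vf_coord /vf_in_chart cmapK//.
have [J JE] := tangent_coordE (chart_at_atlas x) cy.
by rewrite !JE -scalemxAl !mxE.
Qed.

Lemma lie_coord X Y x j : smooth_vf X -> smooth_vf Y ->
  (lie X Y x : 'rV[R]_n) 0 j =
    'D_(X x : 'rV[R]_n) (vf_coord x Y j) (cmap (chart_at x) x) -
    'D_(Y x : 'rV[R]_n) (vf_coord x X j) (cmap (chart_at x) x).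
Proof.
move=> Xs Ys; have d Z j' v : smooth_vf Z ->
    derivable (vf_coord x Z j') (cmap (chart_at x) x) v.
  move=> Zs; exact: (smooth_on_derivable (@open_chart_range x)
    (@vf_coord_smooth x Z j' Zs) (chart_range_at x)).
rewrite -(derive_row (F := vf_in_chart (chart_at x) Y)); last by move=> j'; exact: d.
rewrite -(derive_row (F := vf_in_chart (chart_at x) X)); last by move=> j'; exact: d.
exact: rowB.
Qed.

Lemma derive_vf_coordE X x j (v : 'rV[R]_n) : smooth_vf X ->
  'D_v (vf_coord x X j) (cmap (chart_at x) x) =
    \sum_l v 0 l * partial l (vf_coord x X j) (cmap (chart_at x) x).
Proof.
move=> Xs; exact: (smooth_on_deriveE (@open_chart_range x)
  (@vf_coord_smooth x X j Xs) v (chart_range_at x)).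
Qed.

Lemma is_derive_vf_coord X x j (v : 'rV[R]_n) : smooth_vf X ->
  is_derive (cmap (chart_at x) x) v (vf_coord x X j) ('D_v (vf_coord x X j) (cmap (chart_at x) x)).
Proof.
move=> Xs; apply: derivableP.
exact: (smooth_on_derivable (@open_chart_range x) (@vf_coord_smooth x X j Xs) (chart_range_at x)).
Qed.

Lemma near_chart_range x (P : 'rV[R]_n -> Prop) : (forall p, chart_range x p -> P p) ->
  \forall p \near cmap (chart_at x) x, P p.
Proof.
move=> H; have : \forall p \near cmap (chart_at x) x, chart_range x p.
  by apply: open_nbhs_nbhs; split; [exact: open_chart_range|exact: chart_range_at].
exact: filterS.
Qed.

(** The bracket at [x] as a difference of directional derivatives, of which only the
    linearity and the Leibniz rule are remembered. *)
Lemma lie_local x : exists D : 'rV[R]_n -> vector_field M -> 'I_n -> R,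
  [/\ forall a u v X j, smooth_vf X -> D (a *: u + v) X j = a * D u X j + D v X j,
      forall a v X Y j, smooth_vf X -> smooth_vf Y ->
        D v (fun y => a *: X y + Y y) j = a * D v X j + D v Y j,
      forall f X Y j, smooth_fun setT f -> smooth_vf X ->
        D (Y x) (fun y => f y *: X y) j =
          f x * D (Y x) X j + derive_fun Y f x * (X x : 'rV[R]_n) 0 j &
      forall X Y j, smooth_vf X -> smooth_vf Y ->
        (lie X Y x : 'rV[R]_n) 0 j = D (X x) Y j - D (Y x) X j].
Proof.
exists (fun v X j => 'D_v (vf_coord x X j) (cmap (chart_at x) x)); split.
- move=> a u v X j Xs; rewrite (derive_vf_coordE x j _ Xs) (derive_vf_coordE x j u Xs).
  rewrite (derive_vf_coordE x j v Xs) mulr_sumr -big_split; apply: eq_bigr => l _ /=.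
  by rewrite rowDZ mulrDl mulrA.
- move=> a v X Y j Xs Ys.
  have H := is_deriveD (is_deriveZ a (is_derive_vf_coord x j v Xs)) (is_derive_vf_coord x j v Ys).
  apply: (@derive_val _ _ _ _ _ _ _ (near_eq_is_derive _ H)).
  by apply: near_chart_range => q Uq; rewrite vf_coord_lin.
- move=> f X Y j fs Xs.
  pose g q := f (cinv (chart_at x) q).
  have gs : smooth_on (chart_range x) g.
    by apply: smooth_on_subset (fs _ (chart_at_atlas x)) => _ [y cy <-]; exists y.
  have gp : g (cmap (chart_at x) x) = f x by rewrite /g cmapK//; exact: chart_at_dom.
  have Hg : is_derive (cmap (chart_at x) x) (Y x : 'rV[R]_n) g (derive_fun Y f x).
    by apply: derivableP; exact: (smooth_on_derivable (@open_chart_range x) gs (chart_range_at x)).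
  have H := is_deriveM Hg (is_derive_vf_coord x j (Y x : 'rV[R]_n) Xs).
  rewrite -[in f x * _]gp -(vf_coord_at x X j) [derive_fun _ _ _ * _]mulrC.
  apply: (@derive_val _ _ _ _ _ _ _ (near_eq_is_derive _ H)).
  by apply: near_chart_range => q Uq; rewrite vf_coord_mul.
- by move=> X Y j Xs Ys; exact: lie_coord.
Qed.

Lemma lieC X Y x : lie X Y x = - lie Y X x.
Proof. by rewrite /lie opprB. Qed.

Lemma lie_id X x : lie X X x = 0.
Proof. by rewrite /lie subrr. Qed.

Lemma smooth_vf_lin a X Y : smooth_vf X -> smooth_vf Y ->
  smooth_vf (fun y => a *: X y + Y y).
Proof.
move=> Xs Ys; apply: (smooth_sectionD TM_linear openT _ Ys).
by apply: (smooth_sectionM TM_linear openT _ Xs); apply: smooth_fun_cst; exact: openT.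
Qed.

Lemma lie_linl a X Y Z x : smooth_vf X -> smooth_vf Y -> smooth_vf Z ->
  lie (fun y => a *: X y + Y y) Z x = a *: lie X Z x + lie Y Z x.
Proof.
move=> Xs Ys Zs; have [D [D1 D2 _ DE]] := lie_local x; apply/rowP => j.
apply: (etrans (DE _ _ j (smooth_vf_lin a Xs Ys) Zs)).
apply: (etrans _ (esym (rowDZ a (lie X Z x) (lie Y Z x) j))).
apply: (etrans _ (esym (congr2 (fun u v => a * u + v) (DE _ _ j Xs Zs) (DE _ _ j Ys Zs)))).
rewrite D2//; apply: (etrans (congr1 (fun u => u - _) (D1 a (X x) (Y x) Z j Zs))).
by rewrite mulrBr opprD addrACA.
Qed.

Lemma opp_lin (V : lmodType R) a (u v u' v' : V) : u' = - u -> v' = - v ->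
  - (a *: u + v) = a *: u' + v'.
Proof. by move=> -> ->; rewrite opprD scalerN. Qed.

Lemma lie_linr a X Y Z x : smooth_vf X -> smooth_vf Y -> smooth_vf Z ->
  lie Z (fun y => a *: X y + Y y) x = a *: lie Z X x + lie Z Y x.
Proof.
move=> Xs Ys Zs; apply: (etrans (lieC _ _ _)).
apply: (etrans (congr1 -%R (lie_linl a x Xs Ys Zs))).
exact: (opp_lin a (lieC Z X x) (lieC Z Y x)).
Qed.

Lemma lie_mull f X Y x : smooth_fun setT f -> smooth_vf X -> smooth_vf Y ->
  lie (fun y => f y *: X y) Y x = f x *: lie X Y x - derive_fun Y f x *: X x.
Proof.
move=> fs Xs Ys; have [D [D1 _ D3 DE]] := lie_local x; apply/rowP => j.
have fXs : smooth_vf (fun y => f y *: X y).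
  exact: (smooth_sectionM TM_linear openT fs Xs).
apply: (etrans (DE _ _ j fXs Ys)).
apply: (etrans _ (esym (rowZB (f x) (derive_fun Y f x) (lie X Y x) (X x) j))).
apply: (etrans _ (esym (congr1 (fun u => f x * u - _) (DE _ _ j Xs Ys)))).
rewrite D3// mulrBr opprD addrA; congr (_ - _ - _).
have D0 : D 0 Y j = 0.
  have := D1 1 0 0 Y j Ys; rewrite scale1r addr0 mul1r.
  by rewrite -{1}[D 0 Y j]addr0 => /addrI <-.
have := D1 (f x) (X x) 0 Y j Ys; rewrite D0 !addr0; exact.
Qed.

End Tangent.

(** * Derivatives of sections vanishing at a point *)

Section Filtrations.
Variables (R : realType) (n : nat) (M : manifold R n).
Variables (H : foliated_filtration M) (E : vector_bundle M).
Variables (F : bundle_filtration E) (D : connection E).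
Implicit Types (x : M) (X Y Z : vector_field M) (s : section E) (f : M -> R).

Let TL := @TM_linear R n M.
Let EL := vector_bundle_linear E.

Lemma fH_le i j x : (i <= j)%N -> (H i x <= H j x)%VS.
Proof. by apply: (subv_chain (G := fun i => H i x)) => {}i; exact: fH_incr. Qed.

Lemma fE_le p q x : p <= q -> (F q x <= F p x)%VS.
Proof.
rewrite -subr_ge0 => pq; rewrite -(subrK p q) addrC.
move: pq; case: (q - p) => // d _; elim: d => [|d IH]; first by rewrite addr0.
by apply: subv_trans IH; rewrite -addn1 PoszD addrA fE_decr.
Qed.

Lemma GammaH_smooth i X : Gamma (H i) X -> smooth_vf X.
Proof. by case. Qed.

Lemma smooth_GammaH : exists r, (forall x, H r x = fullv) /\
  forall X, smooth_vf X -> Gamma (H r) X.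
Proof.
have [r rP] := fH_full H; exists r; split=> [x|X Xs]; first exact: rP.
by split=> // x; rewrite rP// memvf.
Qed.

Lemma lie_smooth X Y : smooth_vf X -> smooth_vf Y -> smooth_vf (lie X Y).
Proof.
have [r [_ rG]] := smooth_GammaH => /rG Xr /rG Yr.
exact: GammaH_smooth (fH_bracket Xr Yr).
Qed.

Lemma vf_extension x (v : TM M x) : exists X, smooth_vf X /\ X x = v.
Proof.
have [r [rf _]] := smooth_GammaH.
have [|X [[Xs _] Xx]] := Gamma_extension TL (fH_subbundle H r) (x := x) (v := v).
  by rewrite rf memvf.
by exists X.
Qed.

Lemma eq_liel X X' Y x : (forall y, X y = X' y) -> lie X Y x = lie X' Y x.
Proof. by move=> XX'; have -> : X = X' by exact: functional_extensionality_dep. Qed.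

Lemma lieZl a X Y x : smooth_vf X -> smooth_vf Y ->
  lie (fun y => a *: X y) Y x = a *: lie X Y x.
Proof.
move=> Xs Ys; apply: (etrans (lie_mull x (smooth_fun_cst a (@openT M)) Xs Ys)).
by rewrite /derive_fun derive_cst scale0r subr0.
Qed.

Lemma lie_suml (I : Type) (r : seq I) (P : pred I) (c : I -> vector_field M) Y x :
  (forall i, P i -> smooth_vf (c i)) -> smooth_vf Y ->
  lie (fun y => \sum_(i <- r | P i) c i y) Y x = \sum_(i <- r | P i) lie (c i) Y x.
Proof.
move=> cs Ys; elim: r => [|i r IH].
  rewrite big_nil; apply: (etrans (eq_liel (X' := fun y => 0 *: Y y) _ _ _)).
    by move=> y; rewrite big_nil scale0r.
  by apply: (etrans (lieZl 0 x Ys Ys)); rewrite scale0r.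
rewrite big_cons; case: ifPn => Pi; last first.
  by apply: (etrans _ IH); apply: eq_liel => y; rewrite big_cons (negbTE Pi).
have ss : smooth_vf (fun y => \sum_(i <- r | P i) c i y).
  exact: (smooth_section_sum TL _ openT cs).
apply: (etrans (eq_liel (X' := fun y => 1 *: c i y + \sum_(i <- r | P i) c i y) _ _ _)).
  by move=> y; rewrite big_cons Pi scale1r.
apply: (etrans (lie_linl 1 x (cs i Pi) ss Ys)).
exact: (congr2 +%R (scale1r _) IH).
Qed.

(** A bracket differentiates its arguments, but it differentiates a section of [S]
    vanishing at [x] only through coefficients of sections of [S]. *)
Lemma lie_vanishing (S : subfamily (TM M)) Z Y x : subbundle S -> Gamma S Z ->
  Z x = 0 -> smooth_vf Y -> lie Z Y x \in S x.
Proof.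
move=> Ssub ZS Zx0 Ys.
have [d [f [e [g [fP eS [gs gx] ZE]]]]] := Gamma_vanishing TL Ssub ZS Zx0.
have es i : smooth_vf (e i) by case: (eS i).
have fes i : smooth_vf (fun y => f i y *: e i y).
  exact: (smooth_sectionM TL openT (fP i).1 (es i)).
have Zs : smooth_vf Z by case: ZS.
have sums : smooth_vf (fun y => \sum_i f i y *: e i y).
  exact: (smooth_section_sum TL _ openT (fun i _ => fes i)).
have L0 := lie_linl 1 x sums (smooth_sectionM TL openT gs Zs) Ys.
have L1 := @lie_suml 'I_d (index_enum 'I_d) xpredT (fun i y => f i y *: e i y) Y x
  (fun i _ => fes i) Ys.
have L2 := lie_mull x gs Zs Ys.
have L3 i := lie_mull x (fP i).1 (es i) Ys.
have -> : lie Z Y x = \sum_i (- (derive_fun Y (f i) x)) *: e i x.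
  apply: (etrans (eq_liel
    (X' := fun y => 1 *: (\sum_i f i y *: e i y) + g y *: Z y) _ _ _)).
    by move=> y; rewrite scale1r -ZE.
  apply: (etrans L0); apply: (etrans (congr2 (fun u v => 1 *: u + v) L1 L2)).
  rewrite gx Zx0 scale0r scaler0 subr0 addr0 scale1r; apply: eq_bigr => i _.
  by apply: (etrans (L3 i)); rewrite (fP i).2 scale0r sub0r scaleNr.
by apply: memv_suml => i _; apply: memvZ; case: (eS i).
Qed.

Lemma nabla0 X x : smooth_vf X -> D X (fun y => 0 : E y) x = 0.
Proof.
move=> Xs; have s0 := smooth_section0 EL openT.
have := nablaDr D x Xs s0 s0.
have -> : (fun y => (0 : E y) + 0) = (fun y => 0 : E y).
  by apply: functional_extensionality_dep => y; rewrite addr0.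
by move/eqP; rewrite -subr_eq0 opprD addrA subrr sub0r oppr_eq0 => /eqP.
Qed.

Lemma nabla_linr a X s s' x : smooth_vf X -> smooth_section setT s ->
  smooth_section setT s' ->
  D X (fun y => a *: s y + s' y) x = a *: D X s x + D X s' x.
Proof.
move=> Xs ss ss'; have as_ := smooth_fun_cst a (@openT M).
rewrite (nablaDr D x Xs (smooth_sectionM EL openT as_ ss) ss').
rewrite (nabla_Leibniz D x as_ Xs ss).
by rewrite /derive_fun derive_cst scale0r add0r.
Qed.

Lemma nabla_linl a X Y s x : smooth_vf X -> smooth_vf Y -> smooth_section setT s ->
  D (fun y => a *: X y + Y y) s x = a *: D X s x + D Y s x.
Proof.
move=> Xs Ys ss; have as_ := smooth_fun_cst a (@openT M).
rewrite (nablaDl D x (smooth_sectionM TL openT as_ Xs) Ys ss).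
by rewrite (nablaZl D x as_ Xs ss).
Qed.

Lemma nabla_sumr (I : Type) (r : seq I) (P : pred I) (c : I -> section E) X x :
  (forall i, P i -> smooth_section setT (c i)) -> smooth_vf X ->
  D X (fun y => \sum_(i <- r | P i) c i y) x = \sum_(i <- r | P i) D X (c i) x.
Proof.
move=> cs Xs; elim: r => [|i r IH].
  rewrite big_nil -(nabla0 x Xs); congr (D X _ x).
  by apply: functional_extensionality_dep => y; rewrite big_nil.
rewrite big_cons; case: ifPn => Pi; last first.
  rewrite -IH; congr (D X _ x); apply: functional_extensionality_dep => y.
  by rewrite big_cons (negbTE Pi).
rewrite -IH -(nablaDr D x Xs (cs i Pi) (smooth_section_sum EL _ openT cs)).
congr (D X _ x); apply: functional_extensionality_dep => y.
by rewrite big_cons Pi.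
Qed.

Lemma nabla_field0 s x : smooth_section setT s -> D (fun y => 0 : TM M y) s x = 0.
Proof.
move=> ss; have X0 := smooth_section0 TL openT.
have := nabla_linl (-1) x X0 X0 ss; rewrite scaleN1r addNr => <-.
congr (D _ s x); apply: functional_extensionality_dep => y.
by rewrite scaler0 addr0.
Qed.

Lemma nabla_suml (I : Type) (r : seq I) (P : pred I) (c : I -> vector_field M) s x :
  (forall i, P i -> smooth_vf (c i)) -> smooth_section setT s ->
  D (fun y => \sum_(i <- r | P i) c i y) s x = \sum_(i <- r | P i) D (c i) s x.
Proof.
move=> cs ss; elim: r => [|i r IH].
  rewrite big_nil -(nabla_field0 x ss); congr (D _ s x).
  by apply: functional_extensionality_dep => y; rewrite big_nil.
rewrite big_cons; case: ifPn => Pi; last first.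
  rewrite -IH; congr (D _ s x); apply: functional_extensionality_dep => y.
  by rewrite big_cons (negbTE Pi).
rewrite -IH -(nablaDl D x (cs i Pi) (smooth_section_sum TL _ openT cs) ss).
congr (D _ s x); apply: functional_extensionality_dep => y.
by rewrite big_cons Pi.
Qed.

(** By the Leibniz rule, only the coefficients of a combination of sections of [S]
    get differentiated when they vanish at [x]. *)
Lemma nabla_vanishing_section (S : subfamily E) X s x : subbundle S -> Gamma S s ->
  s x = 0 -> smooth_vf X -> D X s x \in S x.
Proof.
move=> Ssub sS sx0 Xs.
have [d [f [e [g [fP eS [gs gx] sE]]]]] := Gamma_vanishing EL Ssub sS sx0.
have es i : smooth_section setT (e i) by case: (eS i).
have fes i : smooth_section setT (fun y => f i y *: e i y).
  exact: (smooth_sectionM EL openT (fP i).1 (es i)).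
have ss : smooth_section setT s by case: sS.
have -> : s = (fun y => (\sum_i f i y *: e i y) + g y *: s y).
  exact: functional_extensionality_dep.
have sums : smooth_section setT (fun y => \sum_i f i y *: e i y).
  exact: (smooth_section_sum EL _ openT (fun i _ => fes i)).
rewrite (nablaDr D x Xs sums (smooth_sectionM EL openT gs ss)).
rewrite (nabla_Leibniz D x gs Xs ss) gx sx0 scaler0 scale0r !addr0.
rewrite (nabla_sumr _ _ (fun i _ => fes i) Xs); apply: memv_suml => i _.
rewrite (nabla_Leibniz D x (fP i).1 Xs (es i)) (fP i).2 scale0r addr0.
by apply: memvZ; case: (eS i).
Qed.

Lemma nabla_vanishing_field X s x : smooth_vf X -> X x = 0 ->
  smooth_section setT s -> D X s x = 0.
Proof.
move=> Xs Xx0 ss; have [r [_ rG]] := smooth_GammaH.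
have [d [f [e [g [fP eS [gs gx] XE]]]]] :=
  Gamma_vanishing TL (fH_subbundle H r) (rG _ Xs) Xx0.
have es i : smooth_vf (e i) by case: (eS i).
have fes i : smooth_vf (fun y => f i y *: e i y).
  exact: (smooth_sectionM TL openT (fP i).1 (es i)).
have -> : X = (fun y => (\sum_i f i y *: e i y) + g y *: X y).
  exact: functional_extensionality_dep.
have sums : smooth_vf (fun y => \sum_i f i y *: e i y).
  exact: (smooth_section_sum TL _ openT (fun i _ => fes i)).
rewrite (nablaDl D x sums (smooth_sectionM TL openT gs Xs) ss).
rewrite (nablaZl D x gs Xs ss) gx scale0r addr0.
rewrite (nabla_suml _ _ (fun i _ => fes i) ss) big1// => i _.
by rewrite (nablaZl D x (fP i).1 (es i) ss) (fP i).2 scale0r.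
Qed.

End Filtrations.

(** * The bracket and the connection on graded spaces *)

Section LinearMaps.
Variables (R : realType) (V W : lmodType R) (f : V -> W).
Hypothesis fl : linear f.

Lemma linear_map0 : f 0 = 0.
Proof.
have := fl 1 0 0; rewrite !scale1r addr0.
by rewrite -{1}[f 0]addr0 => /addrI <-.
Qed.

Lemma linear_mapZ a u : f (a *: u) = a *: f u.
Proof. by have := fl a u 0; rewrite linear_map0 !addr0. Qed.

Lemma linear_map_sum (I : Type) (r : seq I) (P : pred I) (c : I -> R) (v : I -> V) :
  f (\sum_(i <- r | P i) c i *: v i) = \sum_(i <- r | P i) c i *: f (v i).
Proof.
elim: r => [|i r IH]; first by rewrite !big_nil linear_map0.
by rewrite !big_cons; case: (P i); rewrite // fl IH.
Qed.

End LinearMaps.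

Section GradedBases.
Variables (R : realType) (V : vectType R).

Lemma adapted_expansion (G : nat -> {vspace V}) (A : finType) (dg : A -> nat)
    (e : A -> V) (tau : A -> 'Hom(V, R^o)) :
  (forall i, (G i <= G i.+1)%VS) ->
  (forall a, e a \in G (dg a).+1) -> (forall a v, v \in G (dg a) -> tau a v = 0) ->
  (forall v, v - \sum_a (tau a v : R) *: e a \in G 0%N) ->
  forall i u, u \in G i.+1 -> u - \sum_(a | dg a == i) (tau a u : R) *: e a \in G i.
Proof.
move=> Gincr eG tau0 exp i u uG; have Gle := subv_chain Gincr.
have -> : u - \sum_(a | dg a == i) (tau a u : R) *: e a =
    (u - \sum_a (tau a u : R) *: e a) + \sum_(a | dg a != i) (tau a u : R) *: e a.
  by rewrite [in RHS](bigID (fun a => dg a == i)) /= opprD addrA subrK.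
apply: memvD; first exact: (subvP (Gle 0%N i _)).
apply: memv_suml => a; case: (ltngtP (dg a) i) => // [ai|ia] _.
  by apply: memvZ; exact: (subvP (Gle _ _ ai)).
by rewrite tau0 ?scale0r ?mem0v//; exact: (subvP (Gle _ _ ia)).
Qed.

(** The functional [theta a] is [tau a] read on the component of degree [dg a], so it
    forgets the other degrees, while [tau a] only forgets [W (dg a)]. *)
Lemma gsum_dual (I : eqType) (U W : I -> {vspace V}) (A : finType) (dg : A -> I)
    (e : A -> V) (tau : A -> 'Hom(V, R^o)) :
  (forall i, (W i <= U i)%VS) -> (forall a v, v \in W (dg a) -> tau a v = 0) ->
  (forall i u, u \in U i -> u - \sum_(a | dg a == i) (tau a u : R) *: e a \in W i) ->
  exists theta : A -> gsum (fun i => quotv (U i) (W i) : lmodType R) -> R,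
    [/\ forall a c w w', theta a (c *: w + w') = c * theta a w + theta a w',
        forall a i v, v \in U i ->
          theta a (gcls U W i v) = if dg a == i then tau a v else 0 &
        forall w, w = \sum_a theta a w *: gcls U W (dg a) (e a)].
Proof.
move=> WU tau0 exp; exists (fun a w => tau a (vsval (w (dg a)))); split.
- move=> a c w w'.
  by rewrite [(c *: w + w') _]/(c *: w (dg a) + w' (dg a)) !linearP.
- move=> a i v vU; case: eqVneq => [ai|ai].
    subst i; have := tau0 a _ (vsval_gcls WU vU).
    by move/eqP; rewrite linearB subr_eq0 => /eqP.
  by rewrite gclsE eq_sym (negbTE ai) !linear0.
- exact: (gsum_expansion (tau := fun a v => tau a v : R)).
Qed.

End GradedBases.

Section Specs.
Variables (R : realType) (n : nat) (M : manifold R n).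
Variables (H : foliated_filtration M) (E : vector_bundle M).
Variables (F : bundle_filtration E) (D : connection E).
Hypothesis D_filtered : preserves_filtration H F D.
Variable x : M.

Let TL := @TM_linear R n M.
Let EL := vector_bundle_linear E.

Lemma tcls_linear i a u v : tcls H x i (a *: u + v) = a *: tcls H x i u + tcls H x i v.
Proof. exact: (@gcls_linear R _ _ (fun i => H i.+1 x) (fun i => H i x)). Qed.

Lemma eq_tcls i u v : u - v \in H i x -> tcls H x i u = tcls H x i v.
Proof. exact: (@eq_gcls R _ _ (fun i => H i.+1 x) (fun i => H i x)). Qed.

Lemma grEcls_linear p a u v :
  grEcls F x p (a *: u + v) = a *: grEcls F x p u + grEcls F x p v.
Proof. exact: (@gcls_linear R _ _ (fun p => F p x) (fun p => F (p + 1) x)). Qed.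

Lemma eq_grEcls p u v : u - v \in F (p + 1) x -> grEcls F x p u = grEcls F x p v.
Proof. exact: (@eq_gcls R _ _ (fun p => F p x) (fun p => F (p + 1) x)). Qed.

Lemma grEcls_eq0 p u : u \in F (p + 1) x -> grEcls F x p u = 0.
Proof. exact: (@gcls_eq0 R _ _ (fun p => F p x) (fun p => F (p + 1) x)). Qed.

Lemma tspace_basis : exists (A : finType) (dg : A -> nat) (e : A -> TM M x)
    (tau : A -> 'Hom(TM M x, R^o)) (theta : A -> tspace H x -> R),
  [/\ [/\ forall a, e a \in H (dg a).+1 x,
      forall a v, v \in H (dg a) x -> tau a v = 0 &
      forall v, v - \sum_a (tau a v : R) *: e a \in H 0%N x],
      forall i u, u \in H i.+1 x ->
        u - \sum_(a | dg a == i) (tau a u : R) *: e a \in H i x,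
      forall a c w w', theta a (c *: w + w') = c * theta a w + theta a w',
      forall a i v, v \in H i.+1 x ->
        theta a (tcls H x i v) = if dg a == i then tau a v else 0 &
      forall w, w = \sum_a theta a w *: tcls H x (dg a) (e a)].
Proof.
have [r rf] := fH_full H; have Hincr i : (H i x <= H i.+1 x)%VS by exact: fH_incr.
have [A [dg [e [tau [eH tau0 _ exp]]]]] :=
  @adapted_family _ _ (fun i => H i x) r Hincr.
have exp' v : v - \sum_a (tau a v : R) *: e a \in H 0%N x.
  by apply: exp; rewrite rf// memvf.
have exp'' := adapted_expansion Hincr eH tau0 exp'.
have [theta [th1 th2 th3]] := @gsum_dual _ _ _ (fun i => H i.+1 x) (fun i => H i x)
  A dg e tau Hincr tau0 exp''.
by exists A, dg, e, tau, theta; split.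
Qed.

(** The decreasing filtration of [E] is read backwards from a degree where it is
    zero, which makes it an increasing filtration indexed by natural numbers. *)
Lemma grE_basis : exists (B : finType) (q : B -> int) (e : B -> E x)
    (sigma : B -> 'Hom(E x, R^o)) (eta : B -> grE F x -> R),
  [/\ forall b, e b \in F (q b) x,
      forall p u, u \in F p x ->
        u - \sum_(b | q b == p) (sigma b u : R) *: e b \in F (p + 1) x,
      forall b c w w', eta b (c *: w + w') = c * eta b w + eta b w',
      forall b p v, v \in F p x ->
        eta b (grEcls F x p v) = if q b == p then sigma b v else 0 &
      forall w, w = \sum_b eta b w *: grEcls F x (q b) (e b)].
Proof.
have [a0 a0f] := fE_full F; have [b0 b0z] := fE_zero F.
pose G (i : nat) : {vspace E x} := F (b0 - i%:Z) x.
have Gincr i : (G i <= G i.+1)%VS by apply: fE_le; lia.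
have [r rf] : exists r, G r = fullv.
  by exists (absz (b0 - a0)%R); rewrite /G a0f//; lia.
have [B [dg [e [sigma [eG sigma0 _ exp]]]]] := adapted_family r Gincr.
have exp' v : v - \sum_a (sigma a v : R) *: e a \in G 0%N.
  by apply: exp; rewrite rf memvf.
have exp'' := adapted_expansion Gincr eG sigma0 exp'.
(* [e b] lies in [G (dg b).+1]. *)
pose q b := b0 - (dg b).+1%:Z.
have expq p u : u \in F p x ->
    u - \sum_(b | q b == p) (sigma b u : R) *: e b \in F (p + 1) x.
  have [bp|pb] := lerP b0 p.
    rewrite b0z// memv0 => /eqP ->; rewrite big1 ?subrr ?mem0v// => i _.
    by rewrite linear0 scale0r.
  have [i pE] : exists i : nat, p = b0 - i.+1%:Z by exists (absz (b0 - p - 1)%R); lia.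
  have -> : F p x = G i.+1 by rewrite pE.
  have -> : F (p + 1) x = G i by rewrite pE /G; congr (F _ x); lia.
  move=> uG; rewrite (eq_bigl (fun b => dg b == i)) => [|b]; first exact: exp''.
  by rewrite /q pE; apply/eqP/eqP; lia.
have s0 b v : v \in F (q b + 1) x -> sigma b v = 0.
  move=> vF; apply: sigma0; move: vF; rewrite /G /q.
  by have -> : b0 - (dg b).+1%:Z + 1 = b0 - (dg b)%:Z by lia.
have [eta [et1 et2 et3]] := @gsum_dual _ _ _ (fun p => F p x) (fun p => F (p + 1) x)
  B q e sigma (fun p => fE_decr F p x) s0 expq.
by exists B, q, e, sigma, eta; split.
Qed.

(** The difference of the two fields is, at [x], the value of a section [Z] of the
    smaller subbundle, and the bracket of [Z] and [Y] lies in [H (i + j).+1]. What is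
    left after subtracting [Z] vanishes at [x], so that its bracket with [Y] at [x]
    lies in [H i.+1]. Both have class zero. *)
Lemma tcls_lie_congr i j X X' Y : Gamma (H i.+1) X -> Gamma (H i.+1) X' ->
  X x - X' x \in H i x -> Gamma (H j.+1) Y ->
  tcls H x (i + j).+1 (lie X Y x) = tcls H x (i + j).+1 (lie X' Y x).
Proof.
move=> XH X'H XX' YH; apply: eq_tcls.
have [Z [ZH Zx]] := Gamma_extension TL (fH_subbundle H i) XX'.
have ZH' : Gamma (H i.+1) Z by apply: GammaS ZH => y; exact: fH_incr.
have dH : Gamma (H i.+1) (fun y => X y - X' y) by exact: (GammaB TL).
have := lie_vanishing (fH_subbundle H i.+1) (GammaB TL dH ZH').
have lZ : lie Z Y x \in H (i + j).+1 x.
  by have [_] := fH_bracket ZH YH; rewrite addnS; apply.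
move=> /(_ Y x); rewrite Zx subrr => /(_ erefl YH.1) l0.
have -> : lie X Y x - lie X' Y x =
    lie (fun y => X y - X' y - Z y) Y x + lie Z Y x.
  have B U U' : smooth_vf U -> smooth_vf U' ->
      lie (fun y => U y - U' y) Y x = lie U Y x - lie U' Y x.
    move=> Us U's; apply: (etrans (eq_liel (X' := fun y => -1 *: U' y + U y) _ _ _)).
      by move=> y; rewrite scaleN1r addrC.
    apply: (etrans (lie_linl (-1) x U's Us YH.1)).
    by rewrite scaleN1r addrC.
  apply/eqP; rewrite -subr_eq; apply/eqP/esym.
  apply: (etrans (B _ _ dH.1 ZH.1)).
  exact: (congr1 (fun u => u - _) (B _ _ XH.1 X'H.1)).
have ij : (i.+1 <= (i + j).+1)%N by rewrite ltnS leq_addr.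
exact: (memvD (subvP (fH_le H x ij) _ l0) lZ).
Qed.

(** As for the bracket, for the field and for the section; a field vanishing at [x]
    does not contribute at all. *)
Lemma nabla_congr i q X X' s s' : Gamma (H i.+1) X -> Gamma (H i.+1) X' ->
  X x - X' x \in H i x -> Gamma (F q) s -> Gamma (F q) s' ->
  s x - s' x \in F (q + 1) x ->
  grEcls F x (q - i.+1%:Z) (D X s x) = grEcls F x (q - i.+1%:Z) (D X' s' x).
Proof.
move=> XH X'H XX' sF s'F ss'; apply: eq_grEcls.
have -> : q - i.+1%:Z + 1 = q - i%:Z by lia.
have [Z [ZH Zx]] := Gamma_extension TL (fH_subbundle H i) XX'.
have [t [tF tx]] := Gamma_extension EL (fE_subbundle F (q + 1)) ss'.
have dX : Gamma (H i.+1) (fun y => X y - X' y) by exact: (GammaB TL).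
have ds : Gamma (F q) (fun y => s y - s' y) by exact: (GammaB EL).
have ZH' : Gamma (H i.+1) Z by apply: GammaS ZH => y; exact: fH_incr.
have tF' : Gamma (F q) t by apply: GammaS tF => y; exact: fE_decr.
have BX U U' r : smooth_vf U -> smooth_vf U' -> smooth_section setT r ->
    D (fun y => U y - U' y) r x = D U r x - D U' r x.
  move=> Us U's rs; have := nabla_linl D (-1) x U's Us rs.
  rewrite scaleN1r addrC => <-; congr (D _ r x).
  by apply: functional_extensionality_dep => y; rewrite scaleN1r addrC.
have BS U r r' : smooth_vf U -> smooth_section setT r -> smooth_section setT r' ->
    D U (fun y => r y - r' y) x = D U r x - D U r' x.
  move=> Us rs r's; have := nabla_linr D (-1) x Us r's rs.
  rewrite scaleN1r addrC => <-; congr (D U _ x).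
  by apply: functional_extensionality_dep => y; rewrite scaleN1r addrC.
have -> : D X s x - D X' s' x =
    D Z s x + (D X' (fun y => s y - s' y - t y) x + D X' t x).
  rewrite (BS X' _ _ X'H.1 ds.1 tF.1) (BS X' _ _ X'H.1 sF.1 s'F.1).
  rewrite subrK addrA; congr (_ - _).
  have := nabla_vanishing_field H D (X := fun y => X y - X' y - Z y) (s := s) (x := x).
  rewrite Zx subrr => /(_ (GammaB TL dX ZH').1 erefl sF.1).
  rewrite (BX _ _ _ dX.1 ZH.1 sF.1) (BX _ _ _ XH.1 X'H.1 sF.1) => /eqP.
  by rewrite subr_eq0 => /eqP <-; rewrite subrK.
apply: memvD; first by have [_] := D_filtered ZH sF; apply.
apply: memvD.
  apply: (subvP (fE_le F x _)) (nabla_vanishing_section D (fE_subbundle F q)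
    (GammaB EL ds tF') _ X'H.1); last by rewrite tx subrr.
  by lia.
have [_] := D_filtered X'H tF => /(_ x).
by have -> : q + 1 - i.+1%:Z = q - i%:Z by lia.
Qed.

(** The bracket is defined on a basis by fixed extensions of its members, and extended
    bilinearly; independence of the extensions gives its value on all other ones. *)
Lemma tbracket_spec : bilinear_map (tbracket H x) /\
  forall i j X Y, Gamma (H i.+1) X -> Gamma (H j.+1) Y ->
    tbracket H x (tcls H x i (X x)) (tcls H x j (Y x)) =
      tcls H x (i + j).+1 (lie X Y x).
Proof.
apply: (@xgetPex {classic tspace H x -> tspace H x -> tspace H x} _
  [set br : tspace H x -> tspace H x -> tspace H x | bilinear_map br /\
    forall i j X Y, Gamma (H i.+1) X -> Gamma (H j.+1) Y ->
      br (tcls H x i (X x)) (tcls H x j (Y x)) = tcls H x (i + j).+1 (lie X Y x)]).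
have [A [dg [e [tau [theta [[eH tau0 _] exp thl tht _]]]]]] := tspace_basis.
have ext a : {X | Gamma (H (dg a).+1) X /\ X x = e a}.
  by apply: cid; exact: (Gamma_extension TL (fH_subbundle H _) (eH a)).
pose X_ a := projT1 (ext a).
have XG a : Gamma (H (dg a).+1) (X_ a) by rewrite /X_; case: (ext a) => ? [].
have Xx a : X_ a x = e a by rewrite /X_; case: (ext a) => ? [].
clearbody X_; clear ext.
exists (fun xi zeta => \sum_a \sum_b (theta a xi * theta b zeta) *:
  tcls H x (dg a + dg b).+1 (lie (X_ a) (X_ b) x)); split.
  split=> [zeta a u v|xi a u v]; rewrite scaler_sumr -big_split;
    apply: eq_bigr => b _; rewrite scaler_sumr -big_split; apply: eq_bigr => c _ /=.
  - by rewrite thl mulrDl scalerDl !scalerA mulrA.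
  - by rewrite thl mulrDr scalerDl !scalerA mulrCA.
move=> i j X Y XH YH.
pose X' y := \sum_(a | dg a == i) (tau a (X x) : R) *: X_ a y.
pose Y' y := \sum_(b | dg b == j) (tau b (Y x) : R) *: X_ b y.
have X'H : Gamma (H i.+1) X'.
  by apply: (Gamma_sum TL) => a /eqP <-; apply: (GammaZ TL).
have Y'H : Gamma (H j.+1) Y'.
  by apply: (Gamma_sum TL) => a /eqP <-; apply: (GammaZ TL).
have X'x : X x - X' x \in H i x.
  by rewrite /X'; under eq_bigr => a _ do rewrite Xx; apply: exp; case: XH.
have Y'x : Y x - Y' x \in H j x.
  by rewrite /Y'; under eq_bigr => a _ do rewrite Xx; apply: exp; case: YH.
rewrite (tcls_lie_congr XH X'H X'x YH).
have step1 : tcls H x (i + j).+1 (lie X' Y x) =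
    \sum_(a | dg a == i) (tau a (X x) : R) *: tcls H x (i + j).+1 (lie (X_ a) Y x).
  rewrite -(linear_map_sum (tcls_linear _)); congr tcls.
  have cs a : dg a == i -> smooth_vf (fun y => (tau a (X x) : R) *: X_ a y).
    by move=> _; exact: (smooth_sectionM TL openT (smooth_fun_cst _ openT) (XG a).1).
  apply: (etrans (lie_suml (index_enum A) x cs YH.1)).
  by apply: eq_bigr => a _; exact: (lieZl _ _ (XG a).1 YH.1).
have step2 a : dg a = i -> tcls H x (i + j).+1 (lie (X_ a) Y x) =
    \sum_(b | dg b == j) (tau b (Y x) : R) *: tcls H x (i + j).+1 (lie (X_ a) (X_ b) x).
  move=> ai; have XaG : Gamma (H i.+1) (X_ a) by rewrite -ai.
  have flip U : tcls H x (i + j).+1 (lie (X_ a) U x) =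
      -1 *: tcls H x (j + i).+1 (lie U (X_ a) x).
    by rewrite -(linear_mapZ (tcls_linear _)) addnC; congr tcls; rewrite scaleN1r; exact: lieC.
  apply: (etrans (flip _)).
  apply: (etrans (congr1 (fun u => -1 *: u) (tcls_lie_congr YH Y'H Y'x XaG))).
  transitivity (-1 *: (\sum_(b | dg b == j) (tau b (Y x) : R) *:
      tcls H x (j + i).+1 (lie (X_ b) (X_ a) x))); last first.
    rewrite scaler_sumr; apply: eq_bigr => b _; rewrite scalerA mulrC -scalerA.
    exact: (congr1 _ (esym (flip _))).
  congr (_ *: _); rewrite -(linear_map_sum (tcls_linear _)); congr tcls.
  have cs b : dg b == j -> smooth_vf (fun y => (tau b (Y x) : R) *: X_ b y).
    by move=> _; exact: (smooth_sectionM TL openT (smooth_fun_cst _ openT) (XG b).1).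
  apply: (etrans (lie_suml (index_enum A) x cs XaG.1)).
  by apply: eq_bigr => b _; exact: (lieZl _ _ (XG b).1 XaG.1).
rewrite step1 [RHS]big_mkcond; apply: eq_bigr => a _.
rewrite (tht a i); last by case: XH.
case: eqP => [ai|_]; last by rewrite big1// => b _; rewrite mul0r scale0r.
apply: (etrans _ (esym (congr1 (fun u => (tau a (X x) : R) *: u) (step2 a ai)))).
rewrite scaler_sumr [RHS]big_mkcond; apply: eq_bigr => b _.
rewrite (tht b j); last by case: YH.
case: eqP => [bj|_]; last by rewrite mulr0 scale0r.
by rewrite scalerA ai bj.
Qed.

Lemma omegabar_spec : bilinear_map (omegabar H F D x) /\
  forall i q X s, Gamma (H i.+1) X -> Gamma (F q) s ->
    omegabar H F D x (tcls H x i (X x)) (grEcls F x q (s x)) =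
      grEcls F x (q - i.+1%:Z) (D X s x).
Proof.
apply: (@xgetPex {classic tspace H x -> grE F x -> grE F x} _
  [set w : tspace H x -> grE F x -> grE F x | bilinear_map w /\
    forall i q X s, Gamma (H i.+1) X -> Gamma (F q) s ->
      w (tcls H x i (X x)) (grEcls F x q (s x)) = grEcls F x (q - i.+1%:Z) (D X s x)]).
have [A [dg [e [tau [theta [[eH tau0 _] exp thl tht _]]]]]] := tspace_basis.
have [B [qb [eb [sigma [eta [ebF expE etl ett _]]]]]] := grE_basis.
have ext a : {X | Gamma (H (dg a).+1) X /\ X x = e a}.
  by apply: cid; exact: (Gamma_extension TL (fH_subbundle H _) (eH a)).
pose X_ a := projT1 (ext a).
have XG a : Gamma (H (dg a).+1) (X_ a) by rewrite /X_; case: (ext a) => ? [].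
have Xx a : X_ a x = e a by rewrite /X_; case: (ext a) => ? [].
clearbody X_; clear ext.
have ext b : {s | Gamma (F (qb b)) s /\ s x = eb b}.
  by apply: cid; exact: (Gamma_extension EL (fE_subbundle F _) (ebF b)).
pose S_ b := projT1 (ext b).
have SG b : Gamma (F (qb b)) (S_ b) by rewrite /S_; case: (ext b) => ? [].
have Sx b : S_ b x = eb b by rewrite /S_; case: (ext b) => ? [].
clearbody S_; clear ext.
exists (fun xi phi => \sum_a \sum_b (theta a xi * eta b phi) *:
  grEcls F x (qb b - (dg a).+1%:Z) (D (X_ a) (S_ b) x)); split.
  split=> [zeta a u v|xi a u v]; rewrite scaler_sumr -big_split;
    apply: eq_bigr => b _; rewrite scaler_sumr -big_split; apply: eq_bigr => c _ /=.
  - by rewrite thl mulrDl scalerDl !scalerA mulrA.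
  - by rewrite etl mulrDr scalerDl !scalerA mulrCA.
move=> i q X s XH sF.
pose X' y := \sum_(a | dg a == i) (tau a (X x) : R) *: X_ a y.
pose s' y := \sum_(b | qb b == q) (sigma b (s x) : R) *: S_ b y.
have X'H : Gamma (H i.+1) X'.
  by apply: (Gamma_sum TL) => a /eqP <-; apply: (GammaZ TL).
have s'F : Gamma (F q) s'.
  by apply: (Gamma_sum EL) => a /eqP <-; apply: (GammaZ EL).
have X'x : X x - X' x \in H i x.
  by rewrite /X'; under eq_bigr => a _ do rewrite Xx; apply: exp; case: XH.
have s'x : s x - s' x \in F (q + 1) x.
  by rewrite /s'; under eq_bigr => a _ do rewrite Sx; apply: expE; case: sF.
rewrite (nabla_congr XH X'H X'x sF s'F s'x).
have step1 : D X' s' x = \sum_(a | dg a == i) (tau a (X x) : R) *: D (X_ a) s' x.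
  have cs a : dg a == i -> smooth_vf (fun y => (tau a (X x) : R) *: X_ a y).
    by move=> _; exact: (smooth_sectionM TL openT (smooth_fun_cst _ openT) (XG a).1).
  apply: (etrans (nabla_suml D (index_enum A) x cs s'F.1)); apply: eq_bigr => a _.
  exact: (nablaZl D x (smooth_fun_cst _ (@openT M)) (XG a).1 s'F.1).
have step2 a : D (X_ a) s' x = \sum_(b | qb b == q) (sigma b (s x) : R) *: D (X_ a) (S_ b) x.
  have cs b : qb b == q -> smooth_section setT (fun y => (sigma b (s x) : R) *: S_ b y).
    by move=> _; exact: (smooth_sectionM EL openT (smooth_fun_cst _ openT) (SG b).1).
  apply: (etrans (nabla_sumr D (index_enum B) x cs (XG a).1)); apply: eq_bigr => b _.
  apply: (etrans (nabla_Leibniz D x (smooth_fun_cst _ (@openT M)) (XG a).1 (SG b).1)).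
  by rewrite /derive_fun derive_cst scale0r add0r.
rewrite step1 (linear_map_sum (grEcls_linear _)) [RHS]big_mkcond; apply: eq_bigr => a _.
rewrite (tht a i); last by case: XH.
case: eqP => [ai|_]; last by rewrite big1// => b _; rewrite mul0r scale0r.
rewrite step2 (linear_map_sum (grEcls_linear _)) scaler_sumr [RHS]big_mkcond.
apply: eq_bigr => b _; rewrite (ett b q); last by case: sF.
case: eqP => [bj|_]; last by rewrite mulr0 scale0r.
by rewrite scalerA ai bj.
Qed.

End Specs.

(** * The exterior covariant derivative *)

Lemma alternating_slot0 (R : realType) (k : nat) (V W : lmodType R)
    (m : ('I_k -> V) -> W) (w : 'I_k -> V) i : alternating_map m -> w i = 0 -> m w = 0.
Proof.
move=> ma wi; rewrite -(upd_id w i) wi.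
exact: (slot_linear0 I _ (alternating_slot_linear ma)).
Qed.

Lemma sum2_scaleB (R : realType) (W : lmodType R) (I : finType) (Q : I -> pred I)
    (a b : I -> I -> W) (c : R) :
  \sum_i \sum_(j | Q i j) (c *: a i j - b i j) =
    c *: (\sum_i \sum_(j | Q i j) a i j) - \sum_i \sum_(j | Q i j) b i j.
Proof.
rewrite scaler_sumr -sumrB; apply: eq_bigr => i _.
by rewrite scaler_sumr -sumrB.
Qed.

Section Koszul.
Variables (R : realType) (n : nat) (M : manifold R n).
Variables (H : foliated_filtration M) (E : vector_bundle M).
Variables (D : connection E) (k : nat) (alpha : Defs.form E k).
Arguments alpha : clear implicits.
Hypothesis alphaS : smooth_form alpha.
Implicit Types (x : M).

Let TL := @TM_linear R n M.
Let EL := vector_bundle_linear E.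

Let L : lmodType R := gsum (fun y : M => TM M y : lmodType R).
Let P (X : L) : Prop := smooth_vf X.
Let A x (z : L) (w : 'I_k -> L) : (E x : lmodType R) :=
  D z (fun y => alpha y (fun l => w l y)) x.
Let m x (w : 'I_k -> L) : (E x : lmodType R) := alpha x (fun l => w l x).
Let br (u v : L) : L := lie u v.
Let G x (X : 'I_k.+1 -> L) : (E x : lmodType R) := CEsum (A x) (m x) br X.

Lemma KoszulE x X : Koszul D alpha X x = G x X.
Proof.
rewrite /Koszul /G /CEsum; congr (_ + _).
apply: eq_bigr => i _; apply: eq_bigr => j _; congr (_ *: alpha x _).
by apply/funext => l; rewrite /del2; case: ifP.
Qed.

Let P_lin a u v : P u -> P v -> P (a *: u + v).
Proof. exact: smooth_vf_lin. Qed.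

Let P0 : P 0. Proof. exact: (smooth_section0 TL openT). Qed.

Let P_br u v : P u -> P v -> P (br u v).
Proof. exact: (lie_smooth H). Qed.

Let alphaA x : alternating_map (alpha x). Proof. by case: alphaS. Qed.

Let section_smooth (w : 'I_k -> L) : (forall l, P (w l)) ->
  smooth_section setT (fun y => alpha y (fun l => w l y) : E y).
Proof. by case: alphaS => _; apply. Qed.

Let upd_at (w : 'I_k -> L) i (u : L) y :
  (fun l => upd w i u l y) = upd (fun l => w l y) i (u y).
Proof. by apply/funext => l; rewrite /upd; case: eqP. Qed.

Let m_lin x : slot_linear P (m x).
Proof.
move=> w i a u v _ _ _; rewrite /m !upd_at.
exact: (alternating_slot_linear (alphaA x)).
Qed.

Let A_lin1 x w a u v : (forall l, P (w l)) -> P u -> P v ->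
  A x (a *: u + v) w = a *: A x u w + A x v w.
Proof. by move=> Pw Pu Pv; exact: (nabla_linl D a x Pu Pv (section_smooth Pw)). Qed.

Let A_lin2 x z : P z -> slot_linear P (A x z).
Proof.
move=> Pz w i a u v Pw Pu Pv; rewrite /A.
rewrite -(nabla_linr D a x Pz (section_smooth (upd_all i Pw Pu))
  (section_smooth (upd_all i Pw Pv))).
congr (D z _ x); apply: functional_extensionality_dep => y.
exact: m_lin.
Qed.

Let br_lin1 a u v z : P u -> P v -> P z ->
  br (a *: u + v) z = a *: br u z + br v z.
Proof.
by move=> Pu Pv Pz; apply: functional_extensionality_dep => y; exact: (lie_linl a y Pu Pv Pz).
Qed.

Let br_lin2 a u v z : P u -> P v -> P z ->
  br z (a *: u + v) = a *: br z u + br z v.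
Proof.
by move=> Pu Pv Pz; apply: functional_extensionality_dep => y; exact: (lie_linr a y Pu Pv Pz).
Qed.

Let G_lin x : slot_linear P (G x).
Proof. exact: (CEsum_slot_linear P_lin P_br (@A_lin1 x) (@A_lin2 x) (@m_lin x) br_lin1 br_lin2). Qed.

Let m_van x w i j : (forall l, P (w l)) -> i != j -> w i = w j -> m x w = 0.
Proof. by move=> _ ij wij; rewrite /m; case: (alphaA x) => _ /(_ _ i j ij); apply; rewrite wij. Qed.

Let G_adj x : adjacent_vanishing P (G x).
Proof.
apply: CEsum_adjacent => //.
- move=> z w i j Pz Pw ij wij; rewrite /A -(nabla0 D x Pz); congr (D z _ x).
  by apply: functional_extensionality_dep => y; exact: (m_van y Pw ij wij).
- by move=> w i j Pw ij wij; exact: (m_van x Pw ij wij).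
- move=> w i u _ _ wi; apply: (alternating_slot0 (i := i) (alphaA x)).
  by rewrite wi; exact: lie_id.
Qed.

(** Multiplying the first field by a function [f] produces derivatives of [f]
    from the Leibniz rule of the connection and from the brackets with the first
    field; they cancel in pairs. *)
Let G_mul0 x (f : M -> R) (X : 'I_k.+1 -> L) : smooth_fun setT f ->
  (forall l, P (X l)) ->
  G x (upd X ord0 (fun y => f y *: X ord0 y)) = f x *: G x X.
Proof.
move=> fs PX; set fX0 : L := fun y => f y *: X ord0 y.
have PfX : P fX0 by exact: (smooth_sectionM TL openT fs (PX ord0)).
(* What the Leibniz rule of the connection adds to the term of index [j]. *)
pose c (j : 'I_k.+1) := (-1) ^+ j *: ((derive_fun (X j) f x : R) *: m x (fun l => X (lift j l))).
have T1 (j : 'I_k.+1) : (-1) ^+ j *: A x (upd X ord0 fX0 j) (fun l => upd X ord0 fX0 (lift j l)) =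
    f x *: ((-1) ^+ j *: A x (X j) (fun l => X (lift j l))) +
    (if j == ord0 then 0 else c j).
  rewrite scalerA mulrC -scalerA; case: eqVneq => [->|j0].
    rewrite updE upd_lift_same addr0; congr (_ *: _).
    exact: (nablaZl D x fs (PX ord0) (section_smooth (fun l => PX (lift ord0 l)))).
  rewrite updN//; have [d d0 _] := unlift_some j0.
  have Xd : X ord0 = (fun l => X (lift j l)) d by rewrite /= -d0.
  have -> : (fun l => upd X ord0 fX0 (lift j l)) = upd (fun l => X (lift j l)) d fX0.
    by rewrite d0 upd_lift.
  rewrite -scalerDr; congr (_ *: _).
  have sj := section_smooth (fun l => PX (lift j l)).
  rewrite addrC -(nabla_Leibniz D x fs (PX j) sj); congr (D (X j) _ x).
  apply: functional_extensionality_dep => y; rewrite upd_at.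
  rewrite (slot_linearZ (P := fun=> True) I _ _ (alternating_slot_linear (alphaA y)))//.
  by rewrite Xd upd_id.
have T2 (i j : 'I_k.+1) : (i < j)%N ->
    (-1) ^+ (i + j) *:
      m x (del2 i j (br (upd X ord0 fX0 i) (upd X ord0 fX0 j)) (upd X ord0 fX0)) =
    f x *: ((-1) ^+ (i + j) *: m x (del2 i j (br (X i) (X j)) X)) -
    (if i == ord0 then c j else 0).
  move=> ij; have j0 : j != ord0 by rewrite -val_eqE /=; lia.
  have k0 : (0 < k)%N by have := ltn_ord j; lia.
  rewrite (@updN _ _ X ord0 fX0 j j0) [RHS]addrC scalerA mulrC -scalerA.
  case: eqVneq => [i0|i0].
    subst i. have c0 : ((ord0 : 'I_k.+1) == ord0) || (ord0 == j) by rewrite eqxx.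
    rewrite updE.
    apply: (etrans (congr1 (fun d => (-1) ^+ (ord0 + j) *: m x d)
      (del2_upd_same X (br fX0 (X j)) fX0 ij c0))).
    rewrite /c.
    have -> : (ord0 + j)%N = j by [].
    rewrite [RHS]addrC -scalerBr.
    congr (_ *: _).
    pose o := Ordinal k0; set dd := fun l => X (lift j l).
    have jo : lift j o = ord0 by apply: val_inj; rewrite /= /bump; case: leqP ij.
    have del2d z : del2 ord0 j z X = upd dd o z.
      apply/funext => l; rewrite /upd -val_eqE /= /del2; case: eqP => // /eqP l0.
      congr X; apply: val_inj; rewrite /= inordK; last first.
        by have [|l0'] := bump2_lt ord0 j l => //; rewrite l0' in l0.
      rewrite /bump /=; move: l0; case: leqP => /=; case: leqP => /=; lia.
    have mE z : m x (del2 ord0 j z X) = alpha x (upd (fun l => dd l x) o (z x)).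
      exact: (etrans (congr1 (m x) (del2d z)) (congr1 (alpha x) (upd_at dd o z x))).
    have aS := alternating_slot_linear (alphaA x).
    have ddo : alpha x (upd (fun l => dd l x) o (X ord0 x)) = m x dd.
      have -> : X ord0 x = (fun l => dd l x) o by rewrite /dd jo.
      by rewrite upd_id.
    apply: (etrans (mE _)); apply: (etrans _ (esym (congr1 (fun u => f x *: u - _) (mE _)))).
    rewrite -ddo.
    apply: (etrans (congr1 (fun u => alpha x (upd _ o u)) (lie_mull x fs (PX ord0) (PX j)))).
    rewrite -scaleNr addrC.
    apply: (etrans (aS _ _ _ _ _ (fun=> I) I I)); rewrite addrC scaleNr; congr (_ - _).
    exact: (slot_linearZ (P := fun=> True) I _ _ aS (fun=> I) I).
  rewrite (@updN _ _ X ord0 fX0 i i0) oppr0 add0r; congr (_ *: _).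
  have [||l [l0 lE]] := @del2_hit _ i j ord0 ij; [by rewrite eq_sym..|].
  rewrite (del2_upd _ _ _ l0 lE) /m upd_at.
  rewrite (slot_linearZ (P := fun=> True) I _ _ (alternating_slot_linear (alphaA x)))//.
  have -> : X ord0 x = (fun l' => del2 i j (br (X i) (X j)) X l' x) l.
    by rewrite (del2E _ _ l0 lE).
  by rewrite upd_id.
apply: (etrans (congr2 +%R (eq_bigr _ (fun j _ => T1 j))
  (eq_bigr _ (fun (i : 'I_k.+1) _ => eq_bigr _ (fun (j : 'I_k.+1) ij => T2 i j ij))))).
rewrite [RHS]scalerDr big_split /= -scaler_sumr -addrA; congr (_ + _).
apply: (etrans (congr1 (fun u => _ + u) (sum2_scaleB _ _ _ _))).
rewrite addrCA; apply/eqP; rewrite -subr_eq0 addrAC subrr add0r.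
rewrite subr_eq0; apply/eqP.
rewrite [RHS]big_ord_recl /= [X in _ = _ + X]big1 ?addr0; last by move=> i _; rewrite big1.
rewrite [RHS]big_mkcond; apply: eq_bigr => j _ /=.
by rewrite -val_eqE /= lt0n; case: eqP.
Qed.

Let G_sum0 x (I : Type) (r : seq I) (X : 'I_k.+1 -> L) (u : I -> L) :
  (forall l, P (X l)) -> (forall i, P (u i)) ->
  G x (upd X ord0 (fun y => \sum_(i <- r) u i y)) = \sum_(i <- r) G x (upd X ord0 (u i)).
Proof.
move=> PX Pu.
have -> : (fun y => \sum_(i <- r) u i y) = \sum_(i <- r) 1 *: u i :> L.
  apply: functional_extensionality_dep => y; rewrite gsum_sumE; apply: eq_bigr => i _.
  exact/esym/scale1r.
apply: (etrans (slot_linear_sum P_lin P0 r ord0 (fun=> 1) (@G_lin x) PX Pu)).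
by apply: eq_bigr => i _; rewrite scale1r.
Qed.

(** Linearity over functions in the first argument kills a combination whose
    coefficients vanish at [x]; the other arguments are brought to the first place. *)
Let G_vanish x (X : 'I_k.+1 -> L) i : (forall l, P (X l)) -> X i x = 0 -> G x X = 0.
Proof.
suff main (Y : 'I_k.+1 -> L) : (forall l, P (Y l)) -> Y ord0 x = 0 -> G x Y = 0.
  have [-> PX|i0 PX Xi] := eqVneq i ord0; first exact: main.
  rewrite eq_sym in i0; have van w : (forall l, P (w l)) -> w ord0 = w i -> G x w = 0.
    by move=> Pw; exact: (vanishing_of_adjacent P_lin (@G_lin x) (@G_adj x) Pw i0).
  have := swap_of_vanishing P_lin (@G_lin x) i0 van PX.
  rewrite main /=; first by move/esym/eqP; rewrite oppr_eq0 => /eqP.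
    by move=> l; exact: PX.
  by rewrite tpermL.
move=> PY Y0; have [r [_ rG]] := smooth_GammaH H.
have [d [f [e [g [fP eS [gs gx] YE]]]]] :=
  Gamma_vanishing TL (fH_subbundle H r) (rG _ (PY ord0)) Y0.
have Pe a : P (e a) by case: (eS a).
have Pfe a : P (fun y => f a y *: e a y) by exact: (smooth_sectionM TL openT (fP a).1 (Pe a)).
have PgY : P (fun y => g y *: Y ord0 y) by exact: (smooth_sectionM TL openT gs (PY ord0)).
have PS : P (fun y => \sum_a f a y *: e a y).
  exact: (smooth_section_sum TL _ openT (fun i _ => Pfe i)).
have {1}-> : Y = upd Y ord0 (((fun y => \sum_a f a y *: e a y) : L) +
    ((fun y => g y *: Y ord0 y) : L)).
  rewrite -{1}(upd_id Y ord0); congr upd.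
  exact: functional_extensionality_dep.
rewrite (slot_linearD _ (@G_lin x))// G_mul0// gx scale0r addr0 G_sum0// big1// => a _.
have -> : upd Y ord0 (fun y => f a y *: e a y) =
    upd (upd Y ord0 (e a)) ord0 (fun y => f a y *: upd Y ord0 (e a) ord0 y).
  by rewrite upd_upd updE.
apply: (etrans (G_mul0 x (fP a).1 (upd_all ord0 PY (Pe a)))).
by rewrite (fP a).2 scale0r.
Qed.

Let ext_exists : exists e : forall x, TM M x -> L, forall x v, P (e x v) /\ e x v x = v.
Proof.
have H0 x (v : TM M x) : {X : L | P X /\ X x = v}.
  by apply: cid; exact: (vf_extension H v).
by exists (fun x v => projT1 (H0 x v)) => x v; exact: (projT2 (H0 x v)).
Qed.

Let G_eq x (X X' : 'I_k.+1 -> L) : (forall l, P (X l)) -> (forall l, P (X' l)) ->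
  (forall l, X l x = X' l x) -> G x X = G x X'.
Proof.
move=> PX PX' XX'.
apply: (@eq_mod_of_vanishing _ _ _ P P_lin _ _ (fun u : L => u x = 0) (@G_lin x)) => //.
- by move=> w i Pw; exact: G_vanish.
- move=> l; exact: (etrans (congr1 (fun u : TM M x => u - X' l x) (XX' l)) (subrr _)).
Qed.

Lemma ext_cov_derivativeE x (X : 'I_k.+1 -> vector_field M) :
  (forall i, smooth_vf (X i)) ->
  @ext_cov_derivative R n M E D k alpha x (fun i => X i x) = Koszul D alpha X x.
Proof.
move=> Xs; have [e eP] := ext_exists.
suff : [set beta : Defs.form E k.+1 | forall X, (forall i, smooth_vf (X i)) ->
    forall x, beta x (fun i => X i x) = Koszul D alpha X x] (ext_cov_derivative D alpha).
  by move=> /(_ X Xs x).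
apply: (@xgetPex {classic Defs.form E k.+1}).
exists (fun y v => G y (fun i => e y (v i))) => Y Ys y.
apply: (etrans _ (esym (KoszulE y Y))); apply: (G_eq _ Ys) => l.
- by case: (eP y (Y l y)).
- by case: (eP y (Y l y)).
Qed.

Lemma ext_cov_derivative_alternating x : alternating_map (@ext_cov_derivative R n M E D k alpha x).
Proof.
have [e eP] := ext_exists.
have Pe v : P (e x v) by case: (eP x v).
have dE (X : 'I_k.+1 -> L) w : (forall l, P (X l)) -> (forall l, X l x = w l) ->
    @ext_cov_derivative R n M E D k alpha x w = G x X.
  move=> PX Xw; apply: (etrans _ (etrans (ext_cov_derivativeE x PX) (KoszulE x X))).
  by congr (@ext_cov_derivative R n M E D k alpha x _); apply/funext => l; rewrite Xw.
have ex v : e x v x = v by case: (eP x v).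
split=> [w i a u v|w i j ij wij].
  have Pw l : P (e x (w l)) by exact: Pe.
  have Puv := P_lin a (Pe u) (Pe v).
  have E0 : @ext_cov_derivative R n M E D k alpha x (upd w i (a *: u + v)) =
      G x (upd (fun l => e x (w l)) i (a *: e x u + e x v)).
    apply: dE => [|l]; first exact: (upd_all i Pw Puv).
    rewrite /upd; case: eqP => _; last exact: ex.
    exact: (congr2 (fun y z : TM M x => a *: y + z) (ex u) (ex v)).
  apply: (etrans E0); apply: (etrans (@G_lin x _ i a _ _ Pw (Pe u) (Pe v))).
  apply: (congr2 (fun y z => a *: y + z)); apply/esym/dE.
  - exact: (upd_all i Pw (Pe u)).
  - by move=> l; rewrite /upd /=; case: eqP => _; exact: ex.
  - exact: (upd_all i Pw (Pe v)).
  - by move=> l; rewrite /upd /=; case: eqP => _; exact: ex.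
apply: (etrans (dE (fun l => e x (w l)) w _ _)) => [l|l|]; [exact: Pe|exact: ex|].
apply: (vanishing_of_adjacent P_lin (@G_lin x) (@G_adj x) (fun l => Pe (w l)) ij).
by rewrite wij.
Qed.

End Koszul.

(** * Filtration degrees of forms at a point *)

Section Degrees.
Variable k : nat.

Lemma sum_lift (g : 'I_k.+1 -> nat) j :
  (\sum_i g i = g j + \sum_(l < k) g (lift j l))%N.
Proof. by rewrite (bigD1_ord j). Qed.

Lemma sum_del2 (T : Type) (h : T -> nat) (i j : 'I_k.+1) z (X : 'I_k.+1 -> T) :
  (i < j)%N ->
  (h (X i) + h (X j) + \sum_(l < k) h (del2 i j z X l) =
    h z + \sum_l h (X l))%N.
Proof.
case: k i j X => [|k'] i j X ij; first by have := ltn_ord j; lia.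
have i'lt : (i < k'.+1)%N by have := ltn_ord j; lia.
pose i' := Ordinal i'lt.
have ji' : lift j i' = i by apply: val_inj; rewrite /= /bump leqNgt ij.
have -> : \sum_(l < k'.+1) h (del2 i j z X l) =
    (h z + \sum_(l < k') h (X (lift j (lift i' l))))%N.
  rewrite big_ord_recl; congr (_ + _)%N; apply: eq_bigr => l _; congr (h _).
  exact: (@del2E _ _ i j (lift ord0 l) (lift j (lift i' l))).
have -> : \sum_l h (X l) =
    (h (X j) + (h (X i) + \sum_(l < k') h (X (lift j (lift i' l)))))%N.
  by rewrite (bigD1_ord j)//= (bigD1_ord i')//= ji'.
by lia.
Qed.

Lemma del2_map2 (S T U : Type) (f : S -> T -> U) (i j : 'I_k.+1) a b
    (X : 'I_k.+1 -> S) (Y : 'I_k.+1 -> T) :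
  (fun l => f (del2 i j a X l) (del2 i j b Y l)) =
    del2 i j (f a b) (fun l => f (X l) (Y l)).
Proof. by apply/funext => l; rewrite /del2; case: ifP. Qed.

End Degrees.

Section Pointwise.
Variables (R : realType) (n : nat) (M : manifold R n).
Variables (H : foliated_filtration M) (E : vector_bundle M).
Variables (F : bundle_filtration E) (x : M).

(** A covector that vanishes on [H p] is nonzero only at vectors outside [H p]. In a
    nonzero product, the degrees of the vectors therefore bound those of the covectors,
    and the vector in [E] carries the rest. *)
Lemma filtration_value k s (b : ('I_k -> TM M x) -> E x) (p : 'I_k -> nat) v :
  in_filtration H F s b -> (forall l, v l \in H (p l).+1 x) ->
  b v \in F (s - (\sum_l (p l).+1)%N%:Z) x.
Proof.
move=> [m [theta [r [e [q [th0 eF sq bE]]]]]] vH; rewrite bE.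
apply: memv_suml => a _; rewrite /determinant scaler_suml; apply: memv_suml => sg _.
have [/existsP[i pr]|] := boolP [exists i, (p (sg i) < r a i)%N].
  rewrite (bigD1 i)//= mxE th0 ?mul0r ?mulr0 ?scale0r ?mem0v//.
  exact: (subvP (fH_le H x pr)).
rewrite negb_exists => /forallP rp; apply: memvZ.
apply: (subvP (fE_le F x _)) (eF a).
have le : (\sum_l (r a l).+1 <= \sum_l (p l).+1)%N.
  rewrite [X in (_ <= X)%N](reindex_inj (@perm_inj _ sg)) /=.
  by apply: leq_sum => l _; rewrite ltnS leqNgt.
by move: (sq a) le; move: (\sum_l (r a l).+1)%N (\sum_l (p l).+1)%N => S1 S2; lia.
Qed.

(** The expansion of [b] over a basis adapted to the filtration; the basis vectors
    tangent to the foliation contribute nothing. *)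
Lemma in_filtrationI k s (b : ('I_k -> TM M x) -> E x) : alternating_map b ->
  (forall v i, v i \in H 0%N x -> b v = 0) ->
  (forall p v, (forall l, v l \in H (p l).+1 x) ->
    b v \in F (s - (\sum_l (p l).+1)%N%:Z) x) ->
  in_filtration H F s b.
Proof.
move=> ba b0 bF.
have [A [dg [e [tau [theta [[eH tau0 exp] _ _ _ _]]]]]] := tspace_basis H x.
have bl := alternating_slot_linear ba.
have bexp (w : 'I_k -> TM M x) i :
    b w = \sum_a (tau a (w i) : R) *: (b (upd w i (e a)) : E x).
  rewrite -(slot_linear_sum (fun _ _ _ _ _ => I) I _ _ _ bl)//.
  rewrite -{1}(upd_id w i) -{1}(subrK (\sum_a (tau a (w i) : R) *: e a) (w i)).
  rewrite (slot_linearD _ bl)// (b0 _ i) ?add0r//.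
  by rewrite updE; exact: exp.
have bE := alternating_expansion (tau := fun a v => tau a v : R) ba bexp.
(* Each coefficient is put in the degree that completes those of the covectors to [s]. *)
pose T := {ffun 'I_k -> A}.
exists #|{: T}|, (fun c i => tau ((enum_val c : T) i)),
  (fun c i => dg ((enum_val c : T) i)),
  (fun c => (k`!%:R)^-1 *: b (e \o (enum_val c : T))),
  (fun c => s - (\sum_l (dg ((enum_val c : T) l)).+1)%N%:Z); split.
- by move=> c i v vH; exact: tau0.
- move=> c; apply: memvZ.
  exact: (bF (fun l => dg ((enum_val c : T) l)) (e \o (enum_val c : T)) (fun l => eH _)).
- by move=> c; rewrite addrC subrK.
move=> v; rewrite bE scaler_sumr (big_enum_val _ (A := {: T})) /=.
by apply: eq_bigr => c _; rewrite !scalerA mulrC.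
Qed.

Lemma tspace_ext k (W : lmodType R) (m1 m2 : ('I_k -> tspace H x) -> W) :
  alternating_map m1 -> alternating_map m2 ->
  (forall p v, (forall l, v l \in H (p l).+1 x) ->
    m1 (fun l => tcls H x (p l) (v l)) = m2 (fun l => tcls H x (p l) (v l))) ->
  m1 = m2.
Proof.
move=> a1 a2 m12.
have [A [dg [e [tau [theta [[eH _ _] _ _ _ wE]]]]]] := tspace_basis H x.
have mexp m : alternating_map m -> forall (w : 'I_k -> tspace H x) i,
    m w = \sum_a theta a (w i) *: (m (upd w i (tcls H x (dg a) (e a))) : W).
  move=> ma w i; have ml := alternating_slot_linear ma.
  rewrite -(slot_linear_sum (fun _ _ _ _ _ => I) I _ _ _ ml)//.
  by rewrite -wE upd_id.
apply/funext => w.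
rewrite (slot_expansion (mexp _ a1)) (slot_expansion (mexp _ a2)).
apply: eq_bigr => c _; congr (_ *: _).
by apply: (m12 (fun l => dg (c l)) (fun l => e (c l))) => l.
Qed.

Lemma gr_class_unique k s (b : ('I_k -> TM M x) -> E x) m1 m2 :
  gr_class H F s b m1 -> gr_class H F s b m2 -> m1 = m2.
Proof.
move=> [_ a1 m1E] [_ a2 m2E]; apply: tspace_ext => // p v vH.
by rewrite m1E// m2E.
Qed.

End Pointwise.

(** * The Chevalley-Eilenberg formula for the graded operator *)

Section ChevalleyEilenberg.
Variables (R : realType) (L V : lmodType R) (br : L -> L -> L) (rho : L -> V -> V).
Hypothesis br_bil : bilinear_map br.
Hypothesis rho_bil : bilinear_map rho.
Hypothesis br_alt : forall u, br u u = 0.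
Variable k : nat.

Lemma CE_alternating (mu : ('I_k -> L) -> V) : alternating_map mu ->
  alternating_map (CE_formula br rho mu).
Proof.
move=> ma; have ml := alternating_slot_linear ma.
have -> : CE_formula br rho mu = CEsum (fun z w => rho z (mu w)) mu br by [].
apply: alternating_of_adjacent.
  apply: CEsum_slot_linear => //.
  - by move=> w a u v _ _ _; exact: (rho_bil.1 (mu w)).
  - by move=> z _ w i a u v Pw Pu Pv; rewrite ml//; exact: (rho_bil.2 z).
  - by move=> a u v z _ _ _; exact: (br_bil.1 z).
  - by move=> a u v z _ _ _; exact: (br_bil.2 z).
apply: CEsum_adjacent => //.
- move=> z w i j _ _ ij wij; case: ma => _ /(_ w i j ij wij) ->.
  exact: (linear_map0 (rho_bil.2 z)).
- by move=> w i j _ ij wij; case: ma => _ /(_ w i j ij wij).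
- by move=> w i u _ _ wi; apply: (alternating_slot0 (i := i)) => //; rewrite wi br_alt.
Qed.

Lemma CE_linear (a : R) (mu nu : ('I_k -> L) -> V) (xi : 'I_k.+1 -> L) :
  CE_formula br rho (fun w => a *: mu w + nu w) xi =
    a *: CE_formula br rho mu xi + CE_formula br rho nu xi.
Proof.
rewrite /CE_formula scalerDr [RHS]addrACA; congr (_ + _).
  rewrite scaler_sumr -big_split; apply: eq_bigr => j _ /=.
  by rewrite (rho_bil.2 (xi j)) scalerDr !scalerA mulrC.
rewrite scaler_sumr -big_split; apply: eq_bigr => i _ /=.
rewrite scaler_sumr -big_split; apply: eq_bigr => j _ /=.
by rewrite scalerDr !scalerA mulrC.
Qed.

End ChevalleyEilenberg.

Section Classes.
Variables (R : realType) (n : nat) (M : manifold R n).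
Variables (H : foliated_filtration M) (E : vector_bundle M).
Variables (F : bundle_filtration E) (D : connection E) (N : subfamily (TM M)).
Hypothesis D_filtered : preserves_filtration H F D.
Hypothesis N_complement : complement_of (H 0%N) N.
Variables (x : M) (k : nat).

Let TL := @TM_linear R n M.
Let EL := vector_bundle_linear E.

(** On classes of vector fields this is the antisymmetry of the Lie bracket. *)
Lemma tbracket_alt u : tbracket H x u u = 0.
Proof.
have [bil brE] := tbracket_spec H x.
have [A [dg [e [tau [theta [[eH _ _] _ _ _ wE]]]]]] := tspace_basis H x.
pose t a := tcls H x (dg a) (e a).
have anti a b : tbracket H x (t a) (t b) = - tbracket H x (t b) (t a).
  have [X [XH Xx]] := Gamma_extension TL (fH_subbundle H _) (eH a).
  have [Y [YH Yx]] := Gamma_extension TL (fH_subbundle H _) (eH b).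
  rewrite /t -Xx -Yx (brE _ _ _ _ XH YH) (brE _ _ _ _ YH XH) addnC.
  rewrite -scaleN1r -(linear_mapZ (@tcls_linear _ _ _ H x _)); congr tcls.
  by rewrite scaleN1r; exact: lieC.
rewrite [in X in tbracket H x X _](wE u).
rewrite (linear_map_sum (bil.1 u)).
rewrite (eq_bigr (fun a => \sum_b (theta a u * theta b u) *: tbracket H x (t a) (t b))).
  rewrite pair_big /=; apply: (@sum_antisym _ _ _ _ (fun p => (p.2, p.1))) => //.
    by move=> [].
  by move=> [a b] _ /=; rewrite anti scalerN mulrC.
move=> a _; rewrite [in X in tbracket H x _ X](wE u) (linear_map_sum (bil.2 _)) scaler_sumr.
by apply: eq_bigr => b _; rewrite scalerA.
Qed.

Lemma proj_sub v : v - daddv_pi (N x) (H 0%N x) v \in H 0%N x.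
Proof.
have [HN I0] := N_complement.2 x.
have NI : (N x :&: H 0%N x)%VS = 0%VS by rewrite capvC.
have vNH : v \in (N x + H 0%N x)%VS by rewrite addvC HN memvf.
by rewrite -{1}(daddv_pi_add NI vNH) addrC addKr memv_pi.
Qed.

Lemma proj_H0 v : v \in H 0%N x -> daddv_pi (N x) (H 0%N x) v = 0.
Proof.
have [HN I0] := N_complement.2 x.
have NI : (N x :&: H 0%N x)%VS = 0%VS by rewrite capvC.
move=> vH; have vNH : v \in (N x + H 0%N x)%VS by rewrite addvC HN memvf.
have := daddv_pi_add NI vNH; rewrite (daddv_pi_id I0 vH).
by move/(canRL (addrK _)); rewrite subrr.
Qed.

Variables (s : int) (alpha : Defs.form E k).
Arguments alpha : clear implicits.
Hypothesis alpha_k0 : form_k0 H alpha.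
Hypothesis alpha_s : forall y, in_filtration H F s (alpha y).

Let b (v : 'I_k.+1 -> TM M x) : E x := dN H D N alpha x v.

(** Projecting a vector to [N] changes it by an element of [H 0], which changes
    neither its degree nor its class. *)
Let bE (p : 'I_k.+1 -> nat) v : (forall i, v i \in H (p i).+1 x) ->
  exists X : 'I_k.+1 -> vector_field M,
    [/\ forall i, Gamma (H (p i).+1) (X i),
        forall i, tcls H x (p i) (X i x) = tcls H x (p i) (v i) &
        b v = Koszul D alpha X x].
Proof.
move=> vH; pose w i := daddv_pi (N x) (H 0%N x) (v i).
have wH i : w i \in H (p i).+1 x.
  rewrite -[w i](subKr (v i)); apply: memvB; first exact: vH.
  exact: (subvP (fH_le H x (leq0n _)) _ (proj_sub (v i))).
have ext i : {X | Gamma (H (p i).+1) X /\ X x = w i}.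
  by apply: cid; exact: (Gamma_extension TL (fH_subbundle H _) (wH i)).
pose X i := projT1 (ext i).
have XH i : Gamma (H (p i).+1) (X i) by rewrite /X; case: (ext i) => ? [].
have Xx i : X i x = w i by rewrite /X; case: (ext i) => ? [].
exists X; split=> // [i|].
  rewrite Xx; apply/esym/eq_tcls.
  exact: (subvP (fH_le H x (leq0n _)) _ (proj_sub (v i))).
apply: (etrans _ (ext_cov_derivativeE H D alpha_k0.1 x (fun i => (XH i).1))).
by congr (@ext_cov_derivative R n M E D k alpha x _); apply/funext => i; rewrite Xx.
Qed.

Let alpha_Gamma (p : 'I_k -> nat) (X : 'I_k -> vector_field M) :
  (forall i, Gamma (H (p i).+1) (X i)) ->
  Gamma (F (s - (\sum_l (p l).+1)%N%:Z)) (fun y => alpha y (fun l => X l y)).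
Proof.
move=> XH; split; first by apply: (alpha_k0.1.2) => i; case: (XH i).
by move=> y; apply: (filtration_value (alpha_s y)) => l; case: (XH l).
Qed.

Let shift1 (p : 'I_k.+1 -> nat) (j : 'I_k.+1) :
  s - (\sum_(l < k) (p (lift j l)).+1)%N%:Z - (p j).+1%:Z =
  s - (\sum_i (p i).+1)%N%:Z.
Proof. by rewrite (sum_lift (fun i => (p i).+1) j) PoszD opprD addrA addrAC. Qed.

Let shift2 (p : 'I_k.+1 -> nat) (i j : 'I_k.+1) : (i < j)%N ->
  (\sum_(l < k) (del2 i j (p i + p j).+1 p l).+1 = \sum_i (p i).+1)%N.
Proof.
move=> ij; have := sum_del2 succn (p i + p j).+1 p ij.
move: (\sum_(l < k) (del2 i j (p i + p j).+1 p l).+1)%N (\sum_i (p i).+1)%N => S1 S2.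
by lia.
Qed.

Let bracket_H p (X : 'I_k.+1 -> vector_field M) (i j : 'I_k.+1) (l : 'I_k) :
  (forall i, Gamma (H (p i).+1) (X i)) ->
  del2 i j (lie (X i) (X j) x) (fun l => X l x) l \in
    H (del2 i j (p i + p j).+1 p l).+1 x.
Proof.
move=> XH; rewrite /del2; case: ifP => _; last by case: (XH (inord (bump j (bump i l.-1)))).
by have [_] := fH_bracket (XH i) (XH j); rewrite addSn addnS; apply.
Qed.

Let b_alt : alternating_map b.
Proof.
have [al av] := ext_cov_derivative_alternating H D alpha_k0.1 x.
split=> [w i a u v|w i j ij wij]; last by apply: (av _ i j ij); rewrite wij.
have pu z : (fun l => daddv_pi (N x) (H 0%N x) (upd w i z l)) =
    upd (fun l => daddv_pi (N x) (H 0%N x) (w l)) i (daddv_pi (N x) (H 0%N x) z).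
  by apply/funext => l; rewrite /upd; case: eqP.
have bu z : b (upd w i z) = @ext_cov_derivative R n M E D k alpha x
    (upd (fun l => daddv_pi (N x) (H 0%N x) (w l)) i (daddv_pi (N x) (H 0%N x) z)).
  by rewrite /b /dN /component_k0 pu.
apply: (etrans (bu _)); rewrite linearP.
apply: (etrans (al _ _ _ _ _)).
exact: (congr2 (fun y z => a *: y + z) (esym (bu u)) (esym (bu v))).
Qed.

Lemma dN_in_filtration : in_filtration H F s b.
Proof.
apply: in_filtrationI => //.
  move=> v i vH; rewrite /b /dN /component_k0.
  apply: (alternating_slot0 (i := i) (ext_cov_derivative_alternating H D alpha_k0.1 x)).
  exact: proj_H0.
move=> p v vH; have [X [XH _ ->]] := bE vH.
apply: memvD.
  apply: memv_suml => j _; apply: memvZ; rewrite -(shift1 p j).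
  have [_] := D_filtered (XH j) (alpha_Gamma (fun l => XH (lift j l))).
  exact.
apply: memv_suml => i _; apply: memv_suml => j ij; apply: memvZ.
rewrite -(shift2 p ij); apply: (filtration_value (alpha_s x)) => l.
exact: bracket_H.
Qed.

(** Each term of the Koszul formula is sent to the corresponding term of the
    Chevalley-Eilenberg formula. *)
Lemma CE_gr_class mu : gr_class H F s (alpha x) mu ->
  gr_class H F s b (CE_formula (tbracket H x) (omegabar H F D x) mu).
Proof.
move=> [_ mua muE]; have [bil brE] := tbracket_spec H x.
have [obil oE] := omegabar_spec D_filtered x.
split; first exact: dN_in_filtration.
  by apply: CE_alternating => //; exact: tbracket_alt.
move=> p v vH; have [X [XH Xx ->]] := bE vH.
have -> : (fun i => tcls H x (p i) (v i)) = (fun i => tcls H x (p i) (X i x)).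
  by apply/funext => i; rewrite Xx.
have gl := @grEcls_linear R n M E F x (s - (\sum_i (p i).+1)%N%:Z).
have gD u w : grEcls F x (s - (\sum_i (p i).+1)%N%:Z) (u + w) =
    grEcls F x (s - (\sum_i (p i).+1)%N%:Z) u + grEcls F x (s - (\sum_i (p i).+1)%N%:Z) w.
  by have := gl 1 u w; rewrite !scale1r.
rewrite /Koszul gD; congr (_ + _).
  rewrite (linear_map_sum gl); apply: eq_bigr => j _; congr (_ *: _).
  rewrite -(shift1 p j) -(oE _ _ _ _ (XH j) (alpha_Gamma (fun l => XH (lift j l)))).
  congr (omegabar H F D x _ _); apply: muE => l.
  by case: (XH (lift j l)).
rewrite (big_morph _ gD (linear_map0 gl)); apply: eq_bigr => i _.
rewrite (linear_map_sum gl); apply: eq_bigr => j ij; congr (_ *: _).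
rewrite -(shift2 p ij).
have <- := muE (del2 i j (p i + p j).+1 p)
  (del2 i j (lie (X i) (X j) x) (fun l => X l x)) (fun l => bracket_H i j l XH).
rewrite (del2_map2 (fun d u => tcls H x d u)); congr (mu (del2 i j _ _)).
exact: (brE _ _ _ _ (XH i) (XH j)).
Qed.

End Classes.

(** * Forms with a given class, and uniqueness of the graded operator *)

Lemma det_alternating (R : realType) (V W : lmodType R) (k : nat)
    (f : 'I_k -> V -> R) (c : W) : (forall i a u v, f i (a *: u + v) = a * f i u + f i v) ->
  alternating_map (fun w : 'I_k -> V => \det (\matrix_(i, j) f i (w j)) *: c).
Proof.
move=> fl; split=> [w i a u v|w i j ij wij].
  rewrite scalerA -scalerDl; congr (_ *: _).
  rewrite -det_tr -[X in _ = a * X + _]det_tr -[X in _ = _ + X]det_tr -[X in _ = _ + X]mul1r.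
  apply: (determinant_multilinear (i0 := i)).
  - by apply/rowP => j; rewrite !mxE /= eqxx fl mul1r.
  - by apply/matrixP => j l; rewrite !mxE /= eq_sym (negbTE (neq_lift i j)).
  - by apply/matrixP => j l; rewrite !mxE /= eq_sym (negbTE (neq_lift i j)).
by rewrite -det_tr (determinant_alternate ij) ?scale0r// => l; rewrite !mxE wij.
Qed.

Lemma det_col0 (R : realType) (k : nat) (A : 'M[R]_k) j :
  (forall i, A i j = 0) -> \det A = 0.
Proof.
move=> Aj; rewrite /determinant big1// => s _.
by rewrite (bigD1 (s^-1 j)%g)//= permKV Aj mul0r mulr0.
Qed.

Lemma alternating_lin (R : realType) (V W : lmodType R) (k : nat)
    (m1 m2 : ('I_k -> V) -> W) (a : R) : alternating_map m1 -> alternating_map m2 ->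
  alternating_map (fun w => a *: m1 w + m2 w).
Proof.
move=> [l1 v1] [l2 v2]; split=> [w i b u v|w i j ij wij].
  by rewrite l1 l2 !scalerDr !scalerA (mulrC a) addrACA.
by rewrite (v1 _ _ _ ij wij) (v2 _ _ _ ij wij) scaler0 addr0.
Qed.

Lemma alternating0 (R : realType) (V W : lmodType R) (k : nat) :
  alternating_map (fun _ : 'I_k -> V => 0 : W).
Proof. by split=> [w i a u v|//]; rewrite scaler0 addr0. Qed.

Lemma alternating_sum (R : realType) (V W : lmodType R) (k : nat) (J : Type) (r : seq J)
    (c : J -> R) (m : J -> ('I_k -> V) -> W) : (forall j, alternating_map (m j)) ->
  alternating_map (fun w => \sum_(j <- r) c j *: m j w).
Proof.
move=> ma; elim: r => [|j r IH].
  by under eq_fun do rewrite big_nil; exact: alternating0.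
by under eq_fun do rewrite big_cons; exact: alternating_lin.
Qed.

Section Monomials.
Variables (R : realType) (n : nat) (M : manifold R n).
Variables (H : foliated_filtration M) (E : vector_bundle M).
Variables (F : bundle_filtration E) (x : M) (k : nat).
Variables (A : finType) (dg : A -> nat) (tau : A -> 'Hom(TM M x, R^o)).
Variable theta : A -> tspace H x -> R.
Hypothesis tau0 : forall a v, v \in H (dg a) x -> tau a v = 0.
Hypothesis theta_lin : forall a c w w', theta a (c *: w + w') = c * theta a w + theta a w'.
Hypothesis theta_tcls : forall a i v, v \in H i.+1 x ->
  theta a (tcls H x i v) = if dg a == i then tau a v else 0.
Variables (Th : A -> forall y, 'Hom(TM M y, R^o)).
Hypothesis Th0 : forall a y v, v \in H (dg a) y -> Th a y v = 0.
Hypothesis Thx : forall a, Th a x = tau a.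
Hypothesis Ths : forall a X, smooth_vf X -> smooth_fun setT (fun y => Th a y (X y) : R).
Variables (q : int) (S : section E) (c : 'I_k -> A).
Hypothesis SF : Gamma (F q) S.

Let EL := vector_bundle_linear E.

Definition monomial_form : Defs.form E k :=
  fun y v => \det (\matrix_(i, j) (Th (c i) y (v j) : R)) *: S y.

Definition monomial_cochain (w : 'I_k -> tspace H x) : grE F x :=
  \det (\matrix_(i, j) theta (c i) (w j)) *: grEcls F x q (S x).

Definition monomial_degree : int := (\sum_i (dg (c i)).+1)%N%:Z + q.

Lemma monomial_form_k0 : form_k0 H monomial_form.
Proof.
split; last first.
  move=> y v j vj; rewrite /monomial_form (@det_col0 _ _ _ j) ?scale0r// => i.
  by rewrite mxE Th0//; exact: (subvP (fH_le H y (leq0n _))).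
split=> [y|X Xs].
  by apply: (det_alternating (f := fun i v => Th (c i) y v : R)) => i a u v; rewrite linearP.
apply: (smooth_sectionM EL openT _ SF.1); apply: (smooth_fun_det openT) => i j.
by apply: (eq_smooth_fun openT _ (Ths (c i) (Xs j))) => y _; rewrite mxE.
Qed.

Lemma monomial_in_filtration y : in_filtration H F monomial_degree (@monomial_form y).
Proof.
exists 1%N, (fun _ i => Th (c i) y), (fun _ i => dg (c i)), (fun=> S y), (fun=> q); split.
- by move=> _ i v; exact: Th0.
- by move=> _; case: SF.
- by [].
- by move=> v; rewrite big_ord1.
Qed.

(** A product of values of the covectors survives in the associated graded exactly
    when the degrees match one by one; if they do not, either a covector vanishes,
    or the coefficient lies one step deeper in the filtration. *)
Lemma monomial_gr_class :
  gr_class H F monomial_degree (@monomial_form x) monomial_cochain.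
Proof.
split; first exact: monomial_in_filtration.
  exact: (det_alternating (f := fun i w => theta (c i) w)).
move=> p v vH; set s' := monomial_degree - _.
rewrite /monomial_cochain /monomial_form.
rewrite (linear_mapZ (@grEcls_linear R n M E F x s')) /determinant !scaler_suml.
apply: eq_bigr => sg _; rewrite -!scalerA; congr (_ *: _).
have tE i : theta (c i) (tcls H x (p (sg i)) (v (sg i))) =
    if dg (c i) == p (sg i) then tau (c i) (v (sg i)) else 0 by exact: theta_tcls.
under eq_bigr => i _ do rewrite mxE tE.
under [in RHS]eq_bigr => i _ do rewrite mxE Thx.
have psum : (\sum_i (p (sg i)).+1 = \sum_i (p i).+1)%N.
  by rewrite [RHS](reindex_inj (@perm_inj _ sg)).
have [/existsP[i pr]|] := boolP [exists i, (p (sg i) < dg (c i))%N].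
  rewrite (bigD1 i)//= [in RHS](bigD1 i)//= tau0; last exact: (subvP (fH_le H x pr)).
  by rewrite if_same !mul0r !scale0r.
rewrite negb_exists => /forallP dp.
have [/forallP ep|] := boolP [forall i, dg (c i) == p (sg i)].
  have -> : s' = q.
    rewrite /s' /monomial_degree -psum addrAC.
    have -> : (\sum_i (dg (c i)).+1 = \sum_i (p (sg i)).+1)%N.
      by apply: eq_bigr => i _; rewrite (eqP (ep i)).
    by rewrite subrr add0r.
  by congr (_ *: _); apply: eq_bigr => i _; rewrite ep.
rewrite negb_forall => /existsP[i pr].
rewrite (bigD1 i)//= (negbTE pr) mul0r scale0r grEcls_eq0 ?scaler0//.
apply: (subvP (fE_le F x _)) (SF.2 x).
have lt : (\sum_i (dg (c i)).+1 < \sum_i (p i).+1)%N.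
  rewrite -psum (bigD1 i)//= [X in (_ < X)%N](bigD1 i)//= -addSn leq_add//.
    by rewrite ltnS ltn_neqAle pr leqNgt dp.
  by apply: leq_sum => j _; rewrite ltnS leqNgt dp.
rewrite /s' /monomial_degree; move: lt.
by move: (\sum_i (dg (c i)).+1)%N (\sum_i (p i).+1)%N => S1 S2; lia.
Qed.

End Monomials.

Section Uniqueness.
Variables (R : realType) (n : nat) (M : manifold R n).
Variables (H : foliated_filtration M) (E : vector_bundle M).
Variables (F : bundle_filtration E) (D : connection E) (N : subfamily (TM M)).
Variables (x : M) (k : nat).

Let TL := @TM_linear R n M.
Let EL := vector_bundle_linear E.

(** The maps [m j] are the monomials in the dual basis of the graded space, which are
    the classes of the monomials in globally extended covectors. *)
Lemma monomial_decomposition (mu : ('I_k -> tspace H x) -> grE F x) :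
  alternating_map mu ->
  exists (J : finType) (a : J -> R) (m : J -> ('I_k -> tspace H x) -> grE F x)
      (s : J -> int) (alpha : J -> Defs.form E k),
    [/\ forall w, mu w = \sum_j a j *: m j w, forall j, alternating_map (m j),
        forall j, form_k0 H (alpha j),
        forall j y, in_filtration H F (s j) (@alpha j y) &
        forall j, gr_class H F (s j) (@alpha j x) (m j)].
Proof.
move=> mua; have ml := alternating_slot_linear mua.
have [A [dg [e [tau [theta [[eH tau0 _] _ thl tht wE]]]]]] := tspace_basis H x.
have [B [qb [eb [sigma [eta [ebF _ _ _ phiE]]]]]] := grE_basis F x.
have extT a : {Th : forall y, 'Hom(TM M y, R^o) |
    [/\ forall y v, v \in H (dg a) y -> Th y v = 0, Th x = tau a &
      forall X, smooth_section setT X -> smooth_fun setT (fun y => Th y (X y) : R)]}.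
  by apply: cid; exact: (covector_extension TL (fH_subbundle H _) (@tau0 a)).
pose Th a := projT1 (extT a).
have Th0 a : forall y v, v \in H (dg a) y -> Th a y v = 0.
  by rewrite /Th; case: (extT a) => ? [].
have Thx a : Th a x = tau a by rewrite /Th; case: (extT a) => ? [].
have Ths a : forall X, smooth_vf X -> smooth_fun setT (fun y => Th a y (X y) : R).
  by rewrite /Th; case: (extT a) => ? [].
clearbody Th; clear extT.
have extS b : {s | Gamma (F (qb b)) s /\ s x = eb b}.
  by apply: cid; exact: (Gamma_extension EL (fE_subbundle F _) (ebF b)).
pose S b := projT1 (extS b).
have SF b : Gamma (F (qb b)) (S b) by rewrite /S; case: (extS b) => ? [].
have Sx b : S b x = eb b by rewrite /S; case: (extS b) => ? [].
clearbody S; clear extS.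
pose t a := tcls H x (dg a) (e a).
have mexp (w : 'I_k -> tspace H x) i : mu w = \sum_a theta a (w i) *: mu (upd w i (t a)).
  by rewrite -(slot_linear_sum (fun _ _ _ _ _ => I) I _ _ _ ml)// -wE upd_id.
have muE := alternating_expansion mua mexp.
pose J : finType := ({ffun 'I_k -> A} * B)%type.
have gc (j : J) := monomial_gr_class tau0 thl tht (Th0) Thx j.1 (SF j.2).
exists J, (fun j : J => (k`!%:R)^-1 * eta j.2 (mu (t \o j.1))),
  (fun j : J => monomial_cochain F theta (qb j.2) (S j.2) j.1),
  (fun j : J => monomial_degree dg (qb j.2) j.1),
  (fun j : J => monomial_form Th (S j.2) j.1); split.
- move=> w; rewrite muE scaler_sumr.
  rewrite -(pair_bigA _ (fun (I : {ffun 'I_k -> A}) (b : B) => ((k`!%:R)^-1 * eta b (mu (t \o I))) *: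
    monomial_cochain F theta (qb b) (S b) I w)) /=.
  apply: eq_bigr => I _; rewrite {1}(phiE (mu (t \o I))) !scaler_sumr.
  apply: eq_bigr => b _; rewrite /monomial_cochain Sx !scalerA.
  by congr (_ *: _); ring.
- by move=> j; have [] := gc j.
- by move=> j; exact: (monomial_form_k0 Th0 Ths j.1 (SF j.2)).
- by move=> j y; exact: (monomial_in_filtration Th0 j.1 (SF j.2)).
- exact: gc.
Qed.

Let operator := (('I_k -> tspace H x) -> grE F x) -> ('I_k.+1 -> tspace H x) -> grE F x.

Lemma is_gr_dN_sum (del : operator) (J : Type) (r : seq J) (a : J -> R)
    (m : J -> ('I_k -> tspace H x) -> grE F x) :
  is_gr_dN D N del -> (forall j, alternating_map (m j)) ->
  del (fun w => \sum_(j <- r) a j *: m j w) =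
    fun xi => \sum_(j <- r) a j *: del (m j) xi.
Proof.
move=> [_ dl _] ma; elim: r => [|j r IH].
  (* The value at 0 = - 1 *: 0 + 0 is 0. *)
  have z0 := @alternating0 R (tspace H x) (grE F x) k.
  have := dl (-1) _ _ z0 z0.
  under eq_fun do rewrite scaler0 addr0.
  move=> dz; apply/funext => xi; rewrite big_nil.
  under eq_fun do rewrite big_nil.
  by rewrite dz scaleN1r addNr.
under eq_fun do rewrite big_cons.
rewrite dl//; last exact: alternating_sum.
by rewrite IH; apply/funext => xi; rewrite big_cons.
Qed.

(** On the class of a form, the value of the operator is itself a class of a given
    form, and classes are unique. *)
Lemma is_gr_dN_unique (del del' : operator) mu : is_gr_dN D N del -> is_gr_dN D N del' ->
  alternating_map mu -> del mu = del' mu.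
Proof.
move=> dP dP' mua.
have [J [a [m [s [alpha [muE ma ak0 af ac]]]]]] := monomial_decomposition mua.
have -> : mu = (fun w => \sum_j a j *: m j w) by exact/funext.
rewrite (is_gr_dN_sum _ _ dP ma) (is_gr_dN_sum _ _ dP' ma).
apply/funext => xi; apply: eq_bigr => j _; congr (_ *: _).
have [_ _ c1] := dP; have [_ _ c2] := dP'.
by rewrite (gr_class_unique (c1 _ _ _ (ak0 j) (af j) (ac j)) (c2 _ _ _ (ak0 j) (af j) (ac j))).
Qed.

End Uniqueness.

Theorem proposition10p2 (R : realType) (n : nat) (M : manifold R n)
    (H : foliated_filtration M) (E : vector_bundle M) (F : bundle_filtration E)
    (D : connection E) (D_filtered : preserves_filtration H F D)
    (N : subfamily (TM M)) (N_complement : complement_of (H 0%N) N)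
    (x : M) (k : nat) (mu : ('I_k -> tspace H x) -> grE F x)
    (mu_alternating : alternating_map mu) (xi : 'I_k.+1 -> tspace H x) :
  gr_dN H F D N x k mu xi =
    CE_formula (tbracket H x) (omegabar H F D x) mu xi.
Proof.
have [bil _] := tbracket_spec H x.
have [obil _] := omegabar_spec D_filtered x.
have CE_gr : is_gr_dN (H := H) (F := F) D N (x := x) (k := k)
    (CE_formula (tbracket H x) (omegabar H F D x) (k := k)).
  split=> [nu nua|a nu nu' _ _|s alpha nu ak af ac].
  - exact: (CE_alternating bil obil (@tbracket_alt _ _ _ H x) nua).
  - by apply/funext => w; exact: CE_linear.
  - exact: CE_gr_class.
have gr_gr : is_gr_dN (H := H) (F := F) D N (x := x) (k := k) (gr_dN H F D N x k).
  by apply: (@xgetPex {classic _}); exists (CE_formula (tbracket H x) (omegabar H F D x) (k := k)).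
by rewrite (is_gr_dN_unique gr_gr CE_gr mu_alternating).
Qed.
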